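(* Let $G=(V,E,c)$ be a $p$-edge coloured digraph with $n=|V|$ and $m=|E|$. In time $O((n+m)\log(n+m))$, a canonical coarsest edge-colour stable colouring of $G$ can be computed.
   Context: For a positive integer $p$, a $p$-edge coloured digraph is a tuple $(V,E,c)$ where $(V,E)$ is a digraph that may have parallel edges and loops and $c:E\to\{1,\ldots,p\}$. For $j\in\{1,\ldots,p\}$, $v\in V$ and $C\subseteq V$, $d^+_j(v,C)$ is the number of edges $e=(v,w)$ with $w\in C$ and $c(e)=j$. A (vertex) $\ell$-colouring $\alpha:V\to\{1,\ldots,\ell\}$ is edge-colour stable if for all $u,v$ with $\alpha(u)=\alpha(v)$, all $j\in\{1,\ldots,p\}$ and all $i\in\{1,\ldots,\ell\}$, $d^+_j(u,C^\alpha_i)=d^+_j(v,C^\alpha_i)$, where $C^\alpha_i=\alpha^{-1}(i)$. A coarsest edge-colour stable colouring is one whose partition into colour classes is coarsest (with respect to refinement) among partitions of edge-colour stable colourings. An isomorphism between $p$-edge coloured digraphs $G=(V,E,c)$ and $G'=(V',E',c')$ is a bijection $h:V\to V'$ such that for all $j$ and all $u,v\in V$ (possibly equal), the number of colour-$j$ edges from $u$ to $v$ equals the number of colour-$j$ edges from $h(u)$ to $h(v)$. A colouring method is canonical if for any two such isomorphic structures and any isomorphism $h$, the computed colourings $\beta,\beta'$ satisfy $\beta(v)=\beta'(h(v))$ for all $v$. *)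

(* Defs.v *)
From mathcomp Require Import all_boot.

Set Implicit Arguments.
Unset Strict Implicit.
Unset Printing Implicit Defensive.

(* Every palette {1, ..., k} is rendered as 'I_k, i.e. shifted to start at 0. *)

Record ecdigraph (p : nat) := ECDigraph {
  vertex : finType;
  edge : finType;
  src : edge -> vertex;
  tgt : edge -> vertex;
  ecol : edge -> 'I_p
}.

Section Digraphs.
Variable p : nat.

Definition outdeg (G : ecdigraph p) (j : 'I_p) (v : vertex G)
    (C : {set vertex G}) : nat :=
  #|[set e : edge G | [&& src e == v, tgt e \in C & ecol e == j]]|.

Definition mult (G : ecdigraph p) (j : 'I_p) (u v : vertex G) : nat :=
  #|[set e : edge G | [&& src e == u, tgt e == v & ecol e == j]]|.

Definition colour_class (G : ecdigraph p) l (alpha : vertex G -> 'I_l)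
    (i : 'I_l) : {set vertex G} := [set v | alpha v == i].

Definition edge_colour_stable (G : ecdigraph p) l
    (alpha : vertex G -> 'I_l) : Prop :=
  forall u v : vertex G, alpha u = alpha v ->
  forall (j : 'I_p) (i : 'I_l),
    outdeg j u (colour_class alpha i) = outdeg j v (colour_class alpha i).

Definition colour_partition (G : ecdigraph p) l (alpha : vertex G -> 'I_l) :
    {set {set vertex G}} := preim_partition alpha [set: vertex G].

Definition refines (T : finType) (P Q : {set {set T}}) : Prop :=
  forall B, B \in P -> exists2 C, C \in Q & B \subset C.

Definition coarsest_edge_colour_stable (G : ecdigraph p) l
    (alpha : vertex G -> 'I_l) : Prop :=
  edge_colour_stable alpha /\
  forall l' (beta : vertex G -> 'I_l'), edge_colour_stable beta ->
    refines (colour_partition beta) (colour_partition alpha).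

Definition isomorphism (G G' : ecdigraph p)
    (h : vertex G -> vertex G') : Prop :=
  bijective h /\
  forall (j : 'I_p) (u v : vertex G), mult j u v = mult j (h u) (h v).

End Digraphs.

(* Computation model: a unit-cost word RAM with addition and truncated
   subtraction as its only arithmetic, programmed in structured form.  It has
   registers and a random-access memory, both indexed by nat and holding
   numbers in {0, ..., W}.  A computation that would produce a number larger
   than W has no execution. *)

Inductive expr :=
  | Cst of nat
  | Reg of nat
  | Mem of expr
  | Add of expr & expr
  | Sub of expr & expr.

Inductive cmd :=
  | Skip
  | Assign of nat & expr
  | Store of expr & expr
  | Seq of cmd & cmd
  | If of expr & cmd & cmd
  | While of expr & cmd.

Record state := State { regs : nat -> nat; memory : nat -> nat }.

Fixpoint eval (s : state) (e : expr) : nat :=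
  match e with
  | Cst k => k
  | Reg r => regs s r
  | Mem a => memory s (eval s a)
  | Add e1 e2 => eval s e1 + eval s e2
  | Sub e1 e2 => eval s e1 - eval s e2
  end.

Fixpoint fits (W : nat) (s : state) (e : expr) : bool :=
  (eval s e <= W) &&
  match e with
  | Cst _ | Reg _ => true
  | Mem a => fits W s a
  | Add e1 e2 | Sub e1 e2 => fits W s e1 && fits W s e2
  end.

Fixpoint cost (e : expr) : nat :=
  match e with
  | Cst _ | Reg _ => 1
  | Mem a => (cost a).+1
  | Add e1 e2 | Sub e1 e2 => (cost e1 + cost e2).+1
  end.

Definition set_reg (s : state) (r v : nat) : state :=
  State [eta regs s with r |-> v] (memory s).

Definition set_mem (s : state) (a v : nat) : state :=
  State (regs s) [eta memory s with a |-> v].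

(* exec W c s s' t : with word bound W, the program c started in s halts in s'
   after t unit-cost operations; a test succeeds when its value is nonzero. *)
Inductive exec (W : nat) : cmd -> state -> state -> nat -> Prop :=
  | ExecSkip s : exec W Skip s s 1
  | ExecAssign s r e : fits W s e ->
      exec W (Assign r e) s (set_reg s r (eval s e)) (cost e).+1
  | ExecStore s a e : fits W s a -> fits W s e ->
      exec W (Store a e) s (set_mem s (eval s a) (eval s e))
        (cost a + cost e).+1
  | ExecSeq c1 c2 s s1 s2 t1 t2 :
      exec W c1 s s1 t1 -> exec W c2 s1 s2 t2 ->
      exec W (Seq c1 c2) s s2 (t1 + t2)
  | ExecIf e c1 c2 s s1 t : fits W s e ->
      exec W (if eval s e != 0 then c1 else c2) s s1 t ->
      exec W (If e c1 c2) s s1 (cost e + t).+1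
  | ExecWhileEnd e c s : fits W s e -> eval s e = 0 ->
      exec W (While e c) s s (cost e).+1
  | ExecWhileStep e c s s1 s2 t1 t2 : fits W s e -> eval s e != 0 ->
      exec W c s s1 t1 -> exec W (While e c) s1 s2 t2 ->
      exec W (While e c) s s2 (cost e + t1 + t2).+1.

(* A digraph is presented to the machine by an arbitrary numbering of its
   vertices (v gets the number index v vlist) together with its edges in an
   arbitrary order. *)
Record listing p (G : ecdigraph p) := Listing {
  vlist : seq (vertex G);
  elist : seq (edge G);
  vlistP : perm_eq vlist (enum (vertex G));
  elistP : perm_eq elist (enum (edge G))
}.

Definition input p (G : ecdigraph p) (L : listing G) : seq nat :=
  [:: #|vertex G|; #|edge G|; p] ++
  flatten [seq [:: index (src e) (vlist L); index (tgt e) (vlist L);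
                   nat_of_ord (ecol e)] | e <- elist L].

Definition init_state (x : seq nat) : state :=
  State (fun=> 0) (fun a => nth 0 x a).

(* Words of k * log2 (n + m + p + 2) bits. *)
Definition word_bound (k p : nat) (G : ecdigraph p) : nat :=
  (#|vertex G| + #|edge G| + p + 2) ^ k.

(* The program c, with word-size parameter k, halts on the listing L of G after
   t steps with the palette size l in cell 0 and the colour of the i-th vertex
   in cell i + 1. *)
Definition computes_colouring (c : cmd) (k p : nat) (G : ecdigraph p)
    (L : listing G) (t l : nat) (alpha : vertex G -> 'I_l) : Prop :=
  exists s : state,
    [/\ exec (word_bound k G) c (init_state (input L)) s t,
        memory s 0 = l
      & forall v, memory s (index v (vlist L)).+1 = alpha v].

Definition canonical (c : cmd) (k : nat) : Prop :=
  forall (p : nat) (G G' : ecdigraph p) (L : listing G) (L' : listing G')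
    (t t' l l' : nat) (beta : vertex G -> 'I_l) (beta' : vertex G' -> 'I_l')
    (h : vertex G -> vertex G'),
  0 < p ->
  computes_colouring c k L t beta -> computes_colouring c k L' t' beta' ->
  isomorphism h ->
  forall v : vertex G, beta v = beta' (h v) :> nat.

(* The summand 1 only matters for n + m <= 1, where N log N vanishes. *)
Definition nlogn (N : nat) : nat := N * trunc_log 2 N + 1.

(* Main.v *)
(* Hopcroft's "process the smaller half" refinement, run on the digraph in which
   every edge is subdivided by a node that carries its colour, so that arcs have
   no colours.  Classes are intervals of an array of nodes and are named by their
   start positions.  Processing a class R splits every class by the number of
   arcs into R, one level set {v | at least k arcs into R} after the other; the
   marked part of a class with a unmarked nodes and start position s becomes the
   class s + a.  This new name depends only on the sizes of the parts, and not on
   the order in which the classes are split; together with always processing the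
   pending class with the largest name, found by a tournament tree, this makes
   the result canonical.

   Stability: two equivalent nodes that have equally many arcs into each pending
   class have equally many arcs into each class.  Time: the potential
   sum_v (1 + indeg v) (log |class of v| + [class of v pending]) pays for the
   scans, and each split pays for one tree insertion and one removal. *)
Require Import Defs.
From mathcomp Require Import all_boot.
From mathcomp Require Import zify.

Set Implicit Arguments.
Unset Strict Implicit.
Unset Printing Implicit Defensive.

(** The number [p] of edge colours is not bounded in terms of N = n + m, so no step may take time
    proportional to [p]: there is neither a counting sort over the palette nor a tree with one leaf
    per colour. Memory starts at zero and is unlimited, though, so cells may be addressed by
    colours, and a colour that occurs borrows as its leaf the node of the first edge carrying it.
    The logarithmic tree operations fit into the time bound because every split creates a new name,
    so there are fewer than N splits. Degrees are not sorted: a node enters bucket k when its count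
    reaches k, so the buckets are the level sets and have one entry per scanned arc. The order of
    the listing does influence the concrete run, through the positions inside classes and the order
    of the stack. Abstract runs are therefore relations; any two of them on isomorphic data end with
    corresponding names, and the program realises one of them. Numbers stay within a word because
    each unit of source time raises the largest stored value by at most one: the bound on values
    follows from the bound on time, without an invariant for each variable. *)

Lemma exec_det W c s s1 t1 s2 t2 :
  exec W c s s1 t1 -> exec W c s s2 t2 -> s1 = s2 /\ t1 = t2.
Proof.
move=> H; elim: H s2 t2 => {c s s1 t1} [s|s r e _|s a e _ _
  |c1 c2 s s1 s2 t1 t2 _ IH1 _ IH2|s e c1 c2 s1 t _ _ IH|e c s _ e0
  |e c s s1 s2 t1 t2 _ n0 _ IH1 _ IH2] s3 t3 H; inversion H; subst => //;
  try by rewrite e0 in n0 || match goal with X : is_true (eval _ _ != 0) |- _ =>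
    by rewrite e0 in X end.
- by repeat match goal with I : forall s2 t2, exec W ?c ?s s2 t2 -> _,
    X : exec W ?c ?s _ _ |- _ => case: (I _ _ X) => ??; subst; clear X end.
- by repeat match goal with I : forall s2 t2, exec W ?c ?s s2 t2 -> _,
    X : exec W ?c ?s _ _ |- _ => case: (I _ _ X) => ??; subst; clear X end.
- by match goal with X : eval _ _ = 0 |- _ => rewrite X in n0 end.
- by repeat match goal with I : forall s2 t2, exec W ?c ?s s2 t2 -> _,
    X : exec W ?c ?s _ _ |- _ => case: (I _ _ X) => ??; subst; clear X end.
Qed.

(** * A language with arrays, compiled to the RAM *)

Inductive hexpr :=
  | HC of nat
  | HV of nat
  | HA of nat & hexpr
  | HAdd of hexpr & hexpr
  | HSub of hexpr & hexpr
  | HMax of hexpr & hexpr.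

Inductive hcmd :=
  | HSkip
  | HSet of nat & hexpr
  | HPut of nat & hexpr & hexpr
  | HGet of nat & hexpr
  | HOut of hexpr & hexpr
  | HSeq of hcmd & hcmd
  | HIf of hexpr & hcmd & hcmd
  | HWhile of hexpr & hcmd.

Record hst := HSt { hv : nat -> nat; ha : nat -> nat -> nat; lo : nat -> nat }.

Definition updf (g : nat -> nat) i v : nat -> nat :=
  fun j => if j == i then v else g j.

(** [eqn] reduces under [/=] on literal variable and array numbers, so reading a state after a chain
    of assignments computes; the cell index inside an array stays a symbolic test in [updf]. *)
Definition setv st x v :=
  HSt (fun y => if eqn y x then v else hv st y) (ha st) (lo st).
Definition seta st k i v :=
  HSt (hv st) (fun k' => if eqn k' k then updf (ha st k) i v else ha st k')
    (lo st).
Definition setl st i v := HSt (hv st) (ha st) (updf (lo st) i v).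

Fixpoint heval st e : nat :=
  match e with
  | HC k => k
  | HV x => hv st x
  | HA k e => ha st k (heval st e)
  | HAdd e1 e2 => heval st e1 + heval st e2
  | HSub e1 e2 => heval st e1 - heval st e2
  | HMax e1 e2 => maxn (heval st e1) (heval st e2)
  end.

(* The bound B separates the low memory, which holds the input and the output,
   from the arrays. *)
Inductive hexec (B : nat) : hcmd -> hst -> hst -> nat -> Prop :=
  | XSkip st : hexec B HSkip st st 1
  | XSet st x e : hexec B (HSet x e) st (setv st x (heval st e)) 1
  | XPut st k a e :
      hexec B (HPut k a e) st (seta st k (heval st a) (heval st e)) 1
  | XGet st x a : heval st a < B ->
      hexec B (HGet x a) st (setv st x (lo st (heval st a))) 1
  | XOut st a e : heval st a < B ->
      hexec B (HOut a e) st (setl st (heval st a) (heval st e)) 1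
  | XSeq c1 c2 st st1 st2 t1 t2 :
      hexec B c1 st st1 t1 -> hexec B c2 st1 st2 t2 ->
      hexec B (HSeq c1 c2) st st2 (t1 + t2)
  | XIf st e c1 c2 st1 t :
      hexec B (if heval st e != 0 then c1 else c2) st st1 t ->
      hexec B (HIf e c1 c2) st st1 t.+1
  | XWhileEnd e c st : heval st e = 0 -> hexec B (HWhile e c) st st 1
  | XWhileStep e c st st1 st2 t1 t2 : heval st e != 0 ->
      hexec B c st st1 t1 -> hexec B (HWhile e c) st1 st2 t2 ->
      hexec B (HWhile e c) st st2 (t1 + t2).+1.

Section Compilation.

(* Number of arrays: cell i of array k lies at address n + 3m + 3 + k + K i. *)
Variable K : nat.

(** The input fills [3m + 3] cells and the output [n + 1], so all their addresses lie below this
    base. *)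
Definition base_expr := Add (Reg 0) (Add (Reg 1) (Add (Reg 1)
  (Add (Reg 1) (Cst 3)))).

Fixpoint times_expr j e := if j is j'.+1 then Add e (times_expr j' e) else Cst 0.

(** Interleaving leaves every array unbounded, so that no size has to be fixed for the arrays
    addressed by colours. *)
Definition addr_expr k e := Add base_expr (Add (Cst k) (times_expr K e)).

(** Registers 0 and 1 are reserved for n and m, which every address computation uses. The maximum of
    a and b is a + (b - a) with truncated subtraction. *)
Fixpoint cexpr e : expr :=
  match e with
  | HC k => Cst k
  | HV x => Reg x.+2
  | HA k e => Defs.Mem (addr_expr k (cexpr e))
  | HAdd e1 e2 => Add (cexpr e1) (cexpr e2)
  | HSub e1 e2 => Defs.Sub (cexpr e1) (cexpr e2)
  | HMax e1 e2 => Add (cexpr e1) (Defs.Sub (cexpr e2) (cexpr e1))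
  end.

Fixpoint ccmd c : cmd :=
  match c with
  | HSkip => Skip
  | HSet x e => Assign x.+2 (cexpr e)
  | HPut k a e => Store (addr_expr k (cexpr a)) (cexpr e)
  | HGet x a => Assign x.+2 (Defs.Mem (cexpr a))
  | HOut a e => Store (cexpr a) (cexpr e)
  | HSeq c1 c2 => Seq (ccmd c1) (ccmd c2)
  | HIf e c1 c2 => If (cexpr e) (ccmd c1) (ccmd c2)
  | HWhile e c => While (cexpr e) (ccmd c)
  end.

Fixpoint wfe e : bool :=
  match e with
  | HC _ | HV _ => true
  | HA k e => (k < K) && wfe e
  | HAdd e1 e2 | HSub e1 e2 | HMax e1 e2 => wfe e1 && wfe e2
  end.

(* Expressions that evaluate to at most the largest value stored so far. *)
Fixpoint steady e : bool :=
  match e with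
  | HC k => k <= 1
  | HV _ | HA _ _ => true
  | HAdd _ _ => false
  | HSub e _ => steady e
  | HMax e1 e2 => steady e1 && steady e2
  end.

(** The only sum that may be stored is a successor; other sums occur in addresses and tests. Hence
    one unit of time raises the maximum by at most one. *)
Definition slow e : bool := if e is HAdd e1 (HC 1) then steady e1 else steady e.

Fixpoint wfc c : bool :=
  match c with
  | HSkip => true
  | HSet x e => wfe e && slow e
  | HPut k a e => [&& k < K, wfe a, wfe e & slow e]
  | HGet x a => wfe a
  | HOut a e => [&& wfe a, wfe e & slow e]
  | HSeq c1 c2 => wfc c1 && wfc c2
  | HIf e c1 c2 => [&& wfe e, wfc c1 & wfc c2]
  | HWhile e c => wfe e && wfc c
  end.

(* Bounds both the cost of an expression and, relative to the largest stored
   value, all the numbers met while evaluating it. *)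
Fixpoint weight e : nat :=
  match e with
  | Cst k => k.+1
  | Reg _ => 1
  | Defs.Mem a => (weight a).+1
  | Add e1 e2 | Defs.Sub e1 e2 => (weight e1 + weight e2).+1
  end.

Definition bounded X s := (forall r, regs s r <= X) /\ forall a, memory s a <= X.

Lemma cost_le_weight e : cost e <= weight e.
Proof. by elim: e => //= *; lia. Qed.

Lemma eval_le_weight X s e : 0 < X -> bounded X s -> eval s e <= weight e * X.
Proof.
move=> X0 [bR bM]; elim: e => [k|r|a IH|e1 IH1 e2 IH2|e1 IH1 e2 IH2] /=.
- by rewrite mulSn; nia.
- by rewrite mul1n.
- by rewrite mulSn; have := bM (eval s a); lia.
- by rewrite mulSn mulnDl; lia.
- by rewrite mulSn mulnDl; lia.
Qed.

Lemma fits_weight W X s e : 0 < X -> bounded X s -> weight e * X <= W ->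
  fits W s e.
Proof.
move=> X0 bs; elim: e => [k|r|a IH|e1 IH1 e2 IH2|e1 IH1 e2 IH2] le;
  have := leq_trans (eval_le_weight _ X0 bs) le; move: le;
  rewrite /= ?mulSn ?mulnDl => le -> //=.
- by apply: IH; lia.
- by rewrite IH1 ?IH2 //; lia.
- by rewrite IH1 ?IH2 //; lia.
Qed.

Definition simul n m s st :=
  [/\ regs s 0 = n, regs s 1 = m, forall x, regs s x.+2 = hv st x,
      forall k i, k < K -> memory s (n + 3 * m + 3 + k + K * i) = ha st k i
    & forall a, a < n + 3 * m + 3 -> memory s a = lo st a].

Lemma eval_times s j e : eval s (times_expr j e) = j * eval s e.
Proof. by elim: j => //= j ->; rewrite mulSn. Qed.

Lemma eval_addr n m s st k e : simul n m s st ->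
  eval s (addr_expr k e) = n + 3 * m + 3 + k + K * eval s e.
Proof. by case=> r0 r1 _ _ _; rewrite /= eval_times r0 r1; lia. Qed.

Lemma eval_cexpr n m s st e : simul n m s st -> wfe e ->
  eval s (cexpr e) = heval st e.
Proof.
move=> si; elim: e => //=; try by move=> e1 IH1 e2 IH2 /andP[w1 w2]; rewrite IH1 ?IH2 //; lia.
- by move=> x _; case: si.
- move=> k e IH /andP[kK we]; rewrite -[X in memory _ X]/(eval s (addr_expr k (cexpr e))).
  by rewrite (eval_addr _ _ si) IH //; case: si => _ _ _ -> .
Qed.

Lemma steady_le X s e : 0 < X -> bounded X s -> steady e ->
  eval s (cexpr e) <= X.
Proof.
move=> X0 [bR bM]; elim: e => [k|r|k e IH|e1 IH1 e2 _|e1 IH1 e2 _|e1 IH1 e2 IH2] //=.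
- by lia.
- by move=> /IH1; lia.
- by move=> /andP[/IH1 ? /IH2 ?]; lia.
Qed.

Lemma slow_le X s e : 0 < X -> bounded X s -> slow e ->
  eval s (cexpr e) <= X.+1.
Proof.
move=> X0 bs; case: e => [k|x|k e|e1 e2|e1 e2|e1 e2];
  try by move=> se; apply/leqW/steady_le.
case: e2 => // -[|[|k]] //= se.
by have := steady_le X0 bs se; lia.
Qed.

Fixpoint cmd_weight c : nat :=
  match c with
  | Skip => 1
  | Assign _ e => (weight e).+1
  | Store a e => (weight a + weight e).+1
  | Seq c1 c2 => cmd_weight c1 + cmd_weight c2
  | If e c1 c2 => (weight e + cmd_weight c1 + cmd_weight c2).+1
  | While e c => (weight e + cmd_weight c).+1
  end.

Lemma bounded_mono X Y s : X <= Y -> bounded X s -> bounded Y s.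
Proof. by move=> XY [bR bM]; split=> i; apply: leq_trans XY. Qed.

Lemma bounded_set_reg X s r v : v <= X -> bounded X s -> bounded X (set_reg s r v).
Proof. by move=> vX [bR bM]; split=> //= i; case: eqP. Qed.

Lemma bounded_set_mem X s a v : v <= X -> bounded X s -> bounded X (set_mem s a v).
Proof. by move=> vX [bR bM]; split=> //= i; case: eqP. Qed.

Lemma simul_setv n m s st x v : simul n m s st ->
  simul n m (set_reg s x.+2 v) (setv st x v).
Proof.
case=> r0 r1 rx ar low; split=> //= y.
by rewrite -[eqn y x]/(y == x) !eqSS; case: eqP.
Qed.

Lemma simul_seta n m s st k i v : k < K -> simul n m s st ->
  simul n m (set_mem s (n + 3 * m + 3 + k + K * i) v) (seta st k i v).
Proof.
move=> kK [r0 r1 rx ar low]; split=> //=.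
- move=> k' i' k'K; rewrite -[eqn k' k]/(k' == k) /updf.
  case: eqP => [e|ne].
    (* Both numbers can be read off [k + K * i] because [k] and [k'] are below [K]. *)
    have [ei ek] : i' = i /\ k' = k.
      have e' : k' + K * i' = k + K * i by lia.
      have ei : i' = i by case: (ltngtP i' i) => // ?; nia.
      by split=> //; move: e'; rewrite ei; lia.
    by rewrite ei ek !eqxx.
  case: eqP => [ek|]; last by rewrite ar.
  by case: eqP => [ei|_]; [case: ne; rewrite ek ei | rewrite ar // ek].
- by move=> a aB; case: eqP => [e|_]; [lia | exact: low].
Qed.

Lemma simul_setl n m s st a v : a < n + 3 * m + 3 -> simul n m s st ->
  simul n m (set_mem s a v) (setl st a v).
Proof.
move=> aB [r0 r1 rx ar low]; split=> //=.
- by move=> k i kK; case: eqP => [e|_]; [lia | exact: ar].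
- by move=> b bB; rewrite /updf; case: eqP => // _; exact: low.
Qed.

(* A unit of time raises the largest stored value by at most 1, so that all
   numbers stay within Q times the initial bound plus the running time. *)
Lemma ccmd_correct n m W Q c st st' t :
  hexec (n + 3 * m + 3) c st st' t ->
  wfc c -> cmd_weight (ccmd c) <= Q ->
  forall s X, simul n m s st -> 0 < X -> bounded X s -> Q * (X + t) <= W ->
  exists s' t', [/\ exec W (ccmd c) s s' t', t' <= Q * t, simul n m s' st'
    & bounded (X + t) s'].
Proof.
move=> H; elim: H => {c st st' t}.
- move=> st _ Q1 s X si X0 bs _; exists s, 1; split=> //; first exact: ExecSkip.
    by rewrite muln1.
  by apply: bounded_mono bs; lia.
- move=> st x e /= /andP[we sl] Qw s X si X0 bs QW.
  have cw := cost_le_weight (cexpr e).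
  exists (set_reg s x.+2 (eval s (cexpr e))), (cost (cexpr e)).+1; split.
  + by apply: ExecAssign; apply: (fits_weight X0 bs); nia.
  + by lia.
  + by rewrite -(eval_cexpr si we); apply: simul_setv.
  + apply: bounded_set_reg; first by rewrite addn1; exact: slow_le.
    by apply: bounded_mono bs; lia.
- move=> st k a e /and4P[kK wa we sl] Qw s X si X0 bs QW.
  have {}Qw : (weight (addr_expr k (cexpr a)) + weight (cexpr e)).+1 <= Q := Qw.
  have cw := cost_le_weight (cexpr e).
  have cw' := cost_le_weight (addr_expr k (cexpr a)).
  rewrite [ccmd _]/=; set A := addr_expr _ _ in Qw cw' *.
  exists (set_mem s (eval s A) (eval s (cexpr e))), (cost A + cost (cexpr e)).+1; split.
  + by apply: ExecStore; apply: (fits_weight X0 bs); nia.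
  + by lia.
  + rewrite -(eval_cexpr si we) (eval_addr _ _ si) (eval_cexpr si wa).
    exact: simul_seta.
  + apply: bounded_set_mem; first by rewrite addn1; exact: slow_le.
    by apply: bounded_mono bs; lia.
- move=> st x a aB /= wa Qw s X si X0 bs QW.
  have cw := cost_le_weight (cexpr a).
  exists (set_reg s x.+2 (eval s (Defs.Mem (cexpr a)))), (cost (Defs.Mem (cexpr a))).+1; split.
  + by apply: ExecAssign; apply: (fits_weight X0 bs) => /=; nia.
  + by rewrite /=; lia.
  + rewrite /= (eval_cexpr si wa); case: (si) => _ _ _ _ -> //.
    exact: simul_setv.
  + apply: bounded_set_reg; first by case: bs => _ bM; apply: leq_trans (bM _) _; lia.
    by apply: bounded_mono bs; lia.
- move=> st a e aB /= /and3P[wa we sl] Qw s X si X0 bs QW.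
  have cw := cost_le_weight (cexpr e).
  have cw' := cost_le_weight (cexpr a).
  exists (set_mem s (eval s (cexpr a)) (eval s (cexpr e))), (cost (cexpr a) + cost (cexpr e)).+1; split.
  + by apply: ExecStore; apply: (fits_weight X0 bs); nia.
  + by lia.
  + rewrite -(eval_cexpr si we) (eval_cexpr si wa).
    exact: simul_setl.
  + apply: bounded_set_mem; first by rewrite addn1; exact: slow_le.
    by apply: bounded_mono bs; lia.
- move=> c1 c2 st st1 st2 t1 t2 _ IH1 _ IH2 /= /andP[w1 w2] Qw s X si X0 bs QW.
  have [||s1 [t1' [x1 l1 si1 bs1]]] := IH1 w1 _ s X si X0 bs; [lia|nia|].
  have [|||s2 [t2' [x2 l2 si2 bs2]]] := IH2 w2 _ s1 (X + t1) si1 _ bs1; [lia|lia|nia|].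
  exists s2, (t1' + t2'); split=> //; first exact: ExecSeq x1 x2.
    by lia.
  by rewrite addnA.
- move=> st e c1 c2 st1 t _ IH /= /and3P[we w1 w2] Qw s X si X0 bs QW.
  have cw := cost_le_weight (cexpr e).
  have [|||s1 [t1' [x1 l1 si1 bs1]]] := IH _ _ s X si X0 bs.
  + by case: ifP.
  + by case: ifP => _; lia.
  + by nia.
  have [R [T [xx lT siT bT]]] : exists R T, [/\ exec W (if eval s (cexpr e) != 0 then ccmd c1 else ccmd c2) s R T, T <= Q * t, simul n m R st1 & bounded (X+t) R].
    by exists s1, t1'; rewrite (eval_cexpr si we); split=> //; move: x1; case: ifP.
  exists R, (cost (cexpr e) + T).+1; split=> //.
  + by apply: ExecIf xx; apply: (fits_weight X0 bs); nia.
  + by nia.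
  + by apply: bounded_mono bT; lia.
- move=> e c st e0 /= /andP[we wc] Qw s X si X0 bs QW.
  have cw := cost_le_weight (cexpr e).
  exists s, (cost (cexpr e)).+1; split=> //.
  + by apply: ExecWhileEnd; [apply: (fits_weight X0 bs); nia | rewrite (eval_cexpr si we)].
  + by lia.
  + by apply: bounded_mono bs; lia.
- move=> e c st st1 st2 t1 t2 e0 _ IH1 _ IH2 /= wec Qw s X si X0 bs QW.
  have /andP[we wc] := wec.
  have cw := cost_le_weight (cexpr e).
  have [||s1 [t1' [x1 l1 si1 bs1]]] := IH1 wc _ s X si X0 bs; [lia|by apply: leq_trans QW; rewrite leq_mul2l; lia|].
  have [|||s2 [t2' [x2 l2 si2 bs2]]] := IH2 wec _ s1 (X + t1) si1 _ bs1; [exact: Qw|lia|by apply: leq_trans QW; rewrite leq_mul2l; lia|].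
  exists s2, (cost (cexpr e) + t1' + t2').+1; split=> //.
  + apply: ExecWhileStep x1 x2; last by rewrite (eval_cexpr si we).
    by apply: (fits_weight X0 bs); nia.
  + by nia.
  + by apply: bounded_mono bs2; lia.
Qed.

End Compilation.

(** * Program logic *)

Section ProgramLogic.

Variable B : nat.

Definition hrun c st (Q : hst -> nat -> Prop) :=
  exists st' t, hexec B c st st' t /\ Q st' t.

Fixpoint vwrites c : seq nat :=
  match c with
  | HSet x _ | HGet x _ => [:: x]
  | HSeq c1 c2 | HIf _ c1 c2 => vwrites c1 ++ vwrites c2
  | HWhile _ c => vwrites c
  | _ => [::]
  end.

Fixpoint awrites c : seq nat :=
  match c with
  | HPut k _ _ => [:: k]
  | HSeq c1 c2 | HIf _ c1 c2 => awrites c1 ++ awrites c2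
  | HWhile _ c => awrites c
  | _ => [::]
  end.

Fixpoint lwrites c : bool :=
  match c with
  | HOut _ _ => true
  | HSeq c1 c2 | HIf _ c1 c2 => lwrites c1 || lwrites c2
  | HWhile _ c => lwrites c
  | _ => false
  end.

Definition frame c st st' :=
  [/\ forall x, x \notin vwrites c -> hv st' x = hv st x,
      forall k, k \notin awrites c -> ha st' k = ha st k
    & ~~ lwrites c -> lo st' = lo st].

Lemma frame_refl c st : frame c st st. Proof. by []. Qed.

Lemma frame_trans c st1 st2 st3 :
  frame c st1 st2 -> frame c st2 st3 -> frame c st1 st3.
Proof.
case=> v1 a1 l1 [v2 a2 l2]; split=> [x|k|] w.
- by rewrite v2 ?v1.
- by rewrite a2 ?a1.
- by rewrite l2 ?l1.
Qed.

Lemma hexec_frame c st st' t : hexec B c st st' t -> frame c st st'.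
Proof.
elim=> {c st st' t} //.
- move=> st x e; split=> //= y; rewrite inE.
  by rewrite -[eqn y x]/(y == x); case: eqP.
- move=> st k a e; split=> //= j; rewrite inE.
  by rewrite -[eqn j k]/(j == k); case: eqP.
- move=> st x e _; split=> //= y; rewrite inE.
  by rewrite -[eqn y x]/(y == x); case: eqP.
- move=> c1 c2 st st1 st2 t1 t2 _ [v1 a1 l1] _ [v2 a2 l2]; split=> /= [x|k|].
  + by rewrite mem_cat negb_or => /andP[w1 w2]; rewrite v2 ?v1.
  + by rewrite mem_cat negb_or => /andP[w1 w2]; rewrite a2 ?a1.
  + by rewrite negb_or => /andP[w1 w2]; rewrite l2 ?l1.
- move=> st e c1 c2 st1 t _ [v1 a1 l1]; split=> /= [x|k|].
  + by rewrite mem_cat negb_or => /andP[w1 w2]; apply: v1; case: ifP.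
  + by rewrite mem_cat negb_or => /andP[w1 w2]; apply: a1; case: ifP.
  + by rewrite negb_or => /andP[w1 w2]; apply: l1; case: ifP.
- by move=> e c st st1 st2 t1 t2 _ _ f1 _ f2; exact: (frame_trans f1 f2).
Qed.

(** A postcondition may assume what the syntax of the command leaves untouched, so that
    specifications mention only what changes. *)
Lemma hrun_frame c st Q :
  hrun c st (fun st' t => frame c st st' -> Q st' t) -> hrun c st Q.
Proof.
by case=> st' [t [x q]]; exists st', t; split=> //; apply: q; exact: hexec_frame x.
Qed.

Lemma hrun_mono c st Q Q' :
  (forall st' t, Q st' t -> Q' st' t) -> hrun c st Q -> hrun c st Q'.
Proof. by move=> QQ' [st' [t [x q]]]; exists st', t; split=> //; exact: QQ'. Qed.

(** Straight-line code is executed by [/=]; a loop is left as a [hrun] goal for the loop rules. *)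
Fixpoint wp c st (Q : hst -> nat -> Prop) : Prop :=
  match c with
  | HSkip => Q st 1
  | HSet x e => Q (setv st x (heval st e)) 1
  | HPut k a e => Q (seta st k (heval st a) (heval st e)) 1
  | HGet x a => heval st a < B /\ Q (setv st x (lo st (heval st a))) 1
  | HOut a e => heval st a < B /\ Q (setl st (heval st a) (heval st e)) 1
  | HSeq c1 c2 =>
      wp c1 st (fun st1 t1 => wp c2 st1 (fun st2 t2 => Q st2 (t1 + t2)))
  | HIf e c1 c2 =>
      (heval st e <> 0 -> wp c1 st (fun st' t => Q st' t.+1)) /\
      (heval st e = 0 -> wp c2 st (fun st' t => Q st' t.+1))
  | HWhile e c => hrun (HWhile e c) st Q
  end.

Lemma wpP c st Q : wp c st Q <-> hrun c st Q.
Proof.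
elim: c st Q => [|x e|k a e|x a|a e|c1 IH1 c2 IH2|e c1 IH1 c2 IH2|e c IH] st Q /=.
- split=> [q|[st' [t [x q]]]]; first by exists st, 1; split=> //; exact: XSkip.
  by inversion x; subst.
- split=> [q|[st' [t [H q]]]]; first by eexists _, _; split; [exact: XSet|].
  by inversion H; subst.
- split=> [q|[st' [t [H q]]]]; first by eexists _, _; split; [exact: XPut|].
  by inversion H; subst.
- split=> [[aB q]|[st' [t [H q]]]]; first by eexists _, _; split; [exact: XGet|].
  by inversion H; subst.
- split=> [[aB q]|[st' [t [H q]]]]; first by eexists _, _; split; [exact: XOut|].
  by inversion H; subst.
- split.
    case/IH1=> st1 [t1 [x1 /IH2[st2 [t2 [x2 q]]]]].
    by exists st2, (t1 + t2); split=> //; exact: XSeq x1 x2.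
  case=> st' [t [H q]]; inversion H as [| | | | |a b d st1 f t1 t2 x1 x2| | |]; subst.
  by apply/IH1; exists st1, t1; split=> //; apply/IH2; exists st', t2.
- split.
    case: (eqVneq (heval st e) 0) => e0 [q1 q2].
      have /IH2[st' [t [x q]]] := q2 e0.
      by exists st', t.+1; split=> //; apply: XIf; rewrite e0.
    have /IH1[st' [t [x q]]] := q1 (elimN eqP e0).
    by exists st', t.+1; split=> //; apply: XIf; rewrite e0.
  case=> st' [t [H q]]; inversion H as [| | | | | |a b d f st1 t1 x1| |]; subst.
  split=> e0.
    by apply/IH1; exists st', t1; split=> //; move: x1; case: eqP.
  by apply/IH2; exists st', t1; split=> //; move: x1; rewrite e0.
- by [].
Qed.

Lemma hrun_seq c1 c2 st Q :
  hrun c1 st (fun st1 t1 => hrun c2 st1 (fun st2 t2 => Q st2 (t1 + t2))) ->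
  hrun (HSeq c1 c2) st Q.
Proof.
case=> st1 [t1 [x1 [st2 [t2 [x2 q]]]]]; exists st2, (t1 + t2); split=> //.
exact: XSeq x1 x2.
Qed.

Lemma hrun_while e c st Q :
  (heval st e = 0 -> Q st 1) ->
  (heval st e <> 0 -> hrun c st (fun st1 t1 =>
     hrun (HWhile e c) st1 (fun st2 t2 => Q st2 (t1 + t2).+1))) ->
  hrun (HWhile e c) st Q.
Proof.
move=> q0 q1; case: (eqVneq (heval st e) 0) => e0.
  by exists st, 1; split; [exact: XWhileEnd | exact: q0].
have [st1 [t1 [x1 [st2 [t2 [x2 q]]]]]] := q1 (elimN eqP e0).
by exists st2, (t1 + t2).+1; split=> //; exact: XWhileStep x1 x2.
Qed.

(** A loop rule whose invariant refers to the ghost list of the elements already handled. The cost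
    [tau x] may depend on the element, as it does for nodes with different numbers of predecessors;
    the successor pays for the test of that round and the final 1 for the failing test. *)
Lemma hrun_list (T : Type) (I : seq T -> hst -> Prop) (s : seq T) tau e c st Q :
  I [::] st ->
  (forall s1 x s2 st', s = s1 ++ x :: s2 -> I s1 st' -> frame c st st' ->
     heval st' e <> 0 /\
     hrun c st' (fun st2 t => I (rcons s1 x) st2 /\ t <= tau x)) ->
  (forall st' t, I s st' -> frame c st st' ->
     t <= \sum_(x <- s) (tau x).+1 + 1 -> heval st' e = 0 /\ Q st' t) ->
  hrun (HWhile e c) st Q.
Proof.
move=> I0 Istep Iend.
suff gen s2 : forall s1 st' t0, s = s1 ++ s2 -> I s1 st' -> frame c st st' ->
    t0 <= \sum_(x <- s1) (tau x).+1 ->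
    hrun (HWhile e c) st' (fun st2 t => Q st2 (t0 + t)).
  have := gen s [::] st 0 erefl I0 (@frame_refl c st) (leq0n _).
  exact: hrun_mono.
elim: s2 => [|x s2 IH] s1 st' t0 es Is1 fr t0le.
  rewrite cats0 in es; subst s1.
  have [e0 q] := Iend st' (t0 + 1) Is1 fr (leq_add t0le (leqnn 1)).
  by apply: hrun_while.
have [e0 [st1 [t1 [x1 [Ix tx]]]]] := Istep _ _ _ _ es Is1 fr.
apply: hrun_while => // _; exists st1, t1; split=> //.
have := IH (rcons s1 x) st1 (t0 + t1.+1).
rewrite cat_rcons big_rcons /=; have fr1 := hexec_frame x1.
case=> // [||st2 [t2 [x2 q]]]; first exact: (frame_trans fr fr1).
  by lia.
by exists st2, t2; split=> //; move: q; rewrite -addnA addSn.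
Qed.

Lemma hrun_count (I : nat -> hst -> Prop) a b tau e c st Q : a <= b ->
  I a st ->
  (forall i st', a <= i < b -> I i st' -> frame c st st' ->
     heval st' e <> 0 /\
     hrun c st' (fun st2 t => I i.+1 st2 /\ t <= tau)) ->
  (forall st' t, I b st' -> frame c st st' ->
     t <= (b - a) * tau.+1 + 1 -> heval st' e = 0 /\ Q st' t) ->
  hrun (HWhile e c) st Q.
Proof.
move=> ab I0 Istep Iend.
apply: (@hrun_list nat (fun s => I (a + size s)) (iota a (b - a)) (fun=> tau)).
- by rewrite addn0.
- move=> s1 x s2 st' es Is1 fr.
  have sz := congr1 size es; rewrite size_iota size_cat /= in sz.
  by rewrite size_rcons addnS; apply: Istep => //; lia.
- move=> st' t; rewrite size_iota subnKC // => Ib fr.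
  by rewrite big_const_seq count_predT size_iota iter_addn_0 mulnC; exact: Iend.
Qed.

End ProgramLogic.

(** * Ordered partition refinement *)

Lemma eq_bigl_in (T : eqType) (s : seq T) (p q : pred T) F :
  {in s, p =1 q} -> \sum_(x <- s | p x) F x = \sum_(x <- s | q x) F x.
Proof.
move=> pq; rewrite big_seq_cond [RHS]big_seq_cond; apply: eq_bigl => x.
by case xs: (x \in s) => //=; exact: pq.
Qed.

(** On [s], [p] is a union of fibres of [b], so equal sums over the fibres add up. This carries
    stability from the classes of a partition to unions of its classes. *)
Lemma sum_fibres (I T : eqType) (s : seq I) (b : I -> T) (p : pred I) F G :
  {in s &, forall x y, b x = b y -> p x = p y} ->
  (forall k, \sum_(x <- s | b x == k) F x = \sum_(x <- s | b x == k) G x) ->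
  \sum_(x <- s | p x) F x = \sum_(x <- s | p x) G x.
Proof.
move=> pb FG.
have fib H : \sum_(x <- s | p x) H x =
    \sum_(k <- undup (map b s)) \sum_(x <- s | p x && (b x == k)) H x.
  rewrite (exchange_big_dep p) //=; last by move=> k x _ /andP[].
  rewrite big_seq_cond [RHS]big_seq_cond; apply: eq_bigr => x /andP[xs px].
  rewrite (eq_bigl (pred1 (b x))); last by move=> k; rewrite px /= eq_sym.
  rewrite -big_filter filter_pred1_uniq ?undup_uniq ?mem_undup ?map_f //.
  by rewrite big_seq1.
rewrite !fib big_seq [RHS]big_seq; apply: eq_bigr => k.
rewrite mem_undup => /mapP[x0 x0s kE].
case p0: (p x0).
  have e H : \sum_(x <- s | p x && (b x == k)) H x = \sum_(x <- s | b x == k) H x.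
    apply: eq_bigl_in => x xs; case: eqP => [e|_]; last by rewrite andbF.
    by rewrite andbT (pb x x0) // e.
  by rewrite !e.
have e H : \sum_(x <- s | p x && (b x == k)) H x = 0.
  rewrite big_seq_cond big1 // => x /andP[xs /andP[px /eqP e]].
  by rewrite (pb x x0) ?p0 // e in px.
by rewrite !e.
Qed.

(** An entry of [s] has a single value under [f], so it is counted for at most one member of [S]. *)
Lemma sum_count_uniq (I T : eqType) (S : seq T) (s : seq I) (f : I -> T) :
  uniq S -> \sum_(x <- S) count (fun i => f i == x) s <= size s.
Proof.
move=> uS; elim: s => [|i s IH] /=; first by rewrite big1.
rewrite big_split /=; suff : \sum_(x <- S) (f i == x) <= 1 by lia.
have [iS|/negP iS] := boolP (f i \in S).
  rewrite (eq_bigr (fun x => if x == f i then 1 else 0)).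
    by rewrite -big_mkcond -big_filter filter_pred1_uniq // big_seq1.
  by move=> x _; rewrite eq_sym; case: eqP.
by rewrite big_seq big1 // => x xS; case: eqP => // e; case: iS; rewrite e.
Qed.

(* A state consists of the names of the classes of the nodes and of the set of
   the names of the pending classes. *)
Definition astate := ((nat -> nat) * pred nat)%type.

Section Refinement.

Variables (N : nat) (P : nat -> seq nat).
Notation nodes := (iota 0 N).

Definition csize (f : nat -> nat) s := count (fun u => f u == s) nodes.
Definition unm (f : nat -> nat) (M : pred nat) s :=
  count (fun u => (f u == s) && ~~ M u) nodes.
Definition mrk (f : nat -> nat) (M : pred nat) s :=
  count (fun u => (f u == s) && M u) nodes.
Definition splits f M s := (0 < unm f M s) && (0 < mrk f M s).
(* The part of a split class that becomes pending in addition to the pending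
   classes: the smaller one, unless the class itself is already pending. *)
Definition agenda (W : pred nat) f M s :=
  if W s || (mrk f M s < unm f M s) then s + unm f M s else s.

Definition split1 M (x : astate) s : astate :=
  if splits x.1 M s then
    (fun v => if M v && (x.1 v == s) then s + unm x.1 M s else x.1 v,
     fun z => x.2 z || (z == agenda x.2 x.1 M s))
  else x.

(* Names are start positions of disjoint intervals, one for each class. *)
Definition wf (x : astate) :=
  [/\ forall v, v < N -> x.1 v + csize x.1 (x.1 v) <= N,
      forall u v, u < N -> v < N -> x.1 u < x.1 v ->
        x.1 u + csize x.1 (x.1 u) <= x.1 v
    & forall s, x.2 s -> exists2 v, v < N & x.1 v = s].

Lemma csizeE f M s : csize f s = unm f M s + mrk f M s.
Proof.
rewrite /csize /unm /mrk; elim: (iota 0 N) => //= v s' ->.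
by case: (f v == s); case: (M v) => /=; lia.
Qed.

Lemma count_nodes_gt0 (p : pred nat) :
  0 < count p nodes -> exists2 v, v < N & p v.
Proof.
rewrite -has_count => /hasP[v]; rewrite mem_iota add0n => /andP[_ vN] pv.
by exists v.
Qed.

Lemma nodes_count_gt0 (p : pred nat) v : v < N -> p v -> 0 < count p nodes.
Proof.
by move=> vN pv; rewrite -has_count; apply/hasP; exists v => //; rewrite mem_iota.
Qed.

Lemma csize_gt0 f v : v < N -> 0 < csize f (f v).
Proof. by move=> vN; apply: (nodes_count_gt0 vN); rewrite eqxx. Qed.

Lemma wf_lt x v : wf x -> v < N -> x.1 v < N.
Proof. by case=> wa _ _ vN; have := wa v vN; have := csize_gt0 x.1 vN; lia. Qed.

(** Intervals of different classes are disjoint, hence a position inside one of them is never the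
    name of another class. This is what makes the names of new parts fresh. *)
Lemma wf_sep x u v a : wf x -> u < N -> v < N -> x.1 u <> x.1 v ->
  a < csize x.1 (x.1 u) -> x.1 u + a <> x.1 v.
Proof.
case=> wa wb _ uN vN ne al; case: (ltngtP (x.1 u) (x.1 v)) => // lt; last by lia.
by have := wb u v uN vN lt; lia.
Qed.

Section Split.
Variables (x : astate) (M : pred nat) (s : nat).
Hypotheses (wx : wf x) (sp : splits x.1 M s).
Let a := unm x.1 M s.
Let c := mrk x.1 M s.
Let y := split1 M x s.

Let a0 : 0 < a. Proof. by case/andP: sp. Qed.
Let c0 : 0 < c. Proof. by case/andP: sp. Qed.
Let ac : csize x.1 s = a + c. Proof. exact: csizeE. Qed.

Let f1E v : y.1 v = if M v && (x.1 v == s) then s + a else x.1 v.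
Proof. by rewrite /y /split1 sp. Qed.
Let W1E z : y.2 z = x.2 z || (z == agenda x.2 x.1 M s).
Proof. by rewrite /y /split1 sp. Qed.

Let uu : exists2 u, u < N & x.1 u = s /\ ~~ M u.
Proof. by have [u uN /andP[/eqP e m]] := count_nodes_gt0 a0; exists u. Qed.
Let vv : exists2 u, u < N & x.1 u = s /\ M u.
Proof. by have [u uN /andP[/eqP e m]] := count_nodes_gt0 c0; exists u. Qed.

Lemma split1_fresh v : v < N -> x.1 v <> s + a.
Proof.
move=> vN e; have [u uN [us _]] := uu.
have := @wf_sep x u v a wx uN vN; rewrite us e ac => sep.
by apply: sep => //; lia.
Qed.

Lemma split1_notin : x.2 (s + a) = false.
Proof.
apply/negP => H; case: wx => _ _ /(_ _ H) [v vN]; exact: split1_fresh.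
Qed.

Lemma split1_eqs v : v < N -> (y.1 v == s) = (x.1 v == s) && ~~ M v.
Proof.
move=> vN; rewrite f1E [in RHS]andbC; case: (M v) => //=; case: (x.1 v =P s) => [_|/eqP/negbTE //].
by apply/eqP; lia.
Qed.

Lemma split1_eqa v : v < N -> (y.1 v == s + a) = (x.1 v == s) && M v.
Proof.
move=> vN; have /eqP/negbTE fr := split1_fresh vN.
rewrite f1E [in RHS]andbC; case: (M v) => //=.
by case: (x.1 v =P s) => [_|_]; rewrite ?eqxx.
Qed.

Lemma split1_eqo v t : t <> s -> t <> s + a -> (y.1 v == t) = (x.1 v == t).
Proof.
move=> ts ta; rewrite f1E; case: ifP => // /andP[_ /eqP ->].
by apply/eqP/eqP => e; lia.
Qed.

Lemma csize_split1 : csize y.1 s = a /\ csize y.1 (s + a) = c.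
Proof.
split; apply: eq_in_count => v; rewrite mem_iota => /andP[_ vN].
  exact: split1_eqs.
exact: split1_eqa.
Qed.

Lemma csize_split1o t : t <> s -> t <> s + a -> csize y.1 t = csize x.1 t.
Proof. by move=> ts ta; apply: eq_count => v; exact: split1_eqo. Qed.

Lemma split1_cases v : v < N ->
  [\/ [/\ x.1 v = s, M v & y.1 v = s + a],
      [/\ x.1 v = s, M v = false & y.1 v = s]
    | [/\ x.1 v <> s, x.1 v <> s + a & y.1 v = x.1 v]].
Proof.
move=> vN; have fr := split1_fresh vN; rewrite f1E.
case: (x.1 v =P s) => [e|ne]; last by rewrite andbF; constructor 3.
by case m: (M v); [constructor 1 | constructor 2].
Qed.

Lemma wf_proper_split : wf y.
Proof.
have [cs ca] := csize_split1; have co := csize_split1o.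
have [wa wb wc] := wx; split.
- move=> v vN; have := wa v vN.
  by have [[e m ->]|[e m ->]|[n1 n2 ->]] := split1_cases vN;
    rewrite ?cs ?ca ?co // e ac; lia.
- move=> u v uN vN.
  have := wb u v uN vN; have := wb v u vN uN.
  have [[eu mu ->]|[eu mu ->]|[nu1 nu2 ->]] := split1_cases uN;
  have [[ev mv ->]|[ev mv ->]|[nv1 nv2 ->]] := split1_cases vN;
  rewrite ?cs ?ca ?co // ?eu ?ev ?ac; lia.
- move=> z; rewrite W1E => /orP[Wz|/eqP ->].
    have [v vN e] := wc z Wz; have [zs|/eqP zs] := eqVneq z s.
      have [u uN [us um]] := uu; exists u => //.
      by rewrite f1E (negbTE um) us.
    by exists v => //; rewrite f1E; case: ifP => // /andP[_ /eqP]; rewrite e.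
  rewrite /agenda; case: ifP => _.
    by have [u uN [us um]] := vv; exists u => //; rewrite f1E um us eqxx.
  by have [u uN [us um]] := uu; exists u => //; rewrite f1E (negbTE um) us.
Qed.

Definition pot (x : astate) :=
  \sum_(v <- nodes) (size (P v)).+1 *
    (trunc_log 2 (csize x.1 (x.1 v)) + x.2 (x.1 v)).

(* A newly pending part of a class that was not pending is its smaller half. *)
Lemma pot_proper_split : pot y <= pot x.
Proof.
rewrite /pot big_seq [leqRHS]big_seq; apply: leq_sum => v.
rewrite mem_iota => /andP[_ vN]; rewrite leq_mul2l; apply/orP; right.
have [cs ca] := csize_split1; have co := csize_split1o.
have la : trunc_log 2 a <= trunc_log 2 (a + c) by apply: leq_trunc_log; lia.
have lc : trunc_log 2 c <= trunc_log 2 (a + c) by apply: leq_trunc_log; lia.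
(* The smaller part has at most half the size, so its logarithm drops by one, which pays for its
   becoming pending. *)
have la1 : a <= c -> (trunc_log 2 a).+1 <= trunc_log 2 (a + c).
  by move=> ?; rewrite -trunc_log2_double //; apply: leq_trunc_log; lia.
have lc1 : c <= a -> (trunc_log 2 c).+1 <= trunc_log 2 (a + c).
  by move=> ?; rewrite -trunc_log2_double //; apply: leq_trunc_log; lia.
have sa : (s == s + a) = false by apply/eqP; lia.
have as_ : (s + a == s) = false by apply/eqP; lia.
have [[e m ->]|[e m ->]|[n1 n2 ->]] := split1_cases vN;
  rewrite W1E /agenda -/a -/c ?cs ?ca ?e ?ac ?split1_notin /=.
- by case: (x.2 s) => //=; case: ltnP => //= ?; rewrite ?eqxx ?as_ /=; lia.
- by case: (x.2 s) => //=; case: ltnP => //= ?; rewrite ?eqxx ?sa /=; lia.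
- rewrite co //; case: ifP => _; last first.
    by rewrite (_ : (x.1 v == s) = false) ?orbF //; apply/eqP.
  by rewrite (_ : (x.1 v == s + a) = false) ?orbF //; apply/eqP.
Qed.

Definition names (f : nat -> nat) :=
  count (fun i => has (fun v => f v == i) nodes) nodes.

(** Both parts are nonempty and the new name is fresh and below N. As there are at most N names,
    this bounds the number of splits of a run. *)
Lemma names_proper_split : names x.1 < names y.1.
Proof.
have [v0 v0N [v0s v0M]] := vv; have [u0 u0N [u0s u0M]] := uu.
have saN : s + a < N by case: wx => /(_ v0 v0N); rewrite v0s ac; lia.
rewrite /names.
have -> : count (fun i => has (fun v => y.1 v == i) nodes) nodes =
    count (predU (fun i => has (fun v => x.1 v == i) nodes) (pred1 (s + a))) nodes.
  apply: eq_in_count => i _ /=; apply/hasP/orP => [[v vn /eqP <-]|].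
    have vN : v < N by move: vn; rewrite mem_iota.
    have [[e m ->]|[e m ->]|[n1 n2 ->]] := split1_cases vN.
    - by right; rewrite eqxx.
    - by left; apply/hasP; exists v; rewrite ?e.
    - by left; apply/hasP; exists v.
  case=> [/hasP[v vn /eqP vi]|/eqP ->].
    have vN : v < N by move: vn; rewrite mem_iota.
    have [[e m _]|[e m h]|[n1 n2 h]] := split1_cases vN.
    - exists u0; rewrite ?mem_iota // f1E (negbTE u0M) /= u0s -vi e //.
    - by exists v; rewrite // h -vi e.
    - by exists v; rewrite // h vi.
  by exists v0; rewrite ?mem_iota // f1E v0M v0s eqxx /=.
have := count_predUI (fun i => has (fun v => x.1 v == i) nodes) (pred1 (s + a)) nodes.
rewrite [count (predI _ _) _](@eq_in_count _ _ pred0) => [|i _ /=]; last first.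
  apply/negP => /andP[/hasP[v vn /eqP e] /eqP ei].
  by apply: (@split1_fresh v); rewrite ?e //; move: vn; rewrite mem_iota.
rewrite count_pred0 addn0 => ->.
by rewrite (count_uniq_mem _ (iota_uniq _ _)) mem_iota /= saN addn1.
Qed.

Lemma pending_proper_split : count y.2 nodes <= (count x.2 nodes).+1.
Proof.
have /eq_count -> : y.2 =1 predU x.2 (pred1 (agenda x.2 x.1 M s)) by move=> z; exact: W1E.
have := count_predUI x.2 (pred1 (agenda x.2 x.1 M s)) nodes.
rewrite (count_uniq_mem (agenda _ _ _ _) (iota_uniq 0 N)).
by case: (_ \in _) => /=; lia.
Qed.

End Split.

Lemma wf_split1 x M s : wf x -> wf (split1 M x s).
Proof.
move=> wx; have [sp|/negbTE sp] := boolP (splits x.1 M s).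
  exact: wf_proper_split.
by rewrite /split1 sp.
Qed.

(** [P w] lists the tails of the arcs into [w], with repetition, so this is the number of arcs from
    [v] into the class [r]. *)
Definition dg (f : nat -> nat) r v := \sum_(w <- nodes | f w == r) count_mem v (P w).

(* The usual loop invariant of partition refinement; E holds of the pairs that
   agree on the splitter being processed. *)
Definition almost_stable (E : nat -> nat -> Prop) (x : astate) :=
  forall u v, u < N -> v < N -> x.1 u = x.1 v -> E u v ->
    (forall r, x.2 r -> dg x.1 r u = dg x.1 r v) ->
    forall r, dg x.1 r u = dg x.1 r v.

Lemma split1_refines x M s u v : wf x -> u < N -> v < N ->
  (split1 M x s).1 u = (split1 M x s).1 v -> x.1 u = x.1 v.
Proof.
move=> wx uN vN; have [sp|/negbTE sp] := boolP (splits x.1 M s); last first.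
  by rewrite /split1 sp.
have [[eu mu ->]|[eu mu ->]|[nu1 nu2 ->]] := split1_cases wx sp uN;
by have [[ev mv ->]|[ev mv ->]|[nv1 nv2 ->]] := split1_cases wx sp vN;
  rewrite ?eu ?ev //; lia.
Qed.

Lemma dg_split1 x M s u : wf x -> splits x.1 M s ->
  dg (split1 M x s).1 s u + dg (split1 M x s).1 (s + unm x.1 M s) u = dg x.1 s u.
Proof.
move=> wx sp; rewrite /dg [RHS](bigID M) /= addnC; congr (_ + _);
  apply: eq_bigl_in => v; rewrite mem_iota => /andP[_ vN].
  exact: split1_eqa.
exact: split1_eqs.
Qed.

(** Hopcroft's argument. If the class was pending, both parts are, and equal degrees into the parts
    give equal degrees into the whole. Otherwise the old invariant gives equal degrees into the
    whole, and the one pending part determines the other by subtraction. *)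
Lemma almost_stable_split1 E x M s :
  wf x -> almost_stable E x -> almost_stable E (split1 M x s).
Proof.
move=> wx st; have [sp|/negbTE sp] := boolP (splits x.1 M s); last first.
  by rewrite /split1 sp.
move=> u v uN vN /(split1_refines wx uN vN) e Euv W1.
have dsum w := dg_split1 w wx sp.
have a0 : 0 < unm x.1 M s by case/andP: sp.
set y := split1 M x s in W1 dsum *; set a := unm x.1 M s in W1 dsum *.
have do_ t w : t <> s -> t <> s + a -> dg y.1 t w = dg x.1 t w.
  by move=> ts ta; apply: eq_bigl => z; exact: split1_eqo.
have W1E z : y.2 z = x.2 z || (z == agenda x.2 x.1 M s).
  by rewrite /y /split1 sp.
have old r : dg x.1 r u = dg x.1 r v.
  apply: st => // {}r Wr.
  have W1r : y.2 r by rewrite W1E Wr.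
  have [rs|/eqP rs] := eqVneq r s.
    rewrite {}rs in Wr W1r *.
    have W1a : y.2 (s + a) by rewrite W1E /agenda Wr /= eqxx orbT.
    by rewrite -!dsum (W1 _ W1r) (W1 _ W1a).
  have ra : r <> s + a.
    by move=> ra; move: Wr; rewrite ra (split1_notin wx sp).
  by rewrite -(do_ r u) // -(do_ r v) //; exact: W1.
have both : dg y.1 s u = dg y.1 s v /\ dg y.1 (s + a) u = dg y.1 (s + a) v.
  have := old s; rewrite -!dsum.
  have : y.2 (agenda x.2 x.1 M s) by rewrite W1E eqxx orbT.
  by rewrite /agenda -/a; case: ifP => _ /W1 -> ?; split=> //; lia.
move=> r; have [->|/eqP rs] := eqVneq r s; first by case: both.
have [->|/eqP ra] := eqVneq r (s + a); first by case: both.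
by rewrite !do_.
Qed.

Definition touched (M : pred nat) (f : nat -> nat) (S : seq nat) :=
  [/\ uniq S, forall v, v < N -> M v -> f v \in S
    & forall s, s \in S -> exists2 v, v < N & f v = s].

Lemma wf_splits x M S : wf x -> wf (foldl (split1 M) x S).
Proof. by elim: S x => //= s S IH x wx; apply: IH; exact: wf_split1. Qed.

Lemma almost_stable_splits E x M S : wf x -> almost_stable E x ->
  almost_stable E (foldl (split1 M) x S).
Proof.
elim: S x => //= s S IH x wx st; apply: IH; first exact: wf_split1.
exact: almost_stable_split1.
Qed.

(* The right-hand sides do not depend on the order of S. *)
Lemma splits_closed x M S : wf x -> uniq S ->
  (forall s, s \in S -> exists2 v, v < N & x.1 v = s) ->
  (forall v, v < N -> (foldl (split1 M) x S).1 v =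
    if M v && (x.1 v \in S) then x.1 v + unm x.1 M (x.1 v) else x.1 v) /\
  forall z, (foldl (split1 M) x S).2 z =
    x.2 z || has (fun s => splits x.1 M s && (z == agenda x.2 x.1 M s)) S.
Proof.
move=> wx; elim/last_ind: S => [|S s IH].
  by move=> _ _; split=> [v vN|z] /=; rewrite ?in_nil ?andbF ?orbF.
rewrite rcons_uniq => /andP[sS uS] nm.
have {IH} [|IHf IHW] := IH uS; first by move=> t tS; apply: nm; rewrite mem_rcons in_cons tS orbT.
have [v0 v0N v0s] : exists2 v, v < N & x.1 v = s.
  by apply: nm; rewrite mem_rcons mem_head.
rewrite foldl_rcons; set y := foldl _ _ _ in IHf IHW *.
have ltu t : splits x.1 M t -> unm x.1 M t < csize x.1 t.
  by case/andP=> _ m0; rewrite (csizeE x.1 M); lia.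
have same u : u < N -> (y.1 u == s) = (x.1 u == s).
  move=> uN; rewrite IHf //; case: ifP => // /andP[mu fuS].
  have ne : x.1 u <> s by move=> e; rewrite -e fuS in sS.
  have /eqP/negbTE -> := ne; apply/eqP; rewrite -v0s; apply: wf_sep => //.
    by rewrite v0s.
  rewrite (csizeE x.1 M) -[X in X < _]addn0 ltn_add2l.
  by apply: (nodes_count_gt0 uN); rewrite eqxx mu.
have eunm : unm y.1 M s = unm x.1 M s.
  by apply: eq_in_count => u; rewrite mem_iota => /andP[_ uN]; rewrite same.
have emrk : mrk y.1 M s = mrk x.1 M s.
  by apply: eq_in_count => u; rewrite mem_iota => /andP[_ uN]; rewrite same.
have esp : splits y.1 M s = splits x.1 M s by rewrite /splits eunm emrk.
(* A split of another class [t] adds either [t] or a position inside the interval of [t], and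
   neither is [s]. *)
have eW : y.2 s = x.2 s.
  rewrite IHW; case: hasP; last by rewrite orbF.
  case=> t tS /andP[sp /eqP e].
  have [w wN wt] : exists2 v, v < N & x.1 v = t.
    by apply: nm; rewrite mem_rcons in_cons tS orbT.
  have ts : t <> s by move=> e'; rewrite -e' tS in sS.
  move: e; rewrite /agenda; case: ifP => _ e; last by case: ts.
  have := @wf_sep x w v0 (unm x.1 M t) wx wN v0N.
  by rewrite wt v0s => /(_ ts (ltu t sp)); rewrite -e.
have eag : agenda y.2 y.1 M s = agenda x.2 x.1 M s.
  by rewrite /agenda eW emrk eunm.
split=> [v vN|z].
- rewrite /split1 esp; case: ifP => sp /=.
    rewrite same // eunm mem_rcons in_cons IHf //.
    case mv: (M v) => //=; case: (x.1 v =P s) => [->|//] /=.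
    by rewrite ?(negbTE sS).
  rewrite IHf // mem_rcons in_cons; case mv: (M v) => //=.
  case: (x.1 v =P s) => [e|//] /=; rewrite e (negbTE sS).
  (* The class [s] contains the marked node [v] and is not split, so it is entirely marked. *)
  suff -> : unm x.1 M s = 0 by rewrite addn0.
  have m0 : 0 < mrk x.1 M s by apply: (nodes_count_gt0 vN); rewrite e eqxx mv.
  by move: sp; rewrite /splits m0 andbT; case: (unm _ _ _).
- rewrite has_rcons orbCA orbC -orbA /split1 esp; case: ifP => sp /=.
    by rewrite IHW eag orbA.
  by rewrite IHW orbF.
Qed.

(** An entirely marked class has [unm] equal to 0, so the formula also covers the classes that are
    not split. *)
Lemma refine_names x M S v : wf x -> touched M x.1 S -> v < N ->
  (foldl (split1 M) x S).1 v =
    if M v then x.1 v + unm x.1 M (x.1 v) else x.1 v.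
Proof.
move=> wx [uS tM tS] vN; have [-> // _] := splits_closed M wx uS tS.
by case m: (M v) => //=; rewrite tM.
Qed.

(** The disjunction ranges over nodes instead of [S], which makes it comparable under a bijection of
    the nodes. A class that splits has a marked node and is therefore in [S]. *)
Lemma refine_pending x M S z : wf x -> touched M x.1 S ->
  (foldl (split1 M) x S).2 z = x.2 z ||
    has (fun v => splits x.1 M (x.1 v) && (z == agenda x.2 x.1 M (x.1 v))) nodes.
Proof.
move=> wx [uS tM tS]; have [_ ->] := splits_closed M wx uS tS.
congr (_ || _); apply/hasP/hasP => [[s sS h]|[v vn h]].
  by have [v vN e] := tS s sS; exists v; rewrite ?mem_iota ?e.
exists (x.1 v) => //.
have [u uN /andP[/eqP <- mu]] : exists2 u, u < N & (x.1 u == x.1 v) && M u.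
  by case/andP: h => /andP[_ /count_nodes_gt0].
exact: tM.
Qed.

(** A new name stays inside the old interval, so different classes remain apart. Within a class, an
    unmarked node makes the offset of the marked ones positive. *)
Lemma refine_sep x M S u v : wf x -> touched M x.1 S -> u < N -> v < N ->
  (foldl (split1 M) x S).1 u = (foldl (split1 M) x S).1 v ->
  x.1 u = x.1 v /\ M u = M v.
Proof.
move=> wx tc uN vN; rewrite !refine_names //.
have lt w : w < N -> M w -> unm x.1 M (x.1 w) < csize x.1 (x.1 w).
  move=> wN mw; rewrite (csizeE x.1 M) -[X in X < _]addn0 ltn_add2l.
  by apply: (nodes_count_gt0 wN); rewrite eqxx mw.
have un w : w < N -> M w = false -> 0 < unm x.1 M (x.1 w).
  by move=> wN mw; apply: (nodes_count_gt0 wN); rewrite eqxx mw.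
have [_ wb _] := wx.
have ltu := lt u uN; have ltv := lt v vN.
have unu := un u uN; have unv := un v vN.
have buv := wb u v uN vN; have bvu := wb v u vN uN.
case: (ltngtP (x.1 u) (x.1 v)) => [luv|lvu|e].
- by move: buv ltu; case: (M u); case: (M v) => h1 h2; have := h1 luv; try have := h2 isT; lia.
- by move: bvu ltv; case: (M u); case: (M v) => h1 h2; have := h1 lvu; try have := h2 isT; lia.
- by move: unu unv; rewrite e; case: (M u); case: (M v) => // h1 h2 ?; [have := h2 erefl|have := h1 erefl]; lia.
Qed.

End Refinement.

(** * Runs of the refinement: their cost and the stability of their result *)

Section Runs.

Variables (N : nat) (P : nat -> seq nat).
Notation nodes := (iota 0 N).

Section Credit.
Variables c1 c2 : nat.

(* Twice the number of possible further splits: each pays for inserting a pending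
   class and for removing it later. *)
Definition credit (x : astate) :=
  c1 * pot N P x + c2 * (2 * (N - names N x.1) + count x.2 nodes).

Lemma names_le f : names N f <= N.
Proof. by rewrite -[leqRHS](size_iota 0) count_size. Qed.

Lemma credit_split1 x M s : wf N x -> splits N x.1 M s ->
  credit (split1 N M x s) + c2 <= credit x.
Proof.
move=> wx sp; rewrite /credit.
have h1 := pot_proper_split P wx sp.
have h2 := names_proper_split wx sp.
have h3 := pending_proper_split sp.
have h4 := names_le (split1 N M x s).1.
rewrite -addnA -mulnSr; apply: leq_add; rewrite leq_mul2l; apply/orP; right => //.
by lia.
Qed.

Definition pop (x : astate) r : astate := (x.1, fun z => x.2 z && (z != r)).

Lemma credit_pop (x : astate) r : r < N -> x.2 r ->
  credit (pop x r) + c1 * (\sum_(v <- nodes | x.1 v == r) (size (P v)).+1) + c2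
    <= credit x.
Proof.
move=> rN Wr; rewrite /credit.
have hW : count x.2 nodes = count (pop x r).2 nodes + 1.
  have := count_predUI (pop x r).2 (pred1 r) nodes.
  rewrite (count_uniq_mem r (iota_uniq 0 N)) mem_iota rN /=.
  rewrite [X in _ + X](@eq_count _ _ pred0) ?count_pred0; last first.
    by move=> z /=; case: eqP; rewrite ?andbF.
  rewrite addn0 => <-; apply: eq_count => z /=.
  by case: eqP => [->|_]; rewrite ?Wr ?andbT ?orbF.
have hp : pot N P x = pot N P (pop x r) + \sum_(v <- nodes | x.1 v == r) (size (P v)).+1.
  rewrite /pot [X in _ + X]big_mkcond -big_split /=; apply: eq_bigr => v _.
  by case: eqP => [->|_]; rewrite ?Wr /= ?andbT ?addn0 // mulnDr muln1.
by rewrite hp hW [(pop x r).1]/=; nia.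
Qed.

End Credit.

Lemma wf_pop x r : wf N x -> wf N (pop x r).
Proof. by case=> wa wb wc; split=> //= s /andP[/wc]. Qed.

Definition level (d : nat -> nat) k : pred nat := fun v => k <= d v.

(** A relation and not a function, since the list [S] depends on the order of the listing. *)
Inductive lrun (d : nat -> nat) : nat -> astate -> astate -> Prop :=
  | Lrun0 k x : (forall v, v < N -> d v < k) -> lrun d k x x
  | LrunS k (x : astate) S y : (exists2 v, v < N & k <= d v) ->
      touched N (level d k) x.1 S ->
      lrun d k.+1 (foldl (split1 N (level d k)) x S) y -> lrun d k x y.

(** The degrees refer to the class [r] as it was when it was removed; splitting off the level sets
    may split [r] itself without changing them. *)
Inductive mrun : astate -> astate -> Prop :=
  | Mrun0 (x : astate) : (forall s, s < N -> ~~ x.2 s) -> mrun x x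
  | MrunS (x : astate) r y z : r < N -> x.2 r -> (forall s, s < N -> x.2 s -> s <= r) ->
      lrun (dg N P x.1 r) 1 (pop x r) y -> mrun y z -> mrun x z.

(* C is the set of the edge colours that remain to be split off. *)
Inductive crun (mark : nat -> pred nat) : pred nat -> astate -> astate -> Prop :=
  | Crun0 C x : (forall j, ~~ C j) -> crun mark C x x
  | CrunS (C C' : pred nat) j (x : astate) S y : C j -> (forall i, C i -> i <= j) ->
      (forall i, C' i = C i && (i != j)) ->
      touched N (mark j) x.1 S ->
      crun mark C' (foldl (split1 N (mark j)) x S) y -> crun mark C x y.

Lemma lrun_correct d k x y E : lrun d k x y -> wf N x -> almost_stable N P E x ->
  [/\ wf N y, almost_stable N P E y
    & forall u v, u < N -> v < N -> y.1 u = y.1 v ->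
      x.1 u = x.1 v /\ forall l, k <= l -> (l <= d u) = (l <= d v)].
Proof.
elim=> {k x y} [k x dk wx sx|k x S y _ tc _ IH wx sx].
  split=> // u v uN vN e; split=> // l kl.
  by have := dk u uN; have := dk v vN; lia.
have [|wy sy sep] := IH (wf_splits _ _ wx); first exact: almost_stable_splits.
split=> // u v uN vN /(sep u v uN vN) [e h].
have [e' m] := refine_sep wx tc uN vN e; split=> // l.
by rewrite leq_eqVlt => /orP[/eqP <- //|]; exact: h.
Qed.

Lemma mrun_correct x y : mrun x y -> wf N x ->
  almost_stable N P (fun _ _ => True) x ->
  [/\ wf N y, forall u v, u < N -> v < N -> y.1 u = y.1 v -> x.1 u = x.1 v
    & forall u v, u < N -> v < N -> y.1 u = y.1 v ->
        forall r, dg N P y.1 r u = dg N P y.1 r v].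
Proof.
elim=> {x y} [x W0 wx sx|x r y z rN Wr _ lr _ IH wx sx].
  split=> // u v uN vN e; apply: sx => // s Ws.
  have [w wN ws] : exists2 v, v < N & x.1 v = s by case: wx => _ _; apply.
  by have := wf_lt wx wN; rewrite ws => /W0; rewrite Ws.
(* That [r] is no longer pending is compensated by the relation, which now demands equal degrees
   into [r]. *)
have sp : almost_stable N P (fun u v => dg N P x.1 r u = dg N P x.1 r v) (pop x r).
  move=> u v uN vN e er W'; apply: sx => // t Wt.
  by have [->//|tr] := eqVneq t r; apply: W'; rewrite /= Wt tr.
have [wy sy sep] := lrun_correct lr (wf_pop r wx) sp.
have [|wz rz stz] := IH wy.
  move=> u v uN vN e _; apply: sy => //; have [_ h] := sep u v uN vN e.
  (* Nodes that all levels leave together have equal degrees: compare them at the levels given by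
     the two degrees. This discharges the relation again. *)
  have := h (dg N P x.1 r u); have := h (dg N P x.1 r v).
  by rewrite !leqnn; case: (dg _ _ _ _ u); case: (dg _ _ _ _ v) => //=; lia.
split=> // u v uN vN /(rz u v uN vN) e.
by have [] := sep u v uN vN e.
Qed.

Lemma crun_correct mark C x y : crun mark C x y -> wf N x ->
  almost_stable N P (fun _ _ => True) x ->
  [/\ wf N y, almost_stable N P (fun _ _ => True) y
    & forall u v, u < N -> v < N -> y.1 u = y.1 v ->
      x.1 u = x.1 v /\ forall j, C j -> mark j u = mark j v].
Proof.
elim=> {C x y} [C x C0 wx sx|C C' j x S y Cj jmax C'E tc _ IH wx sx].
  by split=> // u v uN vN e; split=> // j Cj; have := C0 j; rewrite Cj.
have [|wy sy sep] := IH (wf_splits _ _ wx); first exact: almost_stable_splits.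
split=> // u v uN vN /(sep u v uN vN) [e h].
have [e' m] := refine_sep wx tc uN vN e; split=> // i Ci.
by have [-> //|ij] := eqVneq i j; apply: h; rewrite C'E Ci.
Qed.

Definition init_classes : astate := (fun=> 0, fun z => z == 0).

Lemma wf_init : 0 < N -> wf N init_classes.
Proof.
move=> N0; split=> //= [v vN|s /eqP ->]; last by exists 0.
by rewrite add0n -[leqRHS](size_iota 0) count_size.
Qed.

Lemma almost_stable_init E : almost_stable N P E init_classes.
Proof.
move=> u v uN vN _ _ W r; have [->|/negbTE r0] := eqVneq r 0; first exact: W.
by rewrite /dg !big_pred0 // => w /=; rewrite eq_sym r0.
Qed.

Lemma pot_init L : \sum_(v <- nodes) (size (P v)).+1 <= L ->
  pot N P init_classes <= L * (trunc_log 2 N).+1.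
Proof.
move=> le; rewrite /pot /=.
have -> : csize N (fun=> 0) 0 = N.
  by rewrite /csize (eq_count (a2 := predT)) // count_predT size_iota.
by rewrite -big_distrl /= addn1 leq_mul2r le orbT.
Qed.

(** * Coarseness: no step separates nodes that are equivalent under a stable labelling [b] *)

Section Coarse.
Variables (T : eqType) (b : nat -> T).
Hypothesis b_stable : forall u v, u < N -> v < N -> b u = b v -> forall k,
  \sum_(w <- nodes | b w == k) count_mem u (P w) =
  \sum_(w <- nodes | b w == k) count_mem v (P w).

Definition coarser (f : nat -> nat) :=
  forall u v, u < N -> v < N -> b u = b v -> f u = f v.

Lemma coarser_splits M x S :
  (forall u v, u < N -> v < N -> b u = b v -> M u = M v) ->
  coarser x.1 -> coarser (foldl (split1 N M) x S).1.
Proof.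
move=> bM; elim: S x => //= s S IH x cx; apply: IH.
rewrite /split1; case: ifP => // _ u v uN vN e /=.
by rewrite (bM u v) // (cx u v).
Qed.

Lemma coarser_dg f r u v : coarser f -> u < N -> v < N -> b u = b v ->
  dg N P f r u = dg N P f r v.
Proof.
move=> cf uN vN e; apply: (sum_fibres (b := b)); last exact: b_stable.
move=> w w'; rewrite !mem_iota => /andP[_ wN] /andP[_ w'N] ew.
by rewrite (cf w w').
Qed.

Lemma coarser_lrun d k x y : lrun d k x y ->
  (forall u v, u < N -> v < N -> b u = b v -> d u = d v) ->
  coarser x.1 -> coarser y.1.
Proof.
elim=> // {}k {}x S {}y _ _ _ IH bd cx; apply: IH => //.
by apply: coarser_splits => // u v uN vN e; rewrite /level (bd u v).
Qed.

Lemma coarser_mrun x y : mrun x y -> coarser x.1 -> coarser y.1.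
Proof.
elim=> // {}x r {}y z _ _ _ lr _ IH cx; apply: IH; apply: (coarser_lrun lr) => //.
by move=> u v uN vN e; apply: coarser_dg.
Qed.

Lemma coarser_crun mark C x y : crun mark C x y ->
  (forall j u v, u < N -> v < N -> b u = b v -> mark j u = mark j v) ->
  coarser x.1 -> coarser y.1.
Proof.
elim=> // {}C C' j {}x S {}y _ _ _ _ _ IH bm cx; apply: IH => //.
by apply: coarser_splits => // u v uN vN e; rewrite (bm j u v).
Qed.

End Coarse.

End Runs.

(** * Runs on two digraphs related by a bijection [sg] of the nodes *)

Section Equivariance.

Variables (N : nat) (P P' : nat -> seq nat) (sg : nat -> nat).
Notation nodes := (iota 0 N).
Hypothesis sgN : forall v, v < N -> sg v < N.
Hypothesis sgI : forall u v, u < N -> v < N -> sg u = sg v -> u = v.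
Hypothesis sgP : forall v w, v < N -> w < N ->
  count_mem (sg v) (P' (sg w)) = count_mem v (P w).

Lemma perm_sg : perm_eq (map sg nodes) nodes.
Proof.
have u : uniq (map sg nodes).
  rewrite map_inj_in_uniq ?iota_uniq // => x y.
  by rewrite !mem_iota => /andP[_ ?] /andP[_ ?]; exact: sgI.
apply: uniq_perm; rewrite ?iota_uniq //.
apply: (uniq_min_size u _ _).2; last by rewrite size_map.
by move=> x /mapP[v]; rewrite !mem_iota => /andP[_ vN] ->; exact: sgN.
Qed.

Lemma count_sg p q : (forall v, v < N -> q (sg v) = p v) ->
  count q nodes = count p nodes.
Proof.
move=> pq; rewrite -(permP perm_sg) count_map.
by apply: eq_in_count => v; rewrite mem_iota => /andP[_ vN]; exact: pq.
Qed.

Lemma has_sg p q : (forall v, v < N -> q (sg v) = p v) ->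
  has q nodes = has p nodes.
Proof. by move=> pq; rewrite !has_count (count_sg pq). Qed.

Definition sim (x x' : astate) :=
  (forall v, v < N -> x'.1 (sg v) = x.1 v) /\ forall s, s < N -> x'.2 s = x.2 s.

Lemma sim_dg x x' r v : sim x x' -> v < N ->
  dg N P' x'.1 r (sg v) = dg N P x.1 r v.
Proof.
move=> [sf _] vN; rewrite /dg -(perm_big _ perm_sg) big_map /=.
rewrite big_seq_cond [RHS]big_seq_cond.
rewrite (eq_bigl (fun w => (w \in nodes) && (x.1 w == r))).
  apply: eq_bigr => w /andP[]; rewrite mem_iota => /andP[_ wN] _.
  exact: sgP.
move=> w; case wn: (w \in nodes) => //=; rewrite sf //.
by move: wn; rewrite mem_iota.
Qed.

(** [S] and [S'] may be listed in unrelated orders: the closed forms of the result depend only on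
    sizes of marked and unmarked parts, which the bijection preserves. *)
Lemma sim_splits x x' M M' S S' : sim x x' -> wf N x -> wf N x' ->
  (forall v, v < N -> M' (sg v) = M v) ->
  touched N M x.1 S -> touched N M' x'.1 S' ->
  sim (foldl (split1 N M) x S) (foldl (split1 N M') x' S').
Proof.
move=> [sf sW] wx wx' sM tc tc'.
have eu s : unm N x'.1 M' s = unm N x.1 M s.
  by apply: count_sg => v vN; rewrite sf ?sM.
have em s : mrk N x'.1 M' s = mrk N x.1 M s.
  by apply: count_sg => v vN; rewrite sf ?sM.
split=> [v vN|s sN].
  by rewrite !(refine_names wx tc, refine_names wx' tc') ?sgN // sM // sf // eu.
rewrite (refine_pending _ wx tc) (refine_pending _ wx' tc') sW //; congr (_ || _).
apply: has_sg => v vN; rewrite sf // /splits /agenda eu em sW //.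
exact: wf_lt.
Qed.

Lemma sim_lrun d d' k x x' y y' : lrun N d k x y -> lrun N d' k x' y' ->
  (forall v, v < N -> d' (sg v) = d v) ->
  sim x x' -> wf N x -> wf N x' -> sim y y'.
Proof.
move=> lr lr' sd; elim: lr x' lr' => {k x y} [k x dk|k x S y nd tc _ IH] x' lr' sx wx wx'.
  inversion lr' as [|k' x1 S' y1 [v vN dv]]; subst => //.
  have := perm_mem perm_sg v; rewrite mem_iota vN => /mapP[w].
  rewrite mem_iota => /andP[_ wN] e; move: dv; rewrite e sd //.
  by have := dk w wN; lia.
inversion lr' as [k' x1 dk|k' x1 S' y1 nd' tc' lr1]; subst.
  by have [v vN dv] := nd; have := dk (sg v) (sgN vN); rewrite sd //; lia.
apply: IH lr1 _ _ _; try exact: wf_splits.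
by apply: sim_splits => // v vN; rewrite /level sd.
Qed.

Lemma wf_lrun d k x y : lrun N d k x y -> wf N x -> wf N y.
Proof. by elim=> // {}k {}x S {}y _ _ _ IH wx; apply: IH; exact: wf_splits. Qed.

Lemma sim_mrun x x' y y' : mrun N P x y -> mrun N P' x' y' ->
  sim x x' -> wf N x -> wf N x' -> sim y y'.
Proof.
move=> mr; elim: mr x' => {x y} [x W0|x r y z rN Wr rmax lr _ IH] x' mr' sx wx wx'.
  inversion mr' as [|x1 r y1 z1 rN Wr]; subst => //.
  by have := W0 r rN; rewrite -(sx.2 r rN) Wr.
inversion mr' as [x1 W0|x1 r' y1 z1 rN' Wr' rmax' lr1 mr1]; subst.
  by have := W0 r rN; rewrite (sx.2 r rN) Wr.
(* The choice of the largest pending name forces both runs to process the same class. *)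
have er : r' = r.
  have := rmax r' rN'; have := rmax' r rN; rewrite -(sx.2 r' rN') (sx.2 r rN).
  by move=> /(_ Wr) ? /(_ Wr') ?; lia.
subst r'; have wp := wf_pop r wx; have wp' := wf_pop r wx'.
apply: IH mr1 _ (wf_lrun lr wp) (wf_lrun lr1 wp').
apply: (sim_lrun lr lr1) => //; first by move=> v vN; exact: sim_dg.
by case: sx => sf sW; split=> //= s sN; rewrite sW.
Qed.

Lemma sim_crun mark mark' C C' x x' y y' :
  crun N mark C x y -> crun N mark' C' x' y' -> C =1 C' ->
  (forall j v, v < N -> mark' j (sg v) = mark j v) ->
  sim x x' -> wf N x -> wf N x' -> sim y y'.
Proof.
move=> cr cr' CC sm; elim: cr C' x' cr' CC =>
    {C x y} [C x C0|C D j x S y Cj jmax DE tc _ IH] C' x' cr' CC sx wx wx'.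
  inversion cr' as [|C1 D1 j x1 S1 y1 Cj]; subst => //.
  by have := C0 j; rewrite CC Cj.
inversion cr' as [C1 x1 C0|C1 D' j' x1 S' y1 Cj' jmax' DE' tc' cr1]; subst.
  by have := C0 j; rewrite -CC Cj.
have ej : j' = j.
  have := jmax j'; have := jmax' j; rewrite CC -(CC j).
  by move=> /(_ Cj) ? /(_ Cj') ?; lia.
subst j'; apply: IH cr1 _ _ _ _; try exact: wf_splits.
  by move=> i; rewrite DE DE' CC.
by apply: sim_splits => // v; exact: sm.
Qed.

End Equivariance.

(** * The program and its refinement steps *)

Declare Scope prog_scope.
Delimit Scope prog_scope with P.
Notation "c1 ;; c2" := (HSeq c1 c2)
  (at level 100, c2 at level 200, right associativity) : prog_scope.
Notation "'$' x" := (HV x) (at level 5, format "'$' x").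
Notation "a + b" := (HAdd a b) : prog_scope.
Notation "a - b" := (HSub a b) : prog_scope.

Notation vn := 0 (only parsing).
Notation vm := 1 (only parsing).
Notation vN := 2 (only parsing).
Notation vi := 3 (only parsing).
Notation vx := 4 (only parsing).
Notation vs := 5 (only parsing).
Notation vc := 6 (only parsing).
Notation vq := 7 (only parsing).
Notation ve := 8 (only parsing).
Notation vu := 9 (only parsing).
Notation vv := 10 (only parsing).
Notation vy := 11 (only parsing).
Notation vp := 12 (only parsing).
Notation vz := 13 (only parsing).
Notation vk := 14 (only parsing).
Notation vg := 15 (only parsing).
Notation va := 16 (only parsing).
Notation vt := 17 (only parsing).

(* The nodes sorted by class and its inverse; the name and the end of the class
   of a node; the number of marked nodes in a class and the stack of the classes
   with marked nodes; the number of arcs into the splitter. *)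
Notation aperm := 0 (only parsing).
Notation aposn := 1 (only parsing).
Notation acls := 2 (only parsing).
Notation acend := 3 (only parsing).
Notation amark := 4 (only parsing).
Notation astk := 5 (only parsing).
Notation acnt := 6 (only parsing).
(* Linked lists: buckets of nodes, and predecessors. *)
Notation alh := 7 (only parsing).
Notation alv := 8 (only parsing).
Notation aln := 9 (only parsing).
Notation aph := 10 (only parsing).
Notation apv := 11 (only parsing).
Notation apn := 12 (only parsing).
(* Tournament trees of the pending classes and of the edge colours, the halves
   of the numbers, and the leaf of a colour. *)
Notation atw := 13 (only parsing).
Notation atc := 14 (only parsing).
Notation ahalf := 15 (only parsing).
Notation aloc := 16 (only parsing).

(** A heap-shaped tree with root 1, children [2y] and [2y + 1] of [y], and leaf [s] in cell [N + s];
    [N] need not be a power of two. The climb stops at 0, the half of the root. *)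
Definition tree_set k z e : hcmd :=
  (HPut k ($vN + $z) e;;
   HSet vx (HA ahalf ($vN + $z));;
   HWhile ($vx)
     (HPut k ($vx) (HMax (HA k ($vx + $vx)) (HA k ($vx + $vx + HC 1)));;
      HSet vx (HA ahalf ($vx))))%P.

(** Clearing [acnt] here resets all counters during level 1, because the first bucket holds every
    node with a nonzero count. *)
Definition count_mark : hcmd :=
  (HSet vv (HA alv ($vy));;
   HSet vy (HA aln ($vy));;
   HPut acnt ($vv) (HC 0);;
   HSet vs (HA acls ($vv));;
   HSet vc (HA amark ($vs) + HC 1);;
   HIf (HA amark ($vs)) HSkip (HPut astk ($vp) ($vs);; HSet vp ($vp + HC 1));;
   HPut amark ($vs) ($vc))%P.

(** [vc] already includes the new node, so [q] is the position just before the block of marked nodes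
    at the end of the class. *)
Definition move_marked : hcmd :=
  (HSet vq (HA acend ($vs) - $vc);;
   HSet vi (HA aposn ($vv));;
   HSet vu (HA aperm ($vq));;
   HPut aperm ($vi) ($vu);;
   HPut aposn ($vu) ($vi);;
   HPut aperm ($vq) ($vv);;
   HPut aposn ($vv) ($vq))%P.

Definition mark_node : hcmd := HSeq count_mark move_marked.

(** Only the marked part is relabelled, so apart from the tree update the cost is linear in the
    number of marked nodes. The numbers of unmarked and marked nodes are [q - s] and [c], and the
    nested tests choose between [q] and [s] as [agenda] does. *)
Definition split_class : hcmd :=
  (HSet vp ($vp - HC 1);;
   HSet vs (HA astk ($vp));;
   HSet vc (HA amark ($vs));;
   HPut amark ($vs) (HC 0);;
   HSet ve (HA acend ($vs));;
   HSet vq ($ve - $vc);;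
   HIf ($vq - $vs)
     (HPut acend ($vs) ($vq);;
      HPut acend ($vq) ($ve);;
      HSet vi ($vq);;
      HWhile ($ve - $vi)
        (HPut acls (HA aperm ($vi)) ($vq);; HSet vi ($vi + HC 1));;
      HSet vz ($vq);;
      HIf (HA atw ($vN + $vs)) HSkip
        (HIf ($vq - $vs - $vc) HSkip (HSet vz ($vs)));;
      tree_set atw vz ($vz + HC 1))
     HSkip)%P.

Definition refine_bucket : hcmd :=
  (HSet vy (HA alh ($vk));;
   HPut alh ($vk) (HC 0);;
   HSet vp (HC 0);;
   HWhile ($vy) mark_node;;
   HWhile ($vp) split_class)%P.


(** Cells are allocated with growing numbers and pushed in front, so links decrease; a write to a
    fresh cell cannot disturb an existing list. *)
Fixpoint llist (val nxt : nat -> nat) h (s : seq nat) : Prop :=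
  if s is x :: s' then
    [/\ 0 < h, val h = x, nxt h < h & llist val nxt (nxt h) s']
  else h = 0.

Lemma llist_frame val nxt val' nxt' g h s : h <= g ->
  (forall i, i <= g -> val' i = val i) -> (forall i, i <= g -> nxt' i = nxt i) ->
  llist val nxt h s -> llist val' nxt' h s.
Proof.
move=> + ev en; elim: s h => //= x s IH h hg [h0 vh lt l].
split=> //; rewrite ?ev ?en //; apply: IH => //.
by apply: leq_trans hg; exact: ltnW.
Qed.

Lemma map_push g n s :
  map (updf g n s) (iota 0 n.+1) = rcons (map g (iota 0 n)) s.
Proof.
rewrite -addn1 iotaD map_cat /= -cats1 {2}/updf add0n eqxx; congr (_ ++ _).
by apply/eq_in_map => i; rewrite mem_iota /updf => ?; case: eqP => //; lia.
Qed.

(** * The tournament tree, the array representation of a partition, marking and splitting *)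

Section Concrete.

Variables (N B : nat) (P : nat -> seq nat).
Notation nodes := (iota 0 N).

Definition tree_ok (T lf : nat -> nat) :=
  (forall y, 0 < y < N -> T y = maxn (T y.*2) (T y.*2.+1)) /\
  forall s, s < N -> T (N + s) = lf s.

Definition half_ok (H : nat -> nat) := forall y, y < N.*2 -> H y = y./2.

Lemma tree_max T lf : 0 < N -> tree_ok T lf ->
  (forall s, s < N -> lf s <= T 1) /\ exists2 s, s < N & T 1 = lf s.
Proof.
move=> N0 [TE TL]; split=> [s sN|].
  rewrite -TL //; have : 0 < N + s < N.*2 by lia.
  move: (N + s) => y; elim/ltn_ind: y => y IH yN.
  have [->//|y1] := eqVneq y 1.
  apply: leq_trans (IH y./2 _ _); [|lia|lia].
  rewrite (TE y./2); last by lia.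
  rewrite -{1}(odd_double_half y); case: (odd y) => /=; rewrite ?add0n ?add1n; lia.
(* Descend to a leaf that attains the maximum; the distance [2N - y] shrinks since children have
   larger indices. *)
suff gen k : forall y, 0 < y < N.*2 -> N.*2 - y <= k ->
    exists2 s, s < N & T y = lf s by apply: (gen N.*2); lia.
elim: k => [|k IH] y yN le; first by lia.
case: (ltnP y N) => [yl|yl]; last first.
  by exists (y - N); [lia | rewrite -TL ?subnKC //; lia].
rewrite TE; last by lia.
have [||s1 s1N ->] := IH y.*2; [lia|lia|].
have [||s2 s2N ->] := IH y.*2.+1; [lia|lia|].
by case: (leqP (lf s1) (lf s2)) => _; [exists s2 | exists s1].
Qed.

Section TreeSet.
Local Arguments seta : simpl never.

Lemma tree_set_correct k z e lf l st : 0 < N -> k != ahalf -> z != vx ->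
  hv st vN = N -> hv st z = l -> l < N ->
  half_ok (ha st ahalf) -> tree_ok (ha st k) lf ->
  hrun B (tree_set k z e) st (fun st' t =>
    tree_ok (ha st' k) (updf lf l (heval st e)) /\ t <= 3 * trunc_log 2 N + 9).
Proof.
move=> N0 /eqP k15 /eqP zx hN hz lN hh [TE TL].
have akE st0 i v : ha (seta st0 k i v) k = updf (ha st0 k) i v.
  by rewrite /= -[eqn k k]/(k == k) eqxx.
have ahE st0 i v : ha (seta st0 k i v) ahalf = ha st0 ahalf.
  rewrite -[LHS]/(if ahalf == k then updf (ha st0 k) i v else ha st0 ahalf).
  by case: eqP => // e0; case: k15.
have e15 : eqn ahalf k = false by apply/eqP => e0; case: k15.
set val := heval st e.
(* Invariant: the leaves are final, and the equation of an inner node can fail only at [x], the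
   parent of the cell written last. *)
have loop x : forall st0, x < N -> hv st0 vx = x ->
    ha st0 ahalf = ha st ahalf ->
    (forall y, 0 < y < N -> y <> x ->
       ha st0 k y = maxn (ha st0 k y.*2) (ha st0 k y.*2.+1)) ->
    (forall s, s < N -> ha st0 k (N + s) = updf lf l val s) ->
    hrun B (HWhile ($vx)
     (HPut k ($vx) (HMax (HA k ($vx + $vx)) (HA k ($vx + $vx + HC 1)));;
      HSet vx (HA ahalf ($vx))))%P st0 (fun st' t =>
      tree_ok (ha st' k) (updf lf l val) /\
      t <= 3 * (if x == 0 then 0 else (trunc_log 2 x).+1) + 1).
  elim/ltn_ind: x => x IH st0 xN hx hh0 T0 L0.
  apply: hrun_while => /=; rewrite hx => x0.
    subst x; rewrite x0 /=; split=> //; split=> // y yN; apply: T0 => //; lia.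
  apply/wpP => /=. rewrite e15 hx hh0 hh; last by lia.
  set st1 := setv _ _ _.
  apply: hrun_mono (IH x./2 _ st1 _ _ _ _ _); [|lia|lia|by []|exact: etrans (ahE _ _ _) hh0|..].
  - move=> st' t [ok tl]; split=> //; have /eqP/negbTE -> := x0.
    have [x1|x1] := eqVneq x 1.
      by move: tl; rewrite x1 /=; lia.
    have E : trunc_log 2 x = (trunc_log 2 x./2).+1 by apply: trunc_log2S; lia.
    by move: tl; rewrite E; case: eqP => _; lia.
  - move=> y yN yx; rewrite [ha _ k](akE _ _ _) /updf.
    have -> : (y.*2 == x) = false by apply/eqP; lia.
    have -> : (y.*2.+1 == x) = false by apply/eqP; lia.
    have [->|yx'] := eqVneq y x; last by apply: T0 => //; apply/eqP.
    by rewrite addnn addn1.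
  - move=> s sN; rewrite [ha _ k](akE _ _ _) [LHS]/updf L0 //.
    by case: eqP => //; lia.
apply/wpP => /=.
rewrite e15 hN hz -/val hh; last by lia.
set st1 := setv _ _ _.
have hv1 : hv st1 vx = (N + l)./2 by [].
apply: hrun_mono (loop _ st1 _ hv1 _ _ _); [|lia|exact: ahE|..].
- move=> st' t [ok tl]; split=> //.
  have : trunc_log 2 (N + l)./2 <= trunc_log 2 N by apply: leq_trunc_log; lia.
  by case: eqP tl => _; lia.
- move=> y yN yx; rewrite [ha _ k](akE _ _ _) /updf.
  have -> : (y.*2 == N + l) = false by apply/eqP; lia.
  have -> : (y.*2.+1 == N + l) = false by apply/eqP; lia.
  have -> : (y == N + l) = false by apply/eqP; lia.
  by apply: TE.
- move=> s sN; rewrite [ha _ k](akE _ _ _) /updf eqn_add2l TL //.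
Qed.

End TreeSet.

Lemma tree_set_frame k z e st st' : frame (tree_set k z e) st st' ->
  [/\ forall x, x != vx -> hv st' x = hv st x,
      forall j, j != k -> ha st' j = ha st j & lo st' = lo st].
Proof.
case=> fv fa fl; split=> [x xx|j jk|]; [apply: fv | apply: fa | exact: fl].
  by rewrite !inE orbb.
by rewrite !inE orbb.
Qed.

Lemma refine_bucket_frame st st' : frame refine_bucket st st' ->
  [/\ forall x, (x <= 2) || (vk <= x) -> hv st' x = hv st x,
      forall k, (7 < k) && (k != atw) -> ha st' k = ha st k & lo st' = lo st].
Proof.
case=> fv fa fl; split=> [x xx|k kk|]; [apply: fv | apply: fa | exact: fl];
  by rewrite /= !inE; lia.
Qed.

Local Opaque tree_set.

Record part (f pm ps cl ce : nat -> nat) : Prop := Part {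
  part_perm : forall i, i < N -> pm i < N /\ ps (pm i) = i;
  part_posn : forall v, v < N -> ps v < N /\ pm (ps v) = v;
  part_cls : forall v, v < N -> cl v = f v;
  part_int : forall v, v < N -> f v <= ps v < ce (f v) /\ ce (f v) <= N;
  part_mem : forall v i, v < N -> f v <= i < ce (f v) -> f (pm i) = f v }.

Lemma part_swap f pm ps cl ce v q : part f pm ps cl ce -> v < N ->
  f v <= q < ce (f v) ->
  part f (updf (updf pm (ps v) (pm q)) q v)
    (updf (updf ps (pm q) (ps v)) v q) cl ce.
Proof.
case=> p1 p2 p3 p4 p5 vN qint.
have qN : q < N by have := p4 v vN; lia.
have [uN psu] := p1 q qN; have fu := p5 v q vN qint.
set u := pm q in uN psu fu *; have [psN pmv] := p2 v vN.
split=> // [i iN|w wN|w wN|w i wN wi]; rewrite /updf.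
- case: (i =P q) => [->|iq]; first by rewrite eqxx.
  case: (i =P ps v) => [ei|ei].
    by rewrite eqxx; case: eqP => // uv; case: iq; rewrite ei -uv.
  have [piN pi] := p1 i iN; split=> //.
  case: eqP => [e|_]; first by case: ei; rewrite -e pi.
  by case: eqP => [e|_] //; case: iq; rewrite -pi e.
- case: (w =P v) => [->|wv]; first by rewrite eqxx.
  case: (w =P u) => [->|wu].
    by rewrite eqxx; case: eqP => // e; split=> //; rewrite /u -e pmv.
  have [pwN pw] := p2 w wN; split=> //.
  case: eqP => [e|_]; first by case: wu; rewrite -pw e.
  by case: eqP => [e|_] //; case: wv; rewrite -pw e.
- have := p4 v vN; have := p4 w wN.
  case: (w =P v) => [->|_]; first by lia.
  by case: (w =P u) => [->|_] //; rewrite fu; lia.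
- case: (i =P q) => [iq|_]; first by rewrite -fu /u -iq; exact: p5.
  case: (i =P ps v) => [ip|_]; last exact: p5.
  by rewrite fu -(p5 w i) // ip pmv.
Qed.

(** A pending class [s] has leaf value [s + 1], so that a root equal to 0 means that nothing is
    pending. *)
Record conc (st : hst) (x : astate) : Prop := Conc {
  conc_N : hv st vN = N;
  conc_part : part x.1 (ha st aperm) (ha st aposn) (ha st acls) (ha st acend);
  conc_mark : forall s, ha st amark s = 0;
  conc_tree : tree_ok (ha st atw) (fun s => if x.2 s then s.+1 else 0);
  conc_half : half_ok (ha st ahalf);
  conc_wf : wf N x;
  conc_preds : forall w, w < N ->
    llist (ha st apv) (ha st apn) (ha st aph w) (P w) }.

(* The marked nodes lst occupy the last positions of their classes. *)
Record marked (st : hst) (f cnt : nat -> nat) (lst : seq nat) : Prop := Marked {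
  mk_part : part f (ha st aperm) (ha st aposn) (ha st acls) (ha st acend);
  mk_mark : forall s, ha st amark s = count (fun v => f v == s) lst;
  mk_le : forall v, v < N -> f v + ha st amark (f v) <= ha st acend (f v);
  mk_in : forall v, v < N ->
    (v \in lst) = (ha st acend (f v) <= ha st aposn v + ha st amark (f v));
  mk_uniq : uniq (map (ha st astk) (iota 0 (hv st vp)));
  mk_stk : forall s, (s \in map (ha st astk) (iota 0 (hv st vp))) =
    (0 < ha st amark s);
  mk_cnt : forall v, ha st acnt v = if v \in lst then 0 else cnt v }.

Lemma mark_node_correct st f cnt pr v : marked st f cnt pr ->
  v < N -> v \notin pr -> ha st alv (hv st vy) = v ->
  hrun B mark_node st (fun st' t =>
    [/\ marked st' f cnt (rcons pr v), hv st' vy = ha st aln (hv st vy)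
      & t <= 25]).
Proof.
case=> pa mk le inn un stk ct vN vpr hv_.
have fv : ha st acls v = f v by exact: part_cls pa _ vN.
set s := f v in fv.
set c := ha st amark s; set ce := ha st acend; set q := ce s - c.+1.
have [int ceN] := part_int pa vN; rewrite -/s -/ce in int ceN.
(* An unmarked node lies before the block of the [c] marked ones. *)
have vmk : ha st aposn v + c < ce s.
  by move: (inn v vN); rewrite (negbTE vpr) -/s -/ce -/c; lia.
have qint : s <= q < ce s by rewrite /q; lia.
have qN : q < N by lia.
have [uN psu] := part_perm pa qN; have fu := part_mem pa vN qint.
rewrite -/s in fu.
have sw := part_swap pa vN qint.
apply: hrun_seq.
have run1 : hrun B count_mark st (fun st1 t =>
    [/\ [/\ hv st1 vv = v, hv st1 vy = ha st aln (hv st vy), hv st1 vs = s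
        & hv st1 vc = c.+1],
      ha st1 acnt = updf (ha st acnt) v 0, ha st1 amark = updf (ha st amark) s c.+1,
      uniq (map (ha st1 astk) (iota 0 (hv st1 vp))) /\
      (forall t, (t \in map (ha st1 astk) (iota 0 (hv st1 vp))) =
       (t == s) || (t \in map (ha st astk) (iota 0 (hv st vp))))
    & t <= 12]).
  apply/wpP; rewrite /= hv_ fv -/c addn1; split=> c0; split=> //.
    split=> // t; case: (t =P s) => [->|//].
    by rewrite stk -/c; lia.
  have snew : s \notin map (ha st astk) (iota 0 (hv st vp)) by rewrite stk -/c c0.
  rewrite [ha _ astk]/= [hv _ vp]/= addn1 map_push; split=> [|t].
    by rewrite rcons_uniq snew.
  by rewrite mem_rcons in_cons.
apply: hrun_frame; apply: hrun_mono run1 => st1 t1.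
case=> [[w10 w11 w5 w6] a6 a4 [un1 mem1] t1le] [gv ga _].
have a0 : ha st1 aperm = ha st aperm by rewrite ga.
have a1 : ha st1 aposn = ha st aposn by rewrite ga.
have a2 : ha st1 acls = ha st acls by rewrite ga.
have a3 : ha st1 acend = ha st acend by rewrite ga.
have run2 : hrun B move_marked st1 (fun st2 t =>
    [/\ ha st2 aperm = updf (updf (ha st aperm) (ha st aposn v) (ha st aperm q)) q v,
        ha st2 aposn = updf (updf (ha st aposn) (ha st aperm q) (ha st aposn v)) v q
      & t <= 12]).
  by apply/wpP; rewrite /= w10 w5 w6 a0 a1 a3.
apply: hrun_frame; apply: hrun_mono run2 => st2 t2 [b0 b1 t2le] [kv ka _].
have fin : [/\ marked st2 f cnt (rcons pr v), hv st2 vy = ha st aln (hv st vy)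
    & t1 + t2 <= 25].
  have e0 := b0; have e1 := b1.
  have e2 : ha st2 acls = ha st acls by rewrite ka.
  have e3 : ha st2 acend = ha st acend by rewrite ka.
  have e4 : ha st2 amark = updf (ha st amark) s c.+1 by rewrite ka.
  have e6 : ha st2 acnt = updf (ha st acnt) v 0 by rewrite ka.
  have u' : uniq (map (ha st2 astk) (iota 0 (hv st2 vp))) by rewrite ka // kv.
  have m' t : (t \in map (ha st2 astk) (iota 0 (hv st2 vp))) =
       (t == s) || (t \in map (ha st astk) (iota 0 (hv st vp))) by rewrite ka // kv.
  have y' : hv st2 vy = ha st aln (hv st vy) by rewrite kv.
  have k' : t1 + t2 <= 25 by lia.
  split=> //; split=> //.
  - by rewrite e0 e1 e2 e3.
  - move=> t; rewrite e4 /updf -cats1 count_cat /= -mk addn0 -/s.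
    case: (t =P s) => [->|ts]; first by rewrite eqxx addn1.
    by case: eqP => [e|_]; [case: ts | rewrite addn0].
  - move=> w wN; rewrite e4 e3 /updf; have := le w wN.
    by case: eqP => // ->; rewrite -/ce -/c; lia.
  - move=> w wN; rewrite mem_rcons in_cons inn // e1 e3 e4 /updf.
    case: (w =P v) => [->|wv] /=; first by rewrite -/s !eqxx -/ce /q; apply/esym; lia.
    have [piN ppi] := part_posn pa wN.
    (* The node displaced from [q] takes the old position of [v]; if it is not [v], that position is
       strictly before [q], so it stays unmarked. *)
    case: (w =P ha st aperm q) => [wu|wu].
      have : ha st aposn v <> q.
        by move=> e; apply: wv; rewrite wu -e; have [] := part_posn pa vN.
      by move: vmk; rewrite wu fu eqxx psu -/ce -/c /q; lia.
    case: (f w =P s) => // fws; rewrite fws -/ce -/c.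
    suff : ha st aposn w <> q by rewrite /q; lia.
    by move=> e; apply: wu; rewrite -e ppi.
  - move=> t; rewrite m' stk e4 /updf; case: eqP => [->|] //=.
  - by move=> w; rewrite e6 mem_rcons in_cons /updf ct; case: eqP.
exact: fin.
Qed.

Lemma mark_list_correct st x lst :
  conc st x -> llist (ha st alv) (ha st aln) (hv st vy) lst -> uniq lst ->
  (forall v, v \in lst -> v < N) -> hv st vp = 0 ->
  hrun B (HWhile ($vy) mark_node) st (fun st' t =>
    marked st' x.1 (ha st acnt) lst /\ t <= 26 * size lst + 1).
Proof.
move=> [hN pa mk _ _ wx _] ll ul lN p0.
apply: (@hrun_list B nat (fun s1 st' => marked st' x.1 (ha st acnt) s1 /\
    exists2 s2, lst = s1 ++ s2 & llist (ha st' alv) (ha st' aln) (hv st' vy) s2)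
    lst (fun=> 25)).
- split; last by exists lst.
  split=> //; rewrite ?p0 //=.
  + by move=> v vN; rewrite mk; have := part_int pa vN; lia.
  + by move=> v vN; rewrite mk in_nil; have := part_int pa vN; lia.
  + by move=> s; rewrite mk.
- move=> s1 v s2 st' es [ms [s2' es2 ll']] fr.
  have e2 : s2' = v :: s2 by move/eqP: es; rewrite es2 eqseq_cat // => /andP[_ /eqP].
  rewrite e2 /= in ll'; have [y0 vy lt ll2] := ll'.
  have vl : v \in lst by rewrite es mem_cat mem_head orbT.
  have vs1 : v \notin s1.
    by move: ul; rewrite es cat_uniq /= negb_or => /and4P[_ /andP[]].
  split; first by rewrite /=; lia.
  have run := mark_node_correct ms (lN v vl) vs1 vy.
  apply: hrun_frame; apply: hrun_mono run => st2 t [m2 y2 t2] [_ fa _].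
  do 2!split=> //; exists s2; first by rewrite cat_rcons.
  by rewrite y2 !fa.
- move=> st' t [ms [s2 es ll']] fr; rewrite big_const_seq count_predT iter_addn_0 => tl.
  have e2 : s2 = [::] by have := congr1 size es; rewrite size_cat; case: s2 {ll' es} => //= *; lia.
  by rewrite e2 in ll'; split.
Qed.

Lemma perm_interval f pm ps cl ce (p : pred nat) a b :
  part f pm ps cl ce -> b <= N -> (forall u, u < N -> p u = (a <= ps u < b)) ->
  perm_eq (filter p nodes) (map pm (iota a (b - a))).
Proof.
move=> pa bN pE; apply: uniq_perm.
- by apply/filter_uniq/iota_uniq.
- rewrite map_inj_in_uniq ?iota_uniq // => i j; rewrite !mem_iota => ir jr e.
  have [|_ <-] := part_perm pa (i := i); first by lia.
  by rewrite e; have [|_ ->] := part_perm pa (i := j); first by lia.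
- move=> u; rewrite mem_filter mem_iota /= add0n; apply/andP/mapP => [[pu uN]|[i]].
    exists (ps u); last by have [] := part_posn pa uN.
    by move: pu; rewrite pE // mem_iota; lia.
  rewrite mem_iota => ir ->; have [|? pi] := part_perm pa (i := i); first by lia.
  by rewrite pE // pi; lia.
Qed.

Lemma count_interval f pm ps cl ce (p : pred nat) a b :
  part f pm ps cl ce -> b <= N -> (forall u, u < N -> p u = (a <= ps u < b)) ->
  count p nodes = b - a.
Proof.
move=> pa bN pE; rewrite -size_filter (perm_size (perm_interval pa bN pE)).
by rewrite size_map size_iota.
Qed.

Lemma part_class f pm ps cl ce s u : part f pm ps cl ce ->
  (exists2 v, v < N & f v = s) -> u < N -> (f u == s) = (s <= ps u < ce s).
Proof.
move=> pa [v vN vs] uN; apply/eqP/idP => [us|h].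
  by have [] := part_int pa uN; rewrite us.
have := part_mem pa (v := v) (i := ps u) vN; rewrite vs.
by have [_ ->] := part_posn pa uN; apply.
Qed.

(** The invariant between two calls of [split_class]: [S] holds the classes still to be split, the
    top of the stack first, hence [rev S] in the array. Their marked nodes form the ends of their
    intervals. *)
Record splitting (st : hst) (x : astate) (M : pred nat) (S : seq nat) : Prop :=
  Splitting {
  sp_N : hv st vN = N;
  sp_part : part x.1 (ha st aperm) (ha st aposn) (ha st acls) (ha st acend);
  sp_mark : forall s, s \notin S -> ha st amark s = 0;
  sp_in : forall v, v < N -> x.1 v \in S ->
    M v = (ha st acend (x.1 v) <= ha st aposn v + ha st amark (x.1 v));
  sp_le : forall v, v < N -> x.1 v \in S ->
    x.1 v + ha st amark (x.1 v) <= ha st acend (x.1 v);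
  sp_name : forall s, s \in S -> exists2 v, v < N & x.1 v = s /\ M v;
  sp_uniq : uniq S;
  sp_vp : hv st vp = size S;
  sp_stk : forall i, i < size S -> ha st astk i = nth 0 (rev S) i;
  sp_tree : tree_ok (ha st atw) (fun s => if x.2 s then s.+1 else 0);
  sp_half : half_ok (ha st ahalf);
  sp_wf : wf N x }.

Section SplitCost.

Variables c1 c2 : nat.
Hypothesis c2_ge : 3 * trunc_log 2 N + 30 <= c2.
Notation credit := (credit N P c1 c2).

(** A proper split releases [c2] of credit, which covers the tree update of at most
    [3 * trunc_log 2 N + 9]. The rest is charged to the marked nodes and to a constant. *)
Lemma split_class_correct st x M s S : splitting st x M (s :: S) ->
  hrun B split_class st (fun st' t => [/\ splitting st' (split1 N M x s) M S,
    ha st' amark = updf (ha st amark) s 0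
    & t + credit (split1 N M x s) <= credit x + 4 * ha st amark s + 20]).
Proof.
case=> hN pa mk min mle nam uS hp stk tr hh wx.
have /andP[sS {}uS] : (s \notin S) && uniq S := uS.
have [v0 v0N [v0s v0M]] := nam s (mem_head _ _).
have N0 : 0 < N by lia.
have top : ha st astk (size S) = s by rewrite stk //= rev_cons nth_rcons size_rev ltnn eqxx.
have rest i : i < size S -> ha st astk i = nth 0 (rev S) i.
  by move=> iS; rewrite stk /= ?rev_cons ?nth_rcons ?size_rev ?iS //; lia.
set c := ha st amark s; set e := ha st acend s; set q := e - c.
have [int eN] := part_int pa v0N; rewrite v0s -/e in int eN.
have sce : s + c <= e by have := mle v0 v0N; rewrite v0s mem_head -/c -/e; apply.
have c0 : 0 < c.
  by have := min v0 v0N; rewrite v0s mem_head -/c -/e v0M => /(_ isT) /esym; lia.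
have cls u : u < N -> (x.1 u == s) = (s <= ha st aposn u < e).
  by apply: part_class pa _; exists v0.
have mkE u : u < N -> x.1 u = s -> M u = (q <= ha st aposn u).
  by move=> uN us; rewrite min // us ?mem_head // -/c -/e /q; apply/idP/idP; lia.
have eunm : unm N x.1 M s = q - s.
  apply: (count_interval pa); first by rewrite /q; lia.
  move=> u uN; rewrite cls //; case h : (_ <= _ < _) => /=.
    by rewrite mkE //; [lia | apply/eqP; rewrite cls].
  by move: h; rewrite /q; lia.
have emrk : mrk N x.1 M s = c.
  rewrite /mrk (_ : c = e - q); last by rewrite /q; lia.
  apply: (count_interval pa) => // u uN; rewrite cls //; case h : (_ <= _ < _) => /=.
    by rewrite mkE //; [lia | apply/eqP; rewrite cls].
  by move: h; rewrite /q; lia.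
have spE : splits N x.1 M s = (s < q) by rewrite /splits eunm emrk c0 andbT; lia.
apply/wpP; rewrite /split_class /= hp /= subn1 /= top -/c -/e -/q.
(* When [q = s], the class is entirely marked and keeps its name. *)
split=> qs; last first.
  have nsp : splits N x.1 M s = false by rewrite spE; lia.
  rewrite /split1 nsp; split; [|by []|by lia].
  split=> //=.
  - move=> t tS; rewrite /updf; case: eqP => // /eqP ts.
    by apply: mk; rewrite in_cons negb_or ts.
  - move=> v vN vS; rewrite /updf.
    have /eqP/negbTE -> : x.1 v <> s by move=> vs; rewrite -vs vS in sS.
    by rewrite min ?in_cons ?vS ?orbT.
  - move=> v vN vS; rewrite /updf.
    have /eqP/negbTE -> : x.1 v <> s by move=> vs; rewrite -vs vS in sS.
    by rewrite mle ?in_cons ?vS ?orbT.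
  - by move=> t tS; apply: nam; rewrite in_cons tS orbT.
have {}qs : s < q by lia.
have sp : splits N x.1 M s by rewrite spE.
have saq : s + unm N x.1 M s = q by rewrite eunm; lia.
have qe : q < e by rewrite /q; lia.
set y := split1 N M x s.
have cases v : v < N -> [\/ [/\ x.1 v = s, M v & y.1 v = q],
      [/\ x.1 v = s, M v = false & y.1 v = s]
    | [/\ x.1 v <> s, x.1 v <> q & y.1 v = x.1 v]].
  by move=> vN; rewrite -saq; exact: split1_cases.
have yW z : y.2 z = x.2 z || (z == agenda N x.2 x.1 M s) by rewrite /y /split1 sp.
have agN : agenda N x.2 x.1 M s < N by rewrite /agenda saq; case: ifP; lia.
set st0 := setv _ vi q.
apply: (@hrun_count B (fun i st' => hv st' vi = i /\ forall w, w < N ->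
  ha st' acls w = if q <= ha st aposn w < i then q else ha st acls w) q e 2).
- exact: ltnW.
- by split=> // w wN; case: ifP => //; lia.
- move=> i st' ir [hi hc] fr; have [fv fa _] := fr.
  have qv : hv st' vq = q by rewrite fv.
  have ev : hv st' ve = e by rewrite fv.
  have pm' : ha st' aperm = ha st aperm by rewrite fa.
  split; first by rewrite /= hi ev; lia.
  have [|piN ppi] := part_perm pa (i := i); first by lia.
  apply/wpP; rewrite /= hi qv pm' addn1; do 2!split=> //.
  move=> w wN; rewrite /updf hc //; case: (w =P _) => [->|wi].
    by rewrite ppi; case: ifP => //; lia.
  have : ha st aposn w <> i.
    by move=> wi'; apply: wi; rewrite -wi'; have [] := part_posn pa wN.
  by case: ifP; case: ifP => //; lia.
- move=> st1 t1 [hi hc] fr t1le; have [fv fa _] := fr.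
  have v8 : hv st1 ve = e by rewrite fv.
  split; first by rewrite /= hi v8; lia.
  have a0 : ha st1 aperm = ha st aperm by rewrite fa.
  have a1 : ha st1 aposn = ha st aposn by rewrite fa.
  have a3 : ha st1 acend = updf (updf (ha st acend) s q) q e by rewrite fa.
  have a4 : ha st1 amark = updf (ha st amark) s 0 by rewrite fa.
  have a5 : ha st1 astk = ha st astk by rewrite fa.
  have a13 : ha st1 atw = ha st atw by rewrite fa.
  have a15 : ha st1 ahalf = ha st ahalf by rewrite fa.
  have v2 : hv st1 vN = N by rewrite fv.
  have v5 : hv st1 vs = s by rewrite fv.
  have v6 : hv st1 vc = c by rewrite fv.
  have v7 : hv st1 vq = q by rewrite fv.
  have v12 : hv st1 vp = size S by rewrite fv.
  (* The three branches that choose [vz] share this conclusion, hence the arbitrary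
     postcondition. *)
  have fin st2 Q : ha st2 = ha st1 -> hv st2 vN = N -> hv st2 vp = size S ->
      hv st2 vz = agenda N x.2 x.1 M s ->
      (forall st3 t3, splitting st3 y M S -> ha st3 amark = updf (ha st amark) s 0 -> t3 <= 3 * trunc_log 2 N + 9 -> Q st3 t3) ->
      wp B (tree_set atw vz ($vz + HC 1)%P) st2 Q.
    move=> ea w2 w12 w13 QH; apply/wpP.
    have h2 : half_ok (ha st2 ahalf) by rewrite ea a15.
    have tr2 : tree_ok (ha st2 atw) (fun s => if x.2 s then s.+1 else 0) by rewrite ea a13.
    have run := tree_set_correct (k := atw) (z := vz) ($vz + HC 1)%P N0 isT isT w2 w13 agN h2 tr2.
    apply: hrun_frame; apply: hrun_mono run => st3 t3 [tr3 t3le] /tree_set_frame[gv ga _].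
    have ynS v : v < N -> y.1 v \in S -> [/\ x.1 v <> s, x.1 v <> q & y.1 v = x.1 v].
      move=> vN; have [[vs vm ->]|[vs vm ->]|//] := cases v vN.
        move=> qS; have [|u uN [uq _]] := nam q; first by rewrite in_cons qS orbT.
        by have := split1_fresh wx sp uN; rewrite saq.
      by rewrite (negbTE sS).
    apply: QH => //; last (by rewrite ga // ea a4); split.
    - by rewrite gv.
    - rewrite !ga // ea a0 a1 a3; case: (pa) => p1 p2 p3 p4 p5; split=> //.
      + move=> w wN; rewrite hc //; have [[ws wm ->]|[ws wm ->]|[ws wq ->]] := cases w wN.
        * have := p4 w wN; rewrite ws -/e mkE // in wm *.
          by case: ifP => //; lia.
        * have := p4 w wN; rewrite ws -/e mkE // in wm *.
          by case: ifP => //; rewrite ?p3 ?ws //; lia.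
        * case: ifP => [h|_]; last exact: p3.
          by case: ws; apply/eqP; rewrite cls //; lia.
      + move=> w wN; rewrite /updf; have [[ws wm ->]|[ws wm ->]|[ws wq ->]] := cases w wN.
        * by rewrite eqxx; have := p4 w wN; rewrite ws -/e mkE // in wm *; lia.
        * have -> : (s == q) = false by apply/eqP; lia.
          by rewrite eqxx; have := p4 w wN; rewrite ws -/e mkE // in wm *; lia.
        * by move/eqP/negbTE: (ws) => ->; move/eqP/negbTE: (wq) => ->; exact: p4.
      + move=> w i wN; rewrite /updf.
        have piE : s <= i < e -> y.1 (ha st aperm i) = if q <= i then q else s.
          move=> ir; have [|piN ppi] := p1 i; first by lia.
          have fpi : x.1 (ha st aperm i) = s by apply/eqP; rewrite cls // ppi.
          by have := mkE _ piN fpi; rewrite ppi; have [[_ -> ->]|[_ -> ->]|[//]] := cases _ piN => <-.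
        have [[ws wm ->]|[ws wm ->]|[ws wq ->]] := cases w wN.
        * by rewrite eqxx => ir; rewrite piE; [case: ifP; lia | lia].
        * have -> : (s == q) = false by apply/eqP; lia.
          by rewrite eqxx => ir; rewrite piE; [case: ifP; lia | lia].
        * move/eqP/negbTE: (ws) => wsF; move/eqP/negbTE: (wq) => wqF; rewrite wsF wqF => ir.
          have [|piN ppi] := p1 i; first by have := p4 w wN; lia.
          have := p5 w i wN ir; have [[e1 _ _]|[e1 _ _]|[_ _ ->] //] := cases _ piN;
            by rewrite e1 => e2; case: ws.
    - move=> t tS; rewrite ga // ea a4 /updf; case: (t =P s) => // /eqP ts.
      by apply: mk; rewrite in_cons negb_or ts.
    - move=> v vN vS; have [vs vq vE] := ynS v vN vS; move: vS; rewrite vE => vS.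
      rewrite !ga // ea a1 a3 a4 /updf.
      move/eqP/negbTE: (vs) => ->; move/eqP/negbTE: (vq) => ->.
      by rewrite min // in_cons vS orbT.
    - move=> v vN vS; have [vs vq vE] := ynS v vN vS; move: vS; rewrite vE => vS.
      rewrite !ga // ea a3 a4 /updf.
      move/eqP/negbTE: (vs) => ->; move/eqP/negbTE: (vq) => ->.
      by rewrite mle // in_cons vS orbT.
    - move=> t tS; have [|v vN [vt vM]] := nam t; first by rewrite in_cons tS orbT.
      exists v => //; split=> //; have ts : t <> s by move=> e'; rewrite -e' tS in sS.
      by have [[e1 _ _]|[e1 _ _]|[_ _ ->]] := cases v vN; rewrite // -vt in ts.
    - by [].
    - by rewrite gv.
    - by move=> i iS; rewrite ga // ea a5; exact: rest.
    - case: tr3 => TE TL; split=> // t tN; rewrite TL // /updf yW /= w13.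
      by case: (t =P _) => [->|]; rewrite ?orbT ?orbF ?addn1.
    - by rewrite ga.
    - exact: wf_split1.
  rewrite v2 v5 v6 v7 a13; have [_ TL] := tr; rewrite TL; last by lia.
  have ag : agenda N x.2 x.1 M s = if x.2 s || (c < q - s) then q else s.
    by rewrite /agenda saq emrk eunm.
  have cr := credit_split1 P c1 c2 wx sp; rewrite -/y in cr.
  split=> [xs|xs]; last split=> dif; apply: fin => //=.
  - by rewrite ag; case: (x.2 s) xs.
  - by move=> st3 t3 sp3 mk3 t3le; split=> //; lia.
  - by rewrite ag (_ : c < q - s) ?orbT //; lia.
  - by move=> st3 t3 sp3 mk3 t3le; split=> //; lia.
  - by rewrite ag (_ : (c < q - s) = false); [case: (x.2 s) xs | lia].
  - by move=> st3 t3 sp3 mk3 t3le; split=> //; lia.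
Qed.

End SplitCost.

End Concrete.

(** * Refinement by one bucket of marked nodes *)

Section Refine.

Variables (N B : nat) (P : nat -> seq nat).
Notation nodes := (iota 0 N).
Local Opaque tree_set.

Variables c1 c2 : nat.
Hypothesis c2_ge : 3 * trunc_log 2 N + 30 <= c2.
Notation credit := (credit N P c1 c2).
Notation conc := (conc N P).
Notation splitting := (splitting N).

Lemma split_list_correct M S : forall st x, splitting st x M S ->
  hrun B (HWhile ($vp) split_class) st (fun st' t =>
    splitting st' (foldl (split1 N M) x S) M [::] /\
    t + credit (foldl (split1 N M) x S) <=
      credit x + \sum_(s <- S) (4 * ha st amark s + 21) + 1).
Proof.
elim: S => [|s S IH] st x sp; apply: hrun_while => /=; rewrite (sp_vp sp) //= => _.
  by rewrite big_nil; split=> //; lia.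
have /andP[sS _] := sp_uniq sp.
apply: hrun_mono (split_class_correct B P c1 c2_ge sp) => st1 t1 [sp1 mk1 le1].
apply: hrun_mono (IH _ _ sp1) => st2 t2 [sp2 le2]; split=> //.
rewrite big_cons; move: le2; rewrite mk1.
have -> : \sum_(t <- S) (4 * updf (ha st amark) s 0 t + 21) =
    \sum_(t <- S) (4 * ha st amark t + 21).
  rewrite big_seq [RHS]big_seq; apply: eq_bigr => t tS; rewrite /updf.
  by case: eqP => // ts; rewrite -ts tS in sS.
have arith (a b d m Z : nat) : t1 + b <= d + 4 * m + 20 ->
  t2 + a <= b + Z + 1 -> (t1 + t2).+1 + a <= d + (4 * m + 21 + Z) + 1 by lia.
exact: arith.
Qed.

Lemma refine_bucket_correct st x k M lst : conc st x -> hv st vk = k ->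
  llist (ha st alv) (ha st aln) (ha st alh k) lst -> uniq lst ->
  (forall v, (v \in lst) = (v < N) && M v) ->
  hrun B refine_bucket st (fun st' t => exists S,
    [/\ touched N M x.1 S, conc st' (foldl (split1 N M) x S),
        ha st' alh = updf (ha st alh) k 0,
        forall v, ha st' acnt v = if v \in lst then 0 else ha st acnt v
      & t + credit (foldl (split1 N M) x S) <= credit x + 60 * size lst + 10]).
Proof.
move=> cx hk ll ul lE; apply: hrun_frame; apply/wpP; rewrite /= hk.
set st0 := setv _ vp 0.
have c0 : conc st0 x by case: cx => *; split.
have lN v : v \in lst -> v < N by rewrite lE => /andP[].
have run := mark_list_correct B c0 ll ul lN erefl.
apply: hrun_frame; apply: hrun_mono run => st1 t1 [ms t1le] [fv fa _].
set S := rev (map (ha st1 astk) (iota 0 (hv st1 vp))).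
have SE s : (s \in S) = (0 < ha st1 amark s) by rewrite mem_rev (mk_stk ms).
have tS : touched N M x.1 S.
  split; first by rewrite rev_uniq (mk_uniq ms).
    move=> v vN Mv; rewrite SE (mk_mark ms) -has_count; apply/hasP.
    by exists v; rewrite ?lE ?vN.
  move=> s; rewrite SE (mk_mark ms) -has_count => /hasP[v vl /eqP vs].
  by exists v => //; exact: lN.
have sp : splitting st1 x M S.
  split.
  - by rewrite fv; case: cx.
  - exact: mk_part ms.
  - by move=> s; rewrite SE lt0n negbK => /eqP.
  - by move=> v vN _; rewrite -(mk_in ms) // lE vN.
  - by move=> v vN _; exact: mk_le ms _ vN.
  - move=> s; rewrite SE (mk_mark ms) -has_count => /hasP[v vl /eqP vs].
    by move: (vl); rewrite lE => /andP[vN Mv]; exists v.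
  - by rewrite rev_uniq (mk_uniq ms).
  - by rewrite size_rev size_map size_iota.
  - move=> i; rewrite size_rev size_map size_iota => ip.
    by rewrite revK (nth_map 0) ?size_iota // nth_iota.
  - by rewrite fa; case: cx.
  - by rewrite fa; case: cx.
  - by case: cx.
apply: hrun_frame; apply: hrun_mono (split_list_correct sp) => st2 t2 [sp2 t2le].
move=> fr2 /refine_bucket_frame[gv ga _].
have [_ fa2 _] := fr2.
exists S; split=> //.
- case: sp2 => h1 h2 h3 _ _ _ _ _ _ h4 h5 h6; split=> //.
    by move=> s; apply: h3.
  by move=> w wN; rewrite !ga //; case: cx => *; auto.
- by rewrite fa2 // fa.
- by move=> v; rewrite fa2 // (mk_cnt ms).
(* Every class on the stack has a marked node, to which the constant 21 can be charged. *)
- have : \sum_(s <- S) (4 * ha st1 amark s + 21) <= 25 * size lst.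
    have h := sum_count_uniq lst x.1 (let: And3 u _ _ := tS in u).
    rewrite -(leq_pmul2l (isT : 0 < 25)) in h; apply: leq_trans h.
    rewrite big_distrr /= big_seq [leqRHS]big_seq; apply: leq_sum => s.
    by rewrite SE (mk_mark ms); lia.
  have arith (a b Z m : nat) : t1 <= 26 * m + 1 -> t2 + a <= b + Z + 1 ->
    Z <= 25 * m -> (1 + (1 + (1 + (t1 + t2)))) + a <= b + 60 * m + 10 by lia.
  exact: arith.
Qed.

End Refine.

(** * Processing a splitter, and the main loop *)

Definition count_arc : hcmd :=
  (HSet vv (HA apv ($vy));;
   HSet vy (HA apn ($vy));;
   HSet vc (HA acnt ($vv) + HC 1);;
   HPut acnt ($vv) ($vc);;
   HSet vg ($vg + HC 1);;
   HPut alv ($vg) ($vv);;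
   HPut aln ($vg) (HA alh ($vc));;
   HPut alh ($vc) ($vg))%P.

Definition count_node : hcmd :=
  (HSet vy (HA aph (HA aperm ($vi)));;
   HWhile ($vy) count_arc;;
   HSet vi ($vi + HC 1))%P.

Definition count_class : hcmd :=
  (HSet vi ($vz);;
   HSet ve (HA acend ($vz));;
   HSet vg (HC 0);;
   HWhile ($ve - $vi) count_node)%P.

Definition refine_levels : hcmd :=
  (HSet vk (HC 1);;
   HWhile (HA alh ($vk)) (refine_bucket;; HSet vk ($vk + HC 1)))%P.

Definition process_class : hcmd :=
  (HSet vz (HA atw (HC 1) - HC 1);;
   tree_set atw vz (HC 0);;
   count_class;;
   refine_levels)%P.

Definition main_loop : hcmd := HWhile (HA atw (HC 1)) process_class.

Lemma count_class_frame st st' : frame count_class st st' ->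
  [/\ hv st' vN = hv st vN,
      forall k, k \notin [:: acnt; alh; alv; aln] -> ha st' k = ha st k
    & lo st' = lo st].
Proof.
case=> fv fa fl; split=> [|k kk|]; [exact: fv | apply: fa | exact: fl].
by move: kk; rewrite /= !inE; lia.
Qed.

Section Main.

Variables (N B : nat) (P : nat -> seq nat).
Notation nodes := (iota 0 N).
Local Opaque tree_set refine_bucket.

Hypothesis P_lt : forall w v, w < N -> v \in P w -> v < N.

Variables c1 c2 : nat.
Hypothesis c1_ge : 100 <= c1.
Hypothesis c2_ge : 3 * trunc_log 2 N + 30 <= c2.
Notation credit := (credit N P c1 c2).
Notation conc := (conc N P).

Definition bucket st h (p : pred nat) := exists lst,
  [/\ llist (ha st alv) (ha st aln) h lst, uniq lst & forall v, (v \in lst) = p v].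

(** [q] lists the tails of the arcs scanned so far. A count rises by single steps and its node
    enters bucket [k] just when it reaches [k], so bucket [k] holds each node of count at least [k]
    exactly once. *)
Record counted (st : hst) (q : seq nat) : Prop := Counted {
  ct_cnt : forall v, ha st acnt v = count_mem v q;
  ct_le : forall k, ha st alh k <= hv st vg;
  ct_bucket : forall k,
    bucket st (ha st alh k) (fun v => 0 < k <= count_mem v q) }.

Lemma count_arc_correct st q v : counted st q -> ha st apv (hv st vy) = v ->
  hrun B count_arc st (fun st' t => [/\ counted st' (rcons q v),
    hv st' vy = ha st apn (hv st vy) & t <= 8]).
Proof.
case=> cc le bu hy; apply/wpP; rewrite /= hy cc.
set c := count_mem v q + 1; set g := hv st vg + 1.
set st' := seta _ alh c g; split=> //.
have cE u : count_mem u (rcons q v) = count_mem u q + (u == v).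
  by rewrite -cats1 count_cat /= addn0 eq_sym.
have E6 : ha st' acnt = updf (ha st acnt) v c by [].
have E7 : ha st' alh = updf (ha st alh) c g by [].
have E8 : ha st' alv = updf (ha st alv) g v by [].
have E9 : ha st' aln = updf (ha st aln) g (ha st alh c) by [].
have Eg : hv st' vg = g by [].
split=> [u|k|k].
- rewrite E6 /updf cE cc; case: (u =P v) => [->|] //; by rewrite addn0.
- rewrite Eg E7 /updf; case: eqP => // _; apply: leq_trans (le k) _; rewrite /g; lia.
- rewrite /bucket E7 E8 E9.
  have fr h lst : h <= hv st vg -> llist (ha st alv) (ha st aln) h lst ->
      llist (updf (ha st alv) g v) (updf (ha st aln) g (ha st alh c)) h lst.
    move=> hg; apply: llist_frame hg _ _ => i ig; rewrite /updf;
    by case: eqP => //; rewrite /g in ig *; lia.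
  have [lst [ll ul lE]] := bu k.
  rewrite [updf _ c g k]/updf; case: (k =P c) => [kc|kc].
    exists (v :: lst); split=> /=.
    - have h := le c; have uE F y : updf F g y g = y by rewrite /updf eqxx.
      rewrite !uE; split=> //; try by rewrite /g; lia.
      by apply: fr => //; rewrite -kc.
    - by rewrite ul lE kc /c; case: (0 < _) => //=; lia.
    - move=> u; rewrite in_cons lE cE kc /c; case: (u =P v) => [->|_] /=; lia.
  exists lst; split=> // [|u]; first exact: fr.
  by rewrite lE cE; move: kc; rewrite /c; case: (u =P v) => [->|_] /= ?; lia.
Qed.

Lemma count_node_correct st q w : counted st q -> w < N ->
  ha st aperm (hv st vi) = w -> llist (ha st apv) (ha st apn) (ha st aph w) (P w) ->
  hrun B count_node st (fun st' t => [/\ counted st' (q ++ P w),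
    hv st' vi = (hv st vi).+1 & t <= 9 * size (P w) + 3]).
Proof.
move=> cq wN hw ll; apply/wpP; rewrite /= hw.
set st0 := setv _ _ _.
have c0 : counted st0 q by case: cq.
apply: (@hrun_list B nat (fun s1 st' => counted st' (q ++ s1) /\
    exists2 s2, P w = s1 ++ s2 & llist (ha st' apv) (ha st' apn) (hv st' vy) s2)
    (P w) (fun=> 8)).
- by rewrite cats0; split=> //; exists (P w).
- move=> s1 v s2 st' es [ms [s2' es2 ll']] fr.
  have e2 : s2' = v :: s2 by move/eqP: es; rewrite es2 eqseq_cat // => /andP[_ /eqP].
  rewrite e2 /= in ll'; have [y0 vy lt ll2] := ll'.
  split; first by rewrite /=; lia.
  have run := count_arc_correct ms vy.
  apply: hrun_frame; apply: hrun_mono run => st2 t [m2 y2 t2] [_ fa _].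
  split=> //; rewrite -rcons_cat; split=> //.
  by exists s2; [rewrite cat_rcons | rewrite y2 !fa].
- move=> st' t [ms [s2 es ll']] fr; rewrite big_const_seq count_predT iter_addn_0 => tl.
  have e2 : s2 = [::] by have := congr1 size es; rewrite size_cat; case: s2 {ll' es} => //= *; lia.
  rewrite e2 in ll'; split; first by rewrite /= ll'.
  have [fv _ _] := fr; split=> //; first by case: ms.
    by rewrite /= fv // addn1.
  by lia.
Qed.

Definition arcs_of (pm : nat -> nat) a b := flatten [seq P (pm i) | i <- iota a (b - a)].

Lemma count_class_correct st x r e : conc st x -> hv st vz = r -> r < N ->
  ha st acend r = e -> r <= e <= N ->
  (forall v, ha st acnt v = 0) -> (forall k, ha st alh k = 0) ->
  hrun B count_class st (fun st' t => counted st' (arcs_of (ha st aperm) r e) /\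
    t <= 9 * size (arcs_of (ha st aperm) r e) + 4 * (e - r) + 4).
Proof.
move=> cx hz rN he re z6 z7; apply/wpP; rewrite /= hz he.
set st0 := setv _ vg 0.
have c0 : counted st0 [::].
  split=> [v|k|k]; rewrite [ha st0]/= ?z6 ?z7 //.
  by exists [::]; split=> // v; rewrite in_nil /=; case: k.
have szE : size (arcs_of (ha st aperm) r e) =
    \sum_(i <- iota r (e - r)) size (P (ha st aperm i)).
  by rewrite /arcs_of size_flatten /shape -map_comp sumnE big_map.
apply: (@hrun_list B nat (fun s1 st' => hv st' vi = r + size s1 /\
    counted st' (flatten [seq P (ha st aperm i) | i <- s1]))
    (iota r (e - r)) (fun i => 9 * size (P (ha st aperm i)) + 3)).
- by split=> //=; rewrite addn0.
- move=> s1 i s2 st' es [hi cs] fr; have [fv fa _] := fr.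
  have ei : i = r + size s1.
    have := congr1 (nth 0 ^~ (size s1)) es; rewrite nth_cat ltnn subnn /= nth_iota //.
    by have := congr1 size es; rewrite size_iota size_cat /=; lia.
  have ir : i < e.
    by have := congr1 size es; rewrite size_iota size_cat /=; lia.
  have v8 : hv st' ve = e by rewrite fv.
  have p0 : ha st' aperm = ha st aperm by rewrite fa.
  split; first by rewrite /= hi v8; lia.
  have [|piN _] := part_perm (conc_part cx) (i := i); first by lia.
  have ll : llist (ha st' apv) (ha st' apn) (ha st' aph (ha st aperm i)) (P (ha st aperm i)).
    by rewrite !fa //; exact: conc_preds cx _ piN.
  have hw : ha st' aperm (hv st' vi) = ha st aperm i by rewrite p0 hi -ei.
  have run := count_node_correct cs piN hw ll.
  apply: hrun_mono run => st2 t [m2 i2 t2]; split=> //; split.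
    by rewrite i2 hi size_rcons addnS.
  by rewrite map_rcons flatten_rcons.
- move=> st' t [hi cs] fr tl; have [fv fa _] := fr.
  have v8 : hv st' ve = e by rewrite fv.
  rewrite size_iota in hi; split; first by rewrite /= hi v8; lia.
  split=> //; rewrite szE.
  move: tl; have -> : \sum_(i <- iota r (e - r)) (9 * size (P (ha st aperm i)) + 3).+1 =
    9 * \sum_(i <- iota r (e - r)) size (P (ha st aperm i)) + 4 * (e - r).
    rewrite big_distrr /= (eq_bigr (fun i => 9 * size (P (ha st aperm i)) + 4)).
      by rewrite big_split /= big_const_seq count_predT size_iota iter_addn_0.
    by move=> i _; lia.
  by lia.
Qed.

Lemma llist_nil val nxt h s : llist val nxt h s -> (h == 0) = (s == [::]).
Proof. by case: s => [->//|v s [h0 _ _ _]]; case: h h0. Qed.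

Lemma sum_levels d k : 0 < k ->
  \sum_(v <- nodes) (d v - k.-1) =
    count (fun v => k <= d v) nodes + \sum_(v <- nodes) (d v - k).
Proof.
move=> k0; rewrite -sum1_count [X in X + _]big_mkcond -big_split /=; apply: eq_bigr => v _.
by case: ifP; lia.
Qed.

(** Levels are nested, so the first empty bucket ends the loop. The sum counts the entries of the
    buckets from [k] on; a nonempty bucket has an entry to absorb its constant overhead, whence 80
    per entry in place of 60. *)
Lemma refine_levels_loop d m : forall st x k, \sum_(v <- nodes) (d v - k.-1) <= m ->
  0 < k -> conc st x -> hv st vk = k -> (forall v, N <= v -> d v = 0) ->
  (forall j, j < k -> ha st alh j = 0) ->
  (forall j, k <= j -> bucket st (ha st alh j) (fun v => j <= d v)) ->
  (forall v, d v < k -> ha st acnt v = 0) ->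
  (1 < k -> forall v, ha st acnt v = 0) ->
  hrun B (HWhile (HA alh ($vk)) (refine_bucket;; HSet vk ($vk + HC 1))%P) st
    (fun st' t => exists y,
      [/\ lrun N d k x y, conc st' y, forall j, ha st' alh j = 0,
          forall v, ha st' acnt v = 0
        & t + credit y <= credit x + 80 * (\sum_(v <- nodes) (d v - k.-1)) + 1]).
Proof.
elim: m => [|m IH] st x k dm k0 cx hk dN zlt bu z6 z61;
  have [lst [ll ul lE]] := bu k (leqnn k);
  have lN v : (v \in lst) = (v < N) && (k <= d v) by
    rewrite lE; (case: (ltnP v N) => //= vN; rewrite dN //; lia).
all: have szl : size lst = count (fun v => k <= d v) nodes by
  rewrite -size_filter; apply/perm_size/uniq_perm;
    rewrite ?filter_uniq ?iota_uniq // => v;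
  rewrite mem_filter mem_iota lN add0n andbC.
all: have sl := sum_levels d k0; rewrite -szl in sl.
all: apply: hrun_while => /=; rewrite hk => h0.
1,3: have lst0 : lst = [::] by apply/eqP; rewrite -(llist_nil ll) h0.
1,2: have dk v : d v < k by rewrite ltnNge -lE lst0.
1,2: exists x; split=> // [|j|v|]; [exact: Lrun0 | | exact: z6 | lia].
1,2: case: (ltnP j k) => jk; [exact: zlt|].
1,2: have [lj [llj _ ljE]] := bu j jk; apply/eqP; rewrite (llist_nil llj).
1,2: case: lj {llj} ljE => // v s /(_ v); rewrite mem_head => /esym.
1,2: by have := dk v; lia.
  have s0 : size lst = 0 by lia.
  by case: h0; apply/eqP; rewrite (llist_nil ll) -size_eq0 s0.
have lst1 : 0 < size lst by rewrite lt0n size_eq0 -(llist_nil ll); apply/eqP.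
apply: hrun_seq; apply: hrun_frame.
have run := refine_bucket_correct B c1 c2_ge cx hk ll ul lN.
apply: hrun_mono run => st1 t1 [S [tS cx1 e7 e6 le1]] /refine_bucket_frame[gv ga _].
apply/wpP; rewrite /= gv // hk; set st2 := setv _ _ _.
have c2' : conc st2 (foldl (split1 N (level d k)) x S) by case: cx1 => *; split.
have E7 : ha st2 alh = updf (ha st alh) k 0 by [].
have E6 v : ha st2 acnt v = 0.
  rewrite [LHS]e6 lE; case: ifP => // /negbT dk; apply: z6; lia.
apply: hrun_mono (IH st2 _ k.+1 _ _ c2' _ dN _ _ _ _).
- move=> st3 t3 [y [lr cy z7 z6' le3]]; exists y; split=> //.
    apply: LrunS tS lr.
    case: (lst) lst1 lN => // v s _ /(_ v); rewrite mem_head => /esym/andP[vN kd].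
    by exists v.
  move: le3; rewrite sl /=.
  move: le1 lst1; move: (credit _) (credit _) (credit _) => a b e; lia.
- by rewrite /=; lia.
- by [].
- by rewrite /= addn1.
- move=> j jk; rewrite E7 /updf; case: eqP => // jk'; apply: zlt; lia.
- move=> j jk; rewrite E7 /updf; case: eqP => [|_]; first by lia.
  have [|lj [llj ulj ljE]] := bu j; first exact: ltnW.
  by exists lj; rewrite /bucket [ha st2]/= !ga.
- by move=> v _; exact: E6.
- by move=> _ v; exact: E6.
Qed.

Lemma arcs_perm f pm ps cl ce r e : part N f pm ps cl ce ->
  (exists2 v, v < N & f v = r) -> ce r = e -> e <= N ->
  perm_eq (filter (fun w => f w == r) nodes) (map pm (iota r (e - r))).
Proof.
move=> pa rv <- eN; apply: (perm_interval pa) => // u uN.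
exact: part_class pa rv uN.
Qed.

Lemma arcs_count f pm r e v :
  perm_eq (filter (fun w => f w == r) nodes) (map pm (iota r (e - r))) ->
  count_mem v (arcs_of pm r e) = dg N P f r v.
Proof.
move=> pe; rewrite /dg -big_filter (perm_big _ pe) /= big_map /arcs_of.
by rewrite count_flatten sumnE -map_comp big_map.
Qed.

Lemma arcs_size f pm r e : r <= e ->
  perm_eq (filter (fun w => f w == r) nodes) (map pm (iota r (e - r))) ->
  \sum_(w <- nodes | f w == r) (size (P w)).+1 = size (arcs_of pm r e) + (e - r).
Proof.
move=> re pe; rewrite -big_filter (perm_big _ pe) /= big_map /arcs_of.
rewrite size_flatten /shape sumnE -map_comp big_map.
rewrite (eq_bigr (fun i => size (P (pm i)) + 1)); last by move=> i _; rewrite addn1.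
by rewrite big_split /= sum1_size size_iota.
Qed.

Lemma arcs_lt f pm r e v : (forall i, i < N -> pm i < N) -> e <= N ->
  perm_eq (filter (fun w => f w == r) nodes) (map pm (iota r (e - r))) ->
  N <= v -> dg N P f r v = 0.
Proof.
move=> pmN eN pe Nv; rewrite -(arcs_count v pe); apply/count_memPn/negP.
case/flattenP=> s /mapP[i]; rewrite mem_iota => ir -> /P_lt h.
by have := h (pmN i _); lia.
Qed.

Hypothesis N_gt0 : 0 < N.

Definition idle st := (forall k, ha st alh k = 0) /\ forall v, ha st acnt v = 0.

Lemma process_class_correct st x : conc st x -> idle st -> ha st atw 1 <> 0 ->
  hrun B process_class st (fun st' t => exists r y,
    [/\ r < N, x.2 r & forall s, s < N -> x.2 s -> s <= r] /\
    [/\ lrun N (dg N P x.1 r) 1 (pop x r) y, conc st' y, idle st'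
      & t + credit y + 1 <= credit x]).
Proof.
move=> cx [z7 z6] T1.
have [Tle [r rN Tr]] := tree_max N_gt0 (conc_tree cx).
have Wr : x.2 r by move: Tr; case: (x.2 r).
rewrite Wr in Tr.
have rmax s : s < N -> x.2 s -> s <= r.
  by move=> sN Ws; have := Tle s sN; rewrite Ws Tr.
have rv : exists2 v, v < N & x.1 v = r by have [_ _] := conc_wf cx; exact.
set pm := ha st aperm; set e := ha st acend r.
have [int eN] : r < e /\ e <= N.
  have [v vN vr] := rv; have := part_int (conc_part cx) vN; rewrite vr -/e; lia.
have pe := arcs_perm (conc_part cx) rv erefl eN; rewrite -/pm -/e in pe.
have pmN i : i < N -> pm i < N by move=> iN; have [] := part_perm (conc_part cx) iN.
set q := arcs_of pm r e.
apply: hrun_seq; apply/wpP; rewrite /= Tr subn1 /=.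
set st1 := setv _ vz r.
apply: hrun_seq; apply: hrun_frame.
have run := tree_set_correct B (k := atw) (z := vz) (l := r) (st := st1) (HC 0)
  N_gt0 isT isT (conc_N cx) erefl rN (conc_half cx) (conc_tree cx).
apply: hrun_mono run => st2 t2 [tr2 t2le] /tree_set_frame[gv ga _].
have c2' : conc st2 (pop x r).
  case: (cx) => h1 h2 h3 h4 h5 h6 h7; split.
  - by rewrite gv.
  - by rewrite !ga.
  - by rewrite ga.
  - case: tr2 => TE TL; split=> // s sN; rewrite TL // /updf /=.
    by case: (s =P r) => _; rewrite ?andbF ?andbT.
  - by rewrite ga.
  - exact: wf_pop.
  - by rewrite !ga.
apply: hrun_seq; apply: hrun_frame.
have z62 v : ha st2 acnt v = 0 by rewrite ga //; exact: z6.
have z72 v : ha st2 alh v = 0 by rewrite ga //; exact: z7.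
have e2 : ha st2 acend r = e by rewrite ga.
have re : r <= e <= N by rewrite (ltnW int).
have v2 : hv st2 vz = r by rewrite gv.
have run2 := count_class_correct c2' v2 rN e2 re z62 z72.
apply: hrun_mono run2 => st3 t3 [ct t3le] /count_class_frame[kN ka _].
have p2 : ha st2 aperm = pm by rewrite ga.
rewrite p2 -/q in ct t3le.
have c3 : conc st3 (pop x r).
  case: (c2') => h1 h2 h3 h4 h5 h6 h7; split=> //.
  - by rewrite kN.
  - by rewrite !ka.
  - by rewrite ka.
  - by rewrite ka.
  - by rewrite ka.
  - by rewrite !ka.
apply: hrun_seq; apply/wpP => /=.
set st4 := setv _ vk 1.
set d := dg N P x.1 r.
have c4 : conc st4 (pop x r) by case: c3 => *; split.
have qd v : count_mem v q = d v by exact: arcs_count.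
have dN v : N <= v -> d v = 0 by exact: (arcs_lt pmN eN pe).
have z74 j : j < 1 -> ha st4 alh j = 0.
  rewrite ltnS leqn0 => /eqP ->; have [lst [ll _ lE]] := ct_bucket ct 0.
  apply/eqP; rewrite (llist_nil ll); case: lst {ll} lE => // v s /(_ v).
  by rewrite mem_head.
have b4 j : 0 < j -> bucket st4 (ha st4 alh j) (fun v => j <= d v).
  move=> j0; have [lst [ll ul lE]] := ct_bucket ct j; exists lst; split=> // v.
  by rewrite lE j0 qd.
have z64 v : d v < 1 -> ha st4 acnt v = 0.
  by rewrite [LHS](ct_cnt ct) qd; case: (d v).
have z64' : 1 < 1 -> forall v, ha st4 acnt v = 0 by [].
have run5 := refine_levels_loop (k := 1) (leqnn _) isT c4 erefl dN z74 b4 z64 z64'.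
apply: hrun_mono run5.
move=> st5 t5 [y [lr cy z75 z65 t5le]]; exists r, y; do 2!split=> //.
have sd : \sum_(v <- nodes) (d v - 1.-1) <= size q.
  rewrite (eq_bigr (fun v => count_mem v q)); last by move=> v _; rewrite subn0 qd.
  exact: (sum_count_uniq q id (iota_uniq 0 N)).
have cp := credit_pop P c1 c2 rN Wr.
rewrite (arcs_size (ltnW int) pe) -/q in cp.
(* Counting costs 9 and refining 80 per arc, and counting costs 4 per node, so 100 suffices; the
   tree update and the constants are covered by [c2]. *)
have cq : 100 * (size q + (e - r)) <= c1 * (size q + (e - r)) by rewrite leq_mul2r c1_ge orbT.
move: t5le cp; move: (credit _) (credit _) (credit _) => a b c; lia.
Qed.

(** The credit bounds the time and proves termination as well: every pass lowers it by more than its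
    own cost, which also pays for the loop test. *)
Lemma main_loop_correct m : forall st x, credit x <= m -> conc st x -> idle st ->
  hrun B main_loop st (fun st' t => exists z,
    [/\ mrun N P x z, conc st' z & t <= credit x + 1]).
Proof.
elim: m => [|m IH] st x xm cx id; apply: hrun_while => /= T1.
1,3: exists x; split=> //; [apply: Mrun0 => s sN | lia].
1,2: have [Tle _] := tree_max N_gt0 (conc_tree cx); have := Tle s sN.
1,2: by rewrite T1; case: (x.2 s).
all: apply: hrun_mono (process_class_correct cx id T1) => st1 t1.
all: move=> [r [y [[rN Wr rmax] [lr cy id1 le1]]]].
  by move: le1 xm; move: (credit _) (credit _) => a b; lia.
have ym : credit y <= m by move: le1 xm; move: (credit _) (credit _) => a b; lia.
apply: hrun_mono (IH st1 y ym cy id1) => st2 t2 [z [mr cz le2]]; exists z; split=> //.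
  exact: MrunS lr mr.
by move: le1 le2; move: (credit _) (credit _) => a b; lia.
Qed.

End Main.

(** * Reading the digraph *)

(** Halves are tabulated because the machine cannot divide. [N] is taken from the counter because
    [slow] does not allow storing the sum of two variables. *)
Definition init_nodes : hcmd :=
  (HGet vn (HC 0);;
   HGet vm (HC 1);;
   HWhile ($vn + $vm - $vi)
     (HPut aperm ($vi) ($vi);;
      HPut aposn ($vi) ($vi);;
      HPut ahalf ($vi + $vi) ($vi);;
      HPut ahalf ($vi + $vi + HC 1) ($vi);;
      HSet vi ($vi + HC 1));;
   HSet vN ($vi);;
   HSet vi ($vn);;
   HPut acend (HC 0) ($vN))%P.

(** The pointer advances by three single increments, as [slow] requires. *)
Definition read_triple : hcmd :=
  (HGet vs ($va + HC 3);;
   HGet vt ($va + HC 4);;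
   HGet vc ($va + HC 5);;
   HSet va ($va + HC 1);;
   HSet va ($va + HC 1);;
   HSet va ($va + HC 1))%P.

Definition add_arc w u : hcmd :=
  (HSet vq ($vq + HC 1);;
   HPut apv ($vq) ($u);;
   HPut apn ($vq) (HA aph ($w));;
   HPut aph ($w) ($vq))%P.

(** At the first edge of a colour its bucket is still empty, and the node of that edge becomes the
    leaf of the colour. Colours themselves may exceed N and cannot index the leaves. *)
Definition add_colour : hcmd :=
  HIf (HA alh ($vc)) HSkip (HPut aloc ($vc) ($vi);; tree_set atc vi ($vc + HC 1))%P.

Definition add_to_bucket : hcmd :=
  (HSet vg ($vg + HC 1);;
   HPut alv ($vg) ($vi);;
   HPut aln ($vg) (HA alh ($vc));;
   HPut alh ($vc) ($vg);;
   HSet vi ($vi + HC 1))%P.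

Definition read_edge : hcmd :=
  (read_triple;; add_arc vi vs;; add_arc vt vi;; add_colour;; add_to_bucket)%P.

Definition read_edges : hcmd := HWhile ($vN - $vi)%P read_edge.

Definition colour_loop : hcmd :=
  HWhile (HA atc (HC 1))
    (HSet vk (HA atc (HC 1) - HC 1);;
     refine_bucket;;
     HSet vz (HA aloc ($vk));;
     tree_set atc vz (HC 0))%P.

(** The output overwrites the input and therefore comes last. The palette has N colours because
    class names are positions below N. *)
Definition output_colours : hcmd :=
  (HSet vi (HC 0);;
   HWhile ($vn - $vi)
     (HOut ($vi + HC 1) (HA acls ($vi));; HSet vi ($vi + HC 1));;
   HOut (HC 0) ($vN))%P.

Definition colour_refinement : hcmd :=
  (init_nodes;;
   HIf ($vN) (tree_set atw vz (HC 1);; read_edges;; colour_loop;; main_loop) HSkip;;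
   output_colours)%P.

(* Edge e is node n + e; an arc leads from each vertex to its out-edges and from
   each edge to its target. *)
Section Graph.

Variables (n m : nat) (sr tg co : nat -> nat).
Notation N := (n + m).

(** The predecessor lists after [e] edges have been read; [rev] reflects insertion at the front. *)
Definition preds_upto e w : seq nat :=
  if w < n then [seq n + i | i <- rev (iota 0 e) & tg i == w]
  else if w - n < e then [:: sr (w - n)] else [::].
Definition preds := preds_upto m.

Definition bucket_upto e j : seq nat :=
  [seq n + i | i <- rev (iota 0 e) & co i == j].

Definition colour_upto e : pred nat := fun j => has (fun i => co i == j) (iota 0 e).

Definition edge_mark j : pred nat := fun v => (n <= v) && (co (v - n) == j).

Definition arun (z : astate) := exists2 y,
  crun N edge_mark (colour_upto m) init_classes y & mrun N preds y z.

Hypothesis sr_lt : forall e, e < m -> sr e < n.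
Hypothesis tg_lt : forall e, e < m -> tg e < n.

Lemma preds_lt w v : w < N -> v \in preds w -> v < N.
Proof.
move=> wN; rewrite /preds /preds_upto; case: ifP => wn.
  by case/mapP=> i; rewrite mem_filter mem_rev mem_iota => /andP[_ ?] ->; lia.
case: ifP => // wm; rewrite inE => /eqP ->.
by have := sr_lt wm; lia.
Qed.

Lemma iota_rcons e : rev (iota 0 e.+1) = e :: rev (iota 0 e).
Proof. by rewrite -addn1 iotaD rev_cat /= add0n. Qed.

Lemma bucket_uniq e j : uniq (bucket_upto e j).
Proof.
by rewrite map_inj_uniq ?filter_uniq ?rev_uniq ?iota_uniq // => x y /addnI.
Qed.

Lemma mem_bucket j v : (v \in bucket_upto m j) = (v < N) && edge_mark j v.
Proof.
apply/mapP/andP => [[i]|[vN /andP[nv cv]]].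
  rewrite mem_filter mem_rev mem_iota => /andP[ci im] ->.
  by rewrite /edge_mark addKn ci; lia.
by exists (v - n); [rewrite mem_filter mem_rev mem_iota cv; lia | lia].
Qed.

Lemma bucket_size e j : size (bucket_upto e j) = count (fun i => co i == j) (iota 0 e).
Proof. by rewrite size_map size_filter count_rev. Qed.

Section Run.
Variable B : nat.
Hypothesis B_ge : n + 3 * m + 3 <= B.
Local Opaque tree_set refine_bucket.

(** [aloc] and the leaf values are inverse to each other between the colours in [C] and the occupied
    leaves. All these leaves lie below [lim], so the node of the next edge is a free leaf. *)
Definition colour_tree st (C : pred nat) lim := exists lf,
  [/\ tree_ok N (ha st atc) lf,
      forall j, C j -> ha st aloc j < lim /\ lf (ha st aloc j) = j.+1
    & forall l, l < N -> lf l <> 0 -> C (lf l).-1 /\ ha st aloc (lf l).-1 = l].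

Record edges_read st e : Prop := EdgesRead {
  er_i : hv st vi = n + e;
  er_a : hv st va = 3 * e;
  er_q : hv st vq = e.*2;
  er_g : hv st vg = e;
  er_ph : forall w, w < N -> ha st aph w <= e.*2;
  er_preds : forall w, w < N -> llist (ha st apv) (ha st apn) (ha st aph w) (preds_upto e w);
  er_lh : forall j, ha st alh j <= e;
  er_bucket : forall j, llist (ha st alv) (ha st aln) (ha st alh j) (bucket_upto e j);
  er_tree : colour_tree st (colour_upto e) (n + e) }.

Definition is_input (st : hst) :=
  forall e, e < m -> [/\ lo st (3 * e + 3) = sr e, lo st (3 * e + 4) = tg e
    & lo st (3 * e + 5) = co e].

Lemma add_arc_correct w u st pw ps g : w \in [:: vi; vt] -> u \in [:: vs; vi] ->
  hv st vq = g -> hv st w = pw ->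
  (forall x, x < N -> ha st aph x <= g) ->
  (forall x, x < N -> llist (ha st apv) (ha st apn) (ha st aph x) (ps x)) ->
  pw < N ->
  hrun B (add_arc w u) st (fun st' t => [/\ hv st' vq = g.+1,
    forall x, x < N -> ha st' aph x <= g.+1,
    forall x, x < N -> llist (ha st' apv) (ha st' apn) (ha st' aph x)
      (if x == pw then hv st u :: ps x else ps x) & t <= 4]).
Proof.
move=> wi ui hq hw le ll pN; apply/wpP.
have ew : eqn w vq = false by move: wi; rewrite !inE => /orP[] /eqP ->.
have eu : eqn u vq = false by move: ui; rewrite !inE => /orP[] /eqP ->.
rewrite /= ew eu hw hq addn1; split=> //.
- by move=> x xN; rewrite /updf; case: eqP => // _; apply: leqW; exact: le.
- move=> x xN.
  have fr : llist (updf (ha st apv) g.+1 (hv st u))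
      (updf (ha st apn) g.+1 (ha st aph pw)) (ha st aph x) (ps x).
    by apply: llist_frame (le x xN) _ _ (ll x xN) => i ig; rewrite /updf; case: eqP => //; lia.
  rewrite [ha _ apv]/= [ha _ apn]/= [ha _ aph]/= [updf _ pw _ x]/updf.
  case: (x =P pw) => [xp|//] /=; have h := le x xN.
  have uE F y : updf F g.+1 y g.+1 = y by rewrite /updf eqxx.
  by rewrite !uE; rewrite -xp in fr *; split=> //; lia.
Qed.

Lemma add_colour_correct st C C' c i : hv st vN = N -> half_ok N (ha st ahalf) ->
  hv st vi = i -> hv st vc = c -> i < N -> colour_tree st C i ->
  (ha st alh c == 0) = ~~ C c -> (forall j, C' j = C j || (j == c)) ->
  hrun B add_colour st (fun st' t =>
    colour_tree st' C' i.+1 /\ t <= 3 * trunc_log 2 N + 12).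
Proof.
move=> hN hh hi hc iN [lf [tr lfC lfV]] h0 CE; apply/wpP; rewrite /= hc.
split=> c0; last first.
  have nC : C c = false by move/eqP: c0; rewrite h0 => /negbTE.
  apply/wpP; rewrite hi; set st1 := seta _ _ _ _.
  have run := tree_set_correct B (k := atc) (z := vi) (st := st1) ($vc + HC 1)%P
    (leq_ltn_trans (leq0n i) iN) isT isT hN hi iN hh tr.
  apply: hrun_frame; apply: hrun_mono run => st2 t2 [tr2 t2le] /tree_set_frame[_ ga _].
  split; last by lia.
  have eloc : ha st2 aloc = updf (ha st aloc) c i by rewrite ga.
  have {}tr2 : tree_ok N (ha st2 atc) (updf lf i (c + 1)) by rewrite -hc.
  exists (updf lf i (c + 1)); rewrite eloc; split=> // [j|l lN]; rewrite /updf.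
    rewrite CE => /orP[Cj|/eqP ->]; last by rewrite !eqxx addn1.
    have jc : (j == c) = false by apply/eqP => jc; rewrite -jc Cj in nC.
    have [h1 h2] := lfC j Cj; rewrite jc h2; split; first exact: leqW.
    by case: eqP => // ji; move: h1; rewrite ji ltnn.
  case: (l =P i) => [-> _|li l0].
    by rewrite CE addn1 /= !eqxx orbT.
  have [h1 h2] := lfV l lN l0; rewrite CE h1; split=> //.
  by case: eqP => // lc; rewrite -lc h1 in nC.
have Cc : C c by move/eqP: c0; rewrite h0 negbK.
split; last by lia.
exists lf; split=> // [j|l lN l0].
  rewrite CE => Cj; have {}Cj : C j by case/orP: Cj => // /eqP ->.
  by have [h1 h2] := lfC j Cj; split=> //; exact: leqW.
by have [h1 h2] := lfV l lN l0; rewrite CE h1.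
Qed.

Lemma read_triple_correct st e : e < m -> is_input st -> hv st va = 3 * e ->
  hrun B read_triple st (fun st' t => [/\ hv st' vs = sr e, hv st' vt = tg e,
    hv st' vc = co e, hv st' va = 3 * e.+1 & t <= 6]).
Proof.
move=> em /(_ e em) [h3 h4 h5] ha; apply/wpP; rewrite /= ha h3 h4 h5.
by do 3!(split; first by lia); split=> //; lia.
Qed.

Lemma add_to_bucket_correct st e c : hv st vi = n + e -> hv st vc = c ->
  hv st vg = e -> (forall j, ha st alh j <= e) ->
  (forall j, llist (ha st alv) (ha st aln) (ha st alh j) (bucket_upto e j)) ->
  c = co e ->
  hrun B add_to_bucket st (fun st' t => [/\ hv st' vi = n + e.+1, hv st' vg = e.+1,
    forall j, ha st' alh j <= e.+1,
    forall j, llist (ha st' alv) (ha st' aln) (ha st' alh j) (bucket_upto e.+1 j)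
    & t <= 5]).
Proof.
move=> hi hc hg le ll ce; apply/wpP; rewrite /= hi hc hg !addn1 addnS; split=> // j.
  by rewrite /updf; case: eqP => // _; apply: leqW; exact: le.
have fr : llist (updf (ha st alv) e.+1 (n + e))
    (updf (ha st aln) e.+1 (ha st alh c)) (ha st alh j) (bucket_upto e j).
  by apply: llist_frame (le j) _ _ (ll j) => i ig; rewrite /updf; case: eqP => //; lia.
rewrite [ha _ alv]/= [ha _ aln]/= [ha _ alh]/= [updf _ c _ j]/updf.
rewrite /bucket_upto iota_rcons /= -ce (eq_sym c).
case: (j =P c) => [jc|//] /=; have h := le j.
have uE F y : updf F e.+1 y e.+1 = y by rewrite /updf eqxx.
by rewrite !uE; rewrite -jc in fr *; split=> //; lia.
Qed.

Lemma read_edge_correct st e : edges_read st e -> e < m -> is_input st ->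
  hv st vN = N -> half_ok N (ha st ahalf) ->
  hrun B read_edge st (fun st' t =>
    edges_read st' e.+1 /\ t <= 3 * trunc_log 2 N + 40).
Proof.
case=> hi hA hq hg lph lpr llh lbu ct em inp hN hh.
have iN : n + e < N by lia.
apply: hrun_seq; apply: hrun_frame.
apply: hrun_mono (read_triple_correct em inp hA) => st1 t1.
move=> [h5 h17 h6 h16 t1le] [v1 a1 _].
apply: hrun_seq; apply: hrun_frame.
have q1 : hv st1 vq = e.*2 by rewrite v1.
have i1 : hv st1 vi = n + e by rewrite v1.
have lph1 w : w < N -> ha st1 aph w <= e.*2 by rewrite a1 //; exact: lph.
have lpr1 w : w < N ->
    llist (ha st1 apv) (ha st1 apn) (ha st1 aph w) (preds_upto e w).
  by rewrite !a1 //; exact: lpr.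
have run2 := @add_arc_correct vi vs st1 _ _ _ isT isT q1 i1 lph1 lpr1 iN.
apply: hrun_mono run2 => st2 t2 [q2 lph2 lpr2 t2le] [v2 a2 _].
apply: hrun_seq; apply: hrun_frame.
have t17 : hv st2 vt = tg e by rewrite v2.
have tN : tg e < N by have := tg_lt em; lia.
have run3 := @add_arc_correct vt vi st2 _ _ _ isT isT q2 t17 lph2 lpr2 tN.
apply: hrun_mono run3 => st3 t3 [q3 lph3 lpr3 t3le] [v3 a3 _].
apply: hrun_seq; apply: hrun_frame.
have N3 : hv st3 vN = N by rewrite v3 // v2 // v1.
have hh3 : half_ok N (ha st3 ahalf) by rewrite a3 // a2 // a1.
have i3 : hv st3 vi = n + e by rewrite v3 // v2.
have c3 : hv st3 vc = co e by rewrite v3 // v2.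
have a7 : ha st3 alh = ha st alh by rewrite a3 // a2 // a1.
have ct3 : colour_tree st3 (colour_upto e) (n + e).
  have [lf [? ? ?]] := ct; exists lf.
  have -> : ha st3 atc = ha st atc by rewrite a3 // a2 // a1.
  by have -> : ha st3 aloc = ha st aloc by rewrite a3 // a2 // a1.
(* The bucket head doubles as the flag that tells whether a colour has been met. *)
have cnew : (ha st3 alh (co e) == 0) = ~~ colour_upto e (co e).
  rewrite a7 (llist_nil (lbu _)) -size_eq0 bucket_size -leqn0 leqNgt -has_count.
  by [].
have CE j : colour_upto e.+1 j = colour_upto e j || (j == co e).
  by rewrite /colour_upto -addn1 iotaD has_cat /= add0n orbF (eq_sym j).
apply: hrun_mono (add_colour_correct N3 hh3 i3 c3 iN ct3 cnew CE) => st4 t4.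
move=> [ct4 t4le] [v4 a4 _].
apply: hrun_frame.
have g4 : hv st4 vg = e by rewrite v4 // v3 // v2 // v1.
have i4 : hv st4 vi = n + e by rewrite v4.
have c4 : hv st4 vc = co e by rewrite v4.
have llh4 j : ha st4 alh j <= e by rewrite a4 // a7.
have lbu4 j : llist (ha st4 alv) (ha st4 aln) (ha st4 alh j) (bucket_upto e j).
  have -> : ha st4 alv = ha st alv by rewrite a4 // a3 // a2 // a1.
  have -> : ha st4 aln = ha st aln by rewrite a4 // a3 // a2 // a1.
  by rewrite a4 // a7.
apply: hrun_mono (add_to_bucket_correct i4 c4 g4 llh4 lbu4 erefl) => st5 t5.
move=> [i5 g5 llh5 lbu5 t5le] [v5 a5 _].
split; last by lia.
split=> //.
- by rewrite v5 // v4 // v3 // v2.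
- by rewrite v5 // v4 // q3 doubleS.
- by move=> w wN; rewrite a5 // a4 // doubleS; exact: lph3.
- move=> w wN; rewrite !a5 // !a4 //.
  have -> : preds_upto e.+1 w = if w == tg e then n + e :: (if w == n + e
      then sr e :: preds_upto e w else preds_upto e w)
      else if w == n + e then sr e :: preds_upto e w else preds_upto e w.
    rewrite /preds_upto iota_rcons /=; case: (ltnP w n) => wn.
      have -> : (w == n + e) = false by apply/eqP; lia.
      by rewrite eq_sym; case: eqP.
    have -> : (w == tg e) = false by apply/eqP; have := tg_lt em; lia.
    case: (w =P n + e) => [->|ne]; first by rewrite addKn ltnSn ltnn.
    have -> : (w - n < e.+1) = (w - n < e) by lia.
    by [].
  have := lpr3 w wN; rewrite v2 // i1.
  by rewrite h5.
- have [lf [? ? ?]] := ct4; exists lf; rewrite addnS.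
  by rewrite !a5.
Qed.

Lemma read_edges_correct st : edges_read st 0 -> is_input st ->
  hv st vN = N -> half_ok N (ha st ahalf) ->
  hrun B read_edges st (fun st' t =>
    edges_read st' m /\ t <= m * (3 * trunc_log 2 N + 41) + 1).
Proof.
move=> e0 inp hN hh.
apply: (@hrun_count B (fun i st' => edges_read st' i) 0 m
  (3 * trunc_log 2 N + 40)) => //.
- move=> e st' /andP[_ em] er [fv fa fl].
  have N' : hv st' vN = N by rewrite fv.
  have h' : half_ok N (ha st' ahalf) by rewrite fa.
  have i' : is_input st' by move=> i im; rewrite fl //; exact: inp.
  split; first by rewrite /= N' (er_i er); lia.
  exact: read_edge_correct.
- move=> st' t er [fv _ _] tl; split; last by split=> //; move: tl; lia.
  by rewrite /= (er_i er) fv // hN; lia.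
Qed.

Definition empty_hst lo0 := HSt (fun=> 0) (fun _ _ => 0) lo0.

Lemma init_nodes_correct lo0 : lo0 0 = n -> lo0 1 = m ->
  hrun B init_nodes (empty_hst lo0) (fun st t =>
    [/\ [/\ hv st vn = n, hv st vN = N & hv st vi = n],
        (forall i, i < N -> ha st aperm i = i /\ ha st aposn i = i),
        half_ok N (ha st ahalf), ha st acend 0 = N & t <= 6 * N + 6]).
Proof.
move=> h0 h1; apply/wpP; rewrite /= h0 h1; split; first by lia.
split; first by lia.
set st0 := setv _ vm m.
apply: (@hrun_count B (fun i st => hv st vi = i /\ forall j, j < i ->
    [/\ ha st aperm j = j, ha st aposn j = j, ha st ahalf j.*2 = j
      & ha st ahalf j.*2.+1 = j]) 0 N 5) => //.
- move=> i st /andP[_ iN] [hi ar] [fv fa _].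
  have e0 : hv st vn = n by rewrite fv.
  have e1 : hv st vm = m by rewrite fv.
  split; first by rewrite /= e0 e1 hi; lia.
  apply/wpP; rewrite /= hi !addn1 addnn; do 2!split=> //.
  move=> j; rewrite ltnS leq_eqVlt /updf => /orP[/eqP ->|ji].
    rewrite !eqxx; split=> //; case: eqP => //; lia.
  have [h2 h3 h4 h5] := ar j ji.
  rewrite h2 h3 h4 h5; split; case: eqP => //; try lia.
    by case: eqP => //; lia.
  by case: eqP => //; lia.
- move=> st t [hi ar] [fv fa _]; rewrite subn0 => tl.
  have e0 : hv st vn = n by rewrite fv.
  have e1 : hv st vm = m by rewrite fv.
  split; first by rewrite /= e0 e1 hi; lia.
  split; [by split; rewrite /= ?hi ?e0| | |by rewrite /= hi|by lia].
    by move=> i iN; have [] := ar i iN.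
  move=> y yN /=; have yN2 : y./2 < N by lia.
  have [_ _ h2 h3] := ar _ yN2.
  by rewrite -{1}(odd_double_half y); case: (odd y); rewrite ?add1n ?add0n.
Qed.

(** * Splitting off the edge colours *)

Section Costs.
Variables c1 c2 : nat.
Hypothesis c2_ge : 3 * trunc_log 2 N + 30 <= c2.
Hypothesis N_gt0 : 0 < N.
Notation credit := (credit N preds c1 c2).

Lemma colour_loop_correct k : forall st (C : pred nat) x,
  count (fun e => C (co e)) (iota 0 m) <= k ->
  (forall j, C j -> colour_upto m j) -> conc N preds st x ->
  colour_tree st C N -> (forall j, llist (ha st alv) (ha st aln) (ha st alh j)
    (if C j then bucket_upto m j else [::])) -> (forall v, ha st acnt v = 0) ->
  hrun B colour_loop st (fun st' t => exists y,
    [/\ crun N edge_mark C x y, conc N preds st' y, idle st'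
      & t + credit y <= credit x +
          count (fun e => C (co e)) (iota 0 m) * (3 * trunc_log 2 N + 90) + 1]).
Proof.
elim: k => [|k IH] st C x Ck Csub cx ct ll z6;
  (apply: hrun_while => /= T1; have [lf [tr lfC lfV]] := ct;
   have [Tle [l lN Tl]] := tree_max N_gt0 tr).
1,3: have C0 j : ~~ C j by
  apply/negP => Cj; have [h1 h2] := lfC j Cj; have := Tle _ h1; rewrite T1 h2.
1,2: exists x; split=> //; [exact: Crun0 | split=> // j | lia].
1,2: by have := ll j; rewrite (negbTE (C0 j)).
all: rewrite Tl in T1; have [Cj lj] := lfV l lN T1.
all: set j := (lf l).-1 in Cj lj.
all: have Tj : ha st atc 1 = j.+1 by rewrite Tl /j; lia.
(* A remaining colour occurs on some edge, so the tree update of each round can be charged to an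
   edge and the loop costs a logarithm per edge, whatever [p] is. *)
all: have bj : 0 < size (bucket_upto m j) by
  rewrite bucket_size -has_count; exact: Csub.
all: have ck : count (fun e => C (co e)) (iota 0 m) = size (bucket_upto m j) +
   count (fun e => C (co e) && (co e != j)) (iota 0 m).
1,3: rewrite bucket_size; elim: (iota 0 m) => //= e s ->.
1,2: by case: (co e =P j) => [->|_]; rewrite ?Cj ?andbT ?andbF /=; lia.
  by lia.
have jmax i : C i -> i <= j.
  by move=> Ci; have [h1 h2] := lfC i Ci; have := Tle _ h1; rewrite Tj h2.
apply: hrun_seq; apply/wpP; rewrite /= Tj subn1 /=.
set st1 := setv _ vk j.
have cx1 : conc N preds st1 x by case: cx => *; split.
have ll1 : llist (ha st1 alv) (ha st1 aln) (ha st1 alh j) (bucket_upto m j).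
  by have := ll j; rewrite Cj.
apply: hrun_seq; apply: hrun_frame.
have run := refine_bucket_correct B c1 c2_ge cx1 erefl ll1 (bucket_uniq m j) (mem_bucket j).
apply: hrun_mono run => st2 t2 [S [tS cx2 e7 e6 le2]] /refine_bucket_frame[gv ga _].
apply: hrun_seq; apply/wpP => /=.
have loc2 : ha st2 aloc = ha st aloc by rewrite ga.
have k2 : hv st2 vk = j by rewrite gv.
rewrite loc2 k2; set st3 := setv _ vz _.
have z3 : hv st3 vz = l by rewrite /= lj.
have N3 : hv st3 vN = N by case: cx2.
have h3 : half_ok N (ha st3 ahalf) by case: cx2.
have a3 p : ha st3 p = ha st2 p by [].
have tr3 : tree_ok N (ha st3 atc) lf by rewrite a3 ga.
apply: hrun_frame.
have run3 := tree_set_correct B (k := atc) (z := vz) (st := st3) (HC 0)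
  N_gt0 isT isT N3 z3 lN h3 tr3.
apply: hrun_mono run3 => st4 t4 [tr4 t4le] /tree_set_frame[gv4 ga4 _].
set C' : pred nat := fun i => C i && (i != j).
have cx4 : conc N preds st4 (foldl (split1 N (edge_mark j)) x S).
  case: (cx2) => h1' h2' h3' h4' h5' h6' h7'; split=> //.
  - by rewrite gv4.
  - by rewrite !ga4.
  - by rewrite ga4.
  - by rewrite ga4.
  - by rewrite ga4.
  - by rewrite !ga4.
have ct4 : colour_tree st4 C' N.
  have l4 : ha st4 aloc = ha st aloc by rewrite ga4 // a3.
  exists (updf lf l 0); rewrite l4; split=> //.
    move=> i /andP[Ci ij]; have [h1' h2'] := lfC i Ci; split=> //.
    rewrite /updf; case: eqP => // il.
    by case/eqP: ij; rewrite -[i]/(i.+1.-1) -h2' il.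
  move=> p pN; rewrite /updf; case: (p =P l) => // pl p0.
  have [h1' h2'] := lfV p pN p0; split=> //; rewrite /C' h1' /=.
  by apply/eqP => pj; apply: pl; rewrite -h2' pj lj.
have ll4 i : llist (ha st4 alv) (ha st4 aln) (ha st4 alh i)
    (if C' i then bucket_upto m i else [::]).
  rewrite !ga4 // !a3 e7 /updf /C'; case: (i =P j) => [->|_].
    by rewrite andbF.
  by rewrite andbT !ga //; exact: ll.
have z64 v : ha st4 acnt v = 0.
  by rewrite ga4 // a3 e6; case: ifP => // _; exact: z6.
apply: hrun_mono (IH st4 C' _ _ _ cx4 ct4 ll4 z64); last 2 first.
- by rewrite /C'; lia.
- by move=> i /andP[/Csub].
move=> st5 t5 [y [cr cy id5 le5]]; exists y; split=> //.
  exact: (CrunS Cj jmax (C' := C') _ tS cr).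
rewrite ck; move: le5 le2; rewrite -/C'.
set r1 := count _ _; move: (credit _) (credit _) (credit _) => a b c; nia.
Qed.

End Costs.

Lemma output_colours_correct st f : hv st vn = n -> hv st vN = N ->
  (forall v, v < n -> ha st acls v = f v) ->
  hrun B output_colours st (fun st' t => [/\ lo st' 0 = N,
    forall v, v < n -> lo st' v.+1 = f v & t <= 3 * n + 3]).
Proof.
move=> hn hN hf; apply/wpP => /=; set st0 := setv _ vi 0.
apply: (@hrun_count B (fun i st' => hv st' vi = i /\ forall v, v < i ->
   lo st' v.+1 = f v) 0 n 2) => //.
- move=> i st' /andP[_ iN] [hi ar] [fv fa _].
  have e0 : hv st' vn = n by rewrite fv.
  have e2 : ha st' acls = ha st acls by rewrite fa.
  split; first by rewrite /= e0 hi; lia.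
  apply/wpP; rewrite /= hi e2 !addn1; split; first by lia.
  do 2!split=> //; move=> v; rewrite ltnS leq_eqVlt /updf eqSS => /orP[/eqP ->|vi'].
    by rewrite eqxx hf.
  by case: eqP => [|_]; [lia | exact: ar].
- move=> st' t [hi ar] [fv fa _]; rewrite subn0 => tl.
  have e0 : hv st' vn = n by rewrite fv.
  have e2 : hv st' vN = N by rewrite fv.
  split; first by rewrite /= e0 hi; lia.
  split; first by lia.
  by split=> //; lia.
Qed.

(** Each edge gives two arcs, so the sum is at most N + 2m. *)
Lemma sum_preds : \sum_(v <- iota 0 N) (size (preds v)).+1 <= 3 * N.
Proof.
rewrite iotaD big_cat /=.
have -> : \sum_(v <- iota 0 n) (size (preds v)).+1 =
    \sum_(v <- iota 0 n) count (fun i => tg i == v) (iota 0 m) + n.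
  rewrite -[X in _ + X](size_iota 0 n) -sum1_size -big_split /=.
  rewrite big_seq [RHS]big_seq; apply: eq_bigr => v; rewrite mem_iota => /andP[_ vn].
  by rewrite /preds /preds_upto vn size_map size_filter count_rev addn1.
have h := sum_count_uniq (iota 0 m) tg (iota_uniq 0 n); rewrite size_iota in h.
have : \sum_(v <- iota (0 + n) m) (size (preds v)).+1 <= \sum_(v <- iota (0 + n) m) 2.
  rewrite big_seq [leqRHS]big_seq; apply: leq_sum => v; rewrite mem_iota add0n.
  case/andP=> nv _; rewrite /preds /preds_upto; have /negbTE -> : ~~ (v < n) by lia.
  by case: ifP.
rewrite big_const_seq count_predT size_iota iter_addn_0; move: h.
move: (\sum_(v <- iota 0 n) _) (\sum_(v <- iota (0 + n) m) _) => a b; lia.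
Qed.

(** With L the logarithm, the potential contributes at most 100 times 3N(L + 1), and splits and
    pending classes at most (3L + 30) times 3N, which is below 90N(L + 1). *)
Lemma credit_init : 0 < N ->
  credit N preds 100 (3 * trunc_log 2 N + 30) init_classes <=
    400 * (N * (trunc_log 2 N).+1).
Proof.
move=> N0; rewrite /credit.
have h1 := pot_init sum_preds.
have h2 : count init_classes.2 (iota 0 N) <= N.
  by rewrite -[leqRHS](size_iota 0) count_size.
move: (pot _ _ _) (count _ _) (names _ _) (trunc_log _ _) h1 h2 => a b c d h1 h2.
have : (3 * d + 30) * (2 * (N - c) + b) <= (3 * d + 30) * (3 * N).
  by rewrite leq_mul2l; apply/orP; right; lia.
by nia.
Qed.

Lemma refine_correct st : 0 < N -> is_input st ->
  [/\ hv st vn = n, hv st vN = N & hv st vi = n] ->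
  (forall i, i < N -> ha st aperm i = i /\ ha st aposn i = i) ->
  half_ok N (ha st ahalf) -> ha st acend 0 = N ->
  [/\ hv st vz = 0, hv st va = 0, hv st vq = 0 & hv st vg = 0] ->
  (forall k, k \notin [:: aperm; aposn; ahalf; acend] -> ha st k = fun=> 0) ->
  hrun B (tree_set atw vz (HC 1);; read_edges;; colour_loop;; main_loop)%P st
    (fun st' t => exists2 z, arun z & (forall v, v < n -> ha st' acls v = z.1 v) /\
      t <= 600 * (N * (trunc_log 2 N).+1) + 20).
Proof.
move=> N0 inp [hn hN hi] hp hh he [z13 z16 z7 z15] za.
set L := trunc_log 2 N.
apply: hrun_seq; apply: hrun_frame.
have tr0 : tree_ok N (ha st atw) (fun=> 0) by rewrite za //; split.
have run := tree_set_correct B (k := atw) (z := vz) (HC 1) N0 isT isT hN z13 N0 hh tr0.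
apply: hrun_mono run => st1 t1 [tr1 t1le] /tree_set_frame[v1 a1 l1].
apply: hrun_seq; apply: hrun_frame.
have N1 : hv st1 vN = N by rewrite v1.
have h1 : half_ok N (ha st1 ahalf) by rewrite a1.
have inp1 : is_input st1 by move=> e em; rewrite l1; exact: inp.
have er0 : edges_read st1 0.
  split.
  - by rewrite v1 // hi addn0.
  - by rewrite v1 // z16.
  - by rewrite v1 // z7.
  - by rewrite v1 // z15.
  - by move=> w wN; rewrite a1 // za.
  - by move=> w wN; rewrite !a1 // (za aph) // /preds_upto ltn0 /=; case: ifP.
  - by move=> j; rewrite a1 // za.
  - by move=> j; rewrite !a1 // (za alh).
  - exists (fun=> 0); split=> //.
    by rewrite a1 // za //; split.
apply: hrun_mono (read_edges_correct er0 inp1 N1 h1) => st2 t2 [er t2le] [v2 a2 l2].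
have cx2 : conc N preds st2 init_classes.
  split.
  - by rewrite v2.
  - have -> : ha st2 acls = fun=> 0 by rewrite a2 // a1 // za.
    have -> : ha st2 aperm = ha st aperm by rewrite a2 // a1.
    have -> : ha st2 aposn = ha st aposn by rewrite a2 // a1.
    have -> : ha st2 acend = ha st acend by rewrite a2 // a1.
    split=> //=.
    + by move=> i iN; have [-> _] := hp i iN; have [_ ->] := hp i iN.
    + by move=> i iN; have [_ ->] := hp i iN; have [-> _] := hp i iN.
    + by move=> v vN; rewrite he; have [_ ->] := hp v vN; split; lia.
  - by move=> s; rewrite a2 // a1 // za.
  - rewrite a2 //; case: tr1 => TE TL; split=> // s sN; rewrite TL // /updf /=.
    by case: eqP => // ->.
  - by rewrite a2.
  - exact: wf_init.
  - exact: er_preds er.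
have z62 v : ha st2 acnt v = 0 by rewrite a2 // a1 // za.
have ll2 j : llist (ha st2 alv) (ha st2 aln) (ha st2 alh j)
    (if colour_upto m j then bucket_upto m j else [::]).
  have := er_bucket er j; case: ifP => // /negbT; rewrite /colour_upto has_count.
  by rewrite -bucket_size -eqn0Ngt size_eq0 => /eqP ->.
have c2_ge : 3 * L + 30 <= 3 * L + 30 by [].
have cm : count (fun e => colour_upto m (co e)) (iota 0 m) <= m.
  by rewrite -[leqRHS](size_iota 0) count_size.
apply: hrun_seq; apply: hrun_frame.
have run3 := colour_loop_correct 100 c2_ge N0 cm (fun j h => h) cx2 (er_tree er) ll2 z62.
apply: hrun_mono run3 => st3 t3 [y [cr cy id3 t3le]] _.
have run4 := main_loop_correct B preds_lt (leqnn 100) c2_ge N0 (leqnn _) cy id3.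
apply: hrun_mono run4 => st4 t4 [z [mr cz t4le]].
exists z; first by exists y.
split; first by move=> v vn; apply: part_cls (conc_part cz) _ _; lia.
have ci := credit_init N0; rewrite -/L in t1le t2le t3le ci *.
have : count (fun e => colour_upto m (co e)) (iota 0 m) * (3 * L + 90) <= m * (3 * L + 90).
  by rewrite leq_mul2r cm orbT.
move: t3le t4le ci; move: (credit _ _ _ _ _) (credit _ _ _ _ _) (count _ _ * _) => a b c.
have : m * (3 * L + 90) <= 90 * (N * L.+1) by nia.
have : m * (3 * L + 41) <= 41 * (N * L.+1) by nia.
have : L <= N * L.+1 by nia.
move: (N * L.+1) (m * (3 * L + 90)) (m * (3 * L + 41)) t2le => p q r; lia.
Qed.

Theorem colour_refinement_correct lo0 : lo0 0 = n -> lo0 1 = m ->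
  is_input (empty_hst lo0) ->
  hrun B colour_refinement (empty_hst lo0) (fun st t => exists z,
    [/\ 0 < N -> arun z, lo st 0 = N, forall v, v < n -> lo st v.+1 = z.1 v
      & t <= 2000 * nlogn N]).
Proof.
move=> h0 h1 inp.
apply: hrun_seq; apply: hrun_frame.
apply: hrun_mono (init_nodes_correct h0 h1) => st1 t1.
move=> [[hn hN hi] hp hh he t1le] [v1 a1 l1].
apply: hrun_seq.
have mid : hrun B (HIf ($vN) (tree_set atw vz (HC 1);; read_edges;; colour_loop;; main_loop) HSkip)%P st1
  (fun st2 t2 => exists2 z, (0 < N -> arun z) &
    (forall v, v < n -> ha st2 acls v = z.1 v) /\
      t2 <= 600 * (N * (trunc_log 2 N).+1) + 30).
  apply/wpP; split=> N0; last first.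
    have {}N0 : N = 0 by rewrite -hN.
    (* A dummy witness: without nodes nothing is claimed about it. *)
    by exists init_classes; [rewrite N0 | split=> [v vn|]; lia].
  apply/wpP; have {}N0 : hv st1 vN <> 0 := N0; rewrite hN in N0.
  have N0' : 0 < N by rewrite lt0n; apply/eqP.
  have inp1 : is_input st1 by move=> e em; rewrite l1 //; exact: inp.
  have zs : [/\ hv st1 vz = 0, hv st1 va = 0, hv st1 vq = 0 & hv st1 vg = 0].
    by rewrite !v1.
  have za k : k \notin [:: aperm; aposn; ahalf; acend] -> ha st1 k = fun=> 0.
    by rewrite !inE !negb_or => /and4P[? ? ? ?]; rewrite a1 //= !inE; lia.
  have run := refine_correct N0' inp1 (And3 hn hN hi) hp hh he zs za.
  apply: hrun_mono run => st2 t2 [z az [cz t2le]].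
  by exists z => //; split=> //; lia.
apply: hrun_frame; apply: hrun_mono mid => st2 t2 [z az [cz t2le]] [v2 a2 l2].
have n2 : hv st2 vn = n by rewrite v2.
have N2 : hv st2 vN = N by rewrite v2.
apply: hrun_mono (output_colours_correct n2 N2 cz) => st3 t3 [o1 o2 t3le].
exists z; split=> //; rewrite /nlogn.
case: (posnP N) => [N0|N0]; first by rewrite N0 in t1le t2le *; lia.
have : N <= N * (trunc_log 2 N).+1 by rewrite leq_pmulr.
(* From N = 2 on the logarithm is positive and absorbs the extra N; for N = 1 the summand 1 does. *)
have : N * (trunc_log 2 N).+1 <= 2 * (N * trunc_log 2 N) + 1.
  have [N1|N1] := leqP N 1; first by have -> : N = 1 by lia.
  have : 0 < trunc_log 2 N by rewrite trunc_log_gt0; lia.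
  by nia.
move: (N * _.+1) (N * trunc_log _ _) t2le => a b; lia.
Qed.

End Run.
End Graph.

(** * Stability, coarseness and canonicity *)

Section GraphFacts.

Variables (n m : nat) (sr tg co : nat -> nat).
Hypothesis sr_lt : forall e, e < m -> sr e < n.
Hypothesis tg_lt : forall e, e < m -> tg e < n.
Notation N := (n + m).
Notation P := (preds n m sr tg).
Notation arun := (arun n m sr tg co).

Lemma count_preds u w : w < N -> count_mem u (P w) =
  if w < n then (n <= u < N) && (tg (u - n) == w) else (sr (w - n) == u).
Proof.
move=> wN; rewrite /preds /preds_upto; case: ifP => wn.
  rewrite count_map count_filter count_rev.
  have [uN|uN] := boolP (n <= u < N); last first.
    rewrite (@eq_in_count _ _ pred0) ?count_pred0 // => i; rewrite mem_iota /= => im.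
    by case: eqP uN => //= <-; lia.
  have im : u - n \in iota 0 m by rewrite mem_iota; lia.
  have := count_uniq_mem (u - n) (iota_uniq 0 m); rewrite im /= => cu.
  case: (tg (u - n) =P w) => tw /=.
    rewrite -[RHS]/1 -cu; apply: eq_count => i /=; apply/andP/eqP => [[/eqP e _]|->]; first by lia.
    by rewrite tw eqxx; split=> //; apply/eqP; lia.
  rewrite (@eq_count _ _ pred0) ?count_pred0 // => i /=; apply/negP => /andP[/eqP e /eqP ti].
  by apply: tw; rewrite -ti; congr tg; lia.
have -> : w - n < m by lia.
by rewrite /= addn0.
Qed.

Lemma sum_preds_vertex (p : pred nat) v : v < n ->
  \sum_(w <- iota 0 N | p w) count_mem v (P w) =
  \sum_(e <- iota 0 m | p (n + e)) (sr e == v).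
Proof.
move=> vn; have -> : iota 0 N = iota 0 n ++ map (addn n) (iota 0 m).
  by rewrite -iotaDl addn0 iotaD.
rewrite big_cat big_map /=.
rewrite big_seq_cond big1 => [|w]; last first.
  by rewrite mem_iota => /andP[wn _]; rewrite count_preds; [case: ifP; lia | lia].
rewrite add0n big_seq_cond [RHS]big_seq_cond; apply: eq_bigr => e.
rewrite mem_iota => /andP[em _]; rewrite count_preds; last by lia.
by rewrite ltnNge leq_addr addKn.
Qed.

Lemma sum_preds_edge (p : pred nat) e : e < m ->
  \sum_(w <- iota 0 N | p w) count_mem (n + e) (P w) = p (tg e).
Proof.
move=> em; have tn := tg_lt em.
rewrite big_mkcond (bigD1_seq (tg e)) ?iota_uniq ?mem_iota //=; last by lia.
rewrite count_preds; last by lia.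
rewrite tn addKn eqxx leq_addr ltn_add2l em big_seq_cond big1 ?addn0; first by case: ifP.
move=> w; rewrite mem_iota => /andP[wN /eqP ne]; case: ifP => // _.
rewrite count_preds ?addKn; last by lia.
case: ifP => wn; first by case: eqP => [e'|]; [case: ne | rewrite andbF].
by have := @sr_lt (w - n); case: eqP; lia.
Qed.

Lemma arun_facts z : 0 < N -> arun z ->
  [/\ wf N z,
      forall u v, u < N -> v < N -> z.1 u = z.1 v ->
        forall r, dg N P z.1 r u = dg N P z.1 r v
    & forall u v, u < N -> v < N -> z.1 u = z.1 v ->
        forall j, colour_upto co m j -> edge_mark n co j u = edge_mark n co j v].
Proof.
move=> N0 [y cr mr].
have [wy sy ey] := crun_correct cr (wf_init N0) (@almost_stable_init N P _).
have [wz rz sz] := mrun_correct mr wy sy; split=> // u v uN vN /(rz u v uN vN) e.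
by have [_] := ey u v uN vN e.
Qed.

(** An edge node has a single arc, so its degree into the class of [tg e] tells whether its target
    lies there. The colours agree by the initial splitting. *)
Lemma arun_edges z e e' : arun z -> e < m -> e' < m ->
  z.1 (n + e) = z.1 (n + e') -> z.1 (tg e) = z.1 (tg e') /\ co e = co e'.
Proof.
move=> az em e'm ez; have N0 : 0 < N by lia.
have [_ st mk] := arun_facts N0 az.
have [eN e'N] : n + e < N /\ n + e' < N by lia.
split.
  have := st _ _ eN e'N ez (z.1 (tg e)).
  rewrite /dg !sum_preds_edge // eqxx.
  by case: eqP => // ->.
have := mk _ _ eN e'N ez (co e).
rewrite /edge_mark !addKn !leq_addr eqxx /=.
have ce : colour_upto co m (co e) by apply/hasP; exists e; rewrite ?mem_iota.
by move=> /(_ ce) /esym /eqP.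
Qed.

(** Edges of one class share colour and target class, so the counted edges form a union of edge
    classes; a vertex has as many arcs into an edge class as it has out-edges in it. *)
Lemma arun_stable z u v : arun z -> u < n -> v < n -> z.1 u = z.1 v ->
  forall c j,
  count (fun e => [&& sr e == u, z.1 (tg e) == c & co e == j]) (iota 0 m) =
  count (fun e => [&& sr e == v, z.1 (tg e) == c & co e == j]) (iota 0 m).
Proof.
move=> az un vn ez c j; have N0 : 0 < N by lia.
have [_ st _] := arun_facts N0 az.
have cE w : count (fun e => [&& sr e == w, z.1 (tg e) == c & co e == j]) (iota 0 m) =
    \sum_(e <- iota 0 m | (z.1 (tg e) == c) && (co e == j)) (sr e == w).
  rewrite -sum1_count big_mkcond [RHS]big_mkcond; apply: eq_bigr => e _.
  by case: (sr e == w) => //=; case: ifP.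
rewrite !cE; apply: (sum_fibres (b := fun e => z.1 (n + e))).
  move=> e e'; rewrite !mem_iota => /andP[_ em] /andP[_ e'm] ee.
  by have [-> ->] := arun_edges az em e'm ee.
move=> k; have := st u v _ _ ez k.
by rewrite /dg !sum_preds_vertex //; apply; lia.
Qed.

Lemma arun_coarsest z (be : nat -> nat) : arun z -> 0 < N ->
  (forall u v, u < n -> v < n -> be u = be v -> forall c j,
    count (fun e => [&& sr e == u, be (tg e) == c & co e == j]) (iota 0 m) =
    count (fun e => [&& sr e == v, be (tg e) == c & co e == j]) (iota 0 m)) ->
  forall u v, u < n -> v < n -> be u = be v -> z.1 u = z.1 v.
Proof.
move=> [y cr mr] N0 bs.
(* A stable vertex colouring extends to the subdivided digraph: an edge is labelled by its colour
   and the class of its target. The boolean keeps vertices and edges apart, and the 0 is only a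
   filler. *)
pose b w := if w < n then (true, be w, 0) else (false, be (tg (w - n)), co (w - n)).
have bst u v : u < N -> v < N -> b u = b v -> forall k,
  \sum_(w <- iota 0 N | b w == k) count_mem u (P w) =
  \sum_(w <- iota 0 N | b w == k) count_mem v (P w).
  move=> uN vN; rewrite /b; case: ltnP => un; case: ltnP => vn //;
    [move=> [e1] k | move=> [e1 e2] k].
    rewrite !sum_preds_vertex //.
    case: k => [[[] c] j].
      by rewrite !big_pred0 // => e; rewrite ltnNge leq_addr.
    have cE w : \sum_(e <- iota 0 m | (if n + e < n then (true, be (n + e), 0) else
        (false, be (tg (n + e - n)), co (n + e - n))) == (false, c, j)) (sr e == w) =
        count (fun e => [&& sr e == w, be (tg e) == c & co e == j]) (iota 0 m).
      rewrite -sum1_count big_mkcond [RHS]big_mkcond; apply: eq_bigr => e _.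
      rewrite ltnNge leq_addr addKn /= !xpair_eqE /=.
      by case: (sr e == w); case: (be _ == c); case: (co e == j).
    by rewrite !cE; exact: bs.
  have eu : u = n + (u - n) by lia.
  have ev : v = n + (v - n) by lia.
  rewrite {1}eu {1}ev !sum_preds_edge; try by lia.
  by rewrite !tg_lt ?e1 //; lia.
have cy : coarser N b y.1.
  apply: (coarser_crun cr) => // j u v uN vN; rewrite /b /edge_mark.
  by case: ltnP => un; case: ltnP => vn // [_ ->].
have cz := coarser_mrun bst mr cy.
move=> u v un vn e; apply: cz; try by lia.
by rewrite /b un vn e.
Qed.

End GraphFacts.

(** * Isomorphic numbered digraphs give the same names *)

Section GraphIso.

Variables (n m : nat) (sr tg co sr' tg' co' sv se : nat -> nat).
Hypothesis sr_lt : forall e, e < m -> sr e < n.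
Hypothesis tg_lt : forall e, e < m -> tg e < n.
Hypothesis sv_lt : forall v, v < n -> sv v < n.
Hypothesis se_lt : forall e, e < m -> se e < m.
Hypothesis sv_inj : forall u v, u < n -> v < n -> sv u = sv v -> u = v.
Hypothesis se_inj : forall e e', e < m -> e' < m -> se e = se e' -> e = e'.
Hypothesis sr_se : forall e, e < m -> sr' (se e) = sv (sr e).
Hypothesis tg_se : forall e, e < m -> tg' (se e) = sv (tg e).
Hypothesis co_se : forall e, e < m -> co' (se e) = co e.
Notation N := (n + m).

Lemma arun_sim z z' v : 0 < N -> arun n m sr tg co z -> arun n m sr' tg' co' z' ->
  v < n -> z'.1 (sv v) = z.1 v.
Proof.
move=> N0 [y cr mr] [y' cr' mr'] vn.
pose sg w := if w < n then sv w else n + se (w - n).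
have sgN w : w < N -> sg w < N.
  move=> wN; rewrite /sg; case: (ltnP w n) => wn; first by have := sv_lt wn; lia.
  by have := @se_lt (w - n); lia.
have sgn w : w < N -> (sg w < n) = (w < n).
  move=> wN; rewrite /sg; case: (ltnP w n) => wn; first exact: sv_lt.
  by rewrite ltnNge leq_addr.
have sgI u w : u < N -> w < N -> sg u = sg w -> u = w.
  move=> uN wN e; have := sgn u uN; have := sgn w wN; rewrite -e => ->.
  move: e; rewrite /sg; case: (ltnP u n) => un; case: (ltnP w n) => wn // e _; first exact: sv_inj.
  by have := @se_inj (u - n) (w - n); move/addnI: e => e; lia.
have sgP u w : u < N -> w < N ->
    count_mem (sg u) (preds n m sr' tg' (sg w)) = count_mem u (preds n m sr tg w).
  move=> uN wN; rewrite !count_preds ?sgN // sgn //; case: ifP => wn.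
    rewrite leqNgt sgn // -leqNgt uN !andbT; case: (leqP n u) => //= un.
    have um : u - n < m by lia.
    rewrite /sg ltnNge un /= wn addKn tg_se //; congr nat_of_bool.
    by apply/eqP/eqP => [/sv_inj->//|->//]; exact: tg_lt.
  have wm : w - n < m by lia.
  rewrite {1}/sg wn addKn sr_se //; congr nat_of_bool.
  have sn := sr_lt wm; apply/eqP/eqP => [e|<-]; last by rewrite /sg sn.
  by apply: sgI => //; [lia | rewrite -e /sg sn].
have wi := wf_init N0.
have si : sim N sg init_classes init_classes by [].
have CC : colour_upto co m =1 colour_upto co' m.
  move=> j; have pe : perm_eq (map se (iota 0 m)) (iota 0 m).
    by apply: perm_sg => //; exact: se_inj.
  rewrite /colour_upto -[RHS](perm_has _ pe) has_map.
  apply: eq_in_has => e; rewrite mem_iota => /andP[_ em] /=; by rewrite co_se.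
have mm j w : w < N -> edge_mark n co' j (sg w) = edge_mark n co j w.
  move=> wN; rewrite /edge_mark leqNgt sgn // -leqNgt; case: (leqP n w) => //= wn.
  by rewrite /sg ltnNge wn /= addKn co_se //; lia.
have sy := sim_crun sgN sgI cr cr' CC (fun j w => mm j w) si wi wi.
have [wy _ _] := crun_correct cr wi (@almost_stable_init N (preds n m sr tg) _).
have [wy' _ _] := crun_correct cr' wi (@almost_stable_init N (preds n m sr' tg') _).
have [h _] := sim_mrun sgN sgI sgP mr mr' sy wy wy'.
by have := h v; rewrite /sg vn; apply; lia.
Qed.

End GraphIso.

(** * The RAM program and its specification on listings *)

Definition narrays := 17.

(** Compiled code expects n and m in registers 0 and 1, since [base_expr] refers to them; hence the
    two loads in front. *)
Definition colour_program : cmd :=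
  Seq (Assign 0 (Defs.Mem (Cst 0))) (Seq (Assign 1 (Defs.Mem (Cst 1)))
    (ccmd narrays colour_refinement)).

Section Listings.

Variables (p : nat) (G : ecdigraph p) (L : listing G).
Notation n := #|vertex G|.
Notation m := #|edge G|.

Definition vnum (v : vertex G) := index v (vlist L).
Definition lsrc i := nth 0 [seq vnum (src e) | e <- elist L] i.
Definition ltgt i := nth 0 [seq vnum (tgt e) | e <- elist L] i.
Definition lcol i := nth 0 [seq nat_of_ord (ecol e) | e <- elist L] i.

Lemma size_vlist : size (vlist L) = n.
Proof. by rewrite (perm_size (vlistP L)) cardE. Qed.

Lemma size_elist : size (elist L) = m.
Proof. by rewrite (perm_size (elistP L)) cardE. Qed.

Lemma mem_vlist v : v \in vlist L.
Proof. by rewrite (perm_mem (vlistP L)) mem_enum. Qed.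

Lemma uniq_vlist : uniq (vlist L).
Proof. by rewrite (perm_uniq (vlistP L)) enum_uniq. Qed.

Lemma vnum_lt v : vnum v < n.
Proof. by rewrite -size_vlist index_mem mem_vlist. Qed.

Lemma vnum_inj : injective vnum.
Proof.
move=> u v e; rewrite -(nth_index u (mem_vlist u)) -(nth_index u (mem_vlist v)).
by rewrite -[index u _]/(vnum u) e.
Qed.

Lemma vnum_surj i : i < n -> exists v, vnum v = i.
Proof.
rewrite -size_vlist => iv; case E: (vlist L) iv => [//|v0 s] iv.
exists (nth v0 (vlist L) i); rewrite /vnum index_uniq ?uniq_vlist //.
by rewrite E.
Qed.

Lemma nth_triples (T : Type) (s : seq T) (a b c : T -> nat) i :
  let t := flatten [seq [:: a x; b x; c x] | x <- s] in
  [/\ nth 0 t (3 * i) = nth 0 (map a s) i, nth 0 t (3 * i).+1 = nth 0 (map b s) i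
    & nth 0 t (3 * i).+2 = nth 0 (map c s) i].
Proof.
elim: s i => [|x s IH] i; first by split; rewrite [flatten _]/= [map _ _]/= !nth_nil.
by case: i => [//|i]; rewrite mulnS; exact: IH.
Qed.

Lemma size_input : size (input L) = 3 * m + 3.
Proof.
rewrite /input size_cat /= -size_elist.
by elim: (elist L) => //= e s IH; rewrite !addnS in IH *; lia.
Qed.

Lemma elistE (T : Type) (x0 : T) (f : edge G -> T) i : i < m ->
  exists e, nth x0 (map f (elist L)) i = f e.
Proof.
rewrite -size_elist => im; case E: (elist L) im => [//|e0 s] im.
by exists (nth e0 (e0 :: s) i); rewrite (nth_map e0).
Qed.

Lemma lsrc_lt i : i < m -> lsrc i < n.
Proof. by move=> im; rewrite /lsrc; have [e ->] := elistE 0 (fun e => vnum (src e)) im; exact: vnum_lt. Qed.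

Lemma ltgt_lt i : i < m -> ltgt i < n.
Proof. by move=> im; rewrite /ltgt; have [e ->] := elistE 0 (fun e => vnum (tgt e)) im; exact: vnum_lt. Qed.

Lemma input_is_input : is_input m lsrc ltgt lcol (empty_hst (fun a => nth 0 (input L) a)).
Proof.
move=> i im /=; rewrite /input.
have [h1 h2 h3] := nth_triples (elist L) (fun e => vnum (src e)) (fun e => vnum (tgt e))
  (fun e => nat_of_ord (ecol e)) i.
have e1 : 3 * i + 3 = (3 * i).+3 by rewrite addnC.
have e2 : 3 * i + 4 = (3 * i).+4 by rewrite addnC.
have e3 : 3 * i + 5 = (3 * i).+1.+4 by rewrite addnC.
by rewrite e1 e2 e3 /=.
Qed.

Lemma count_elist (q : nat -> nat -> nat -> bool) :
  count (fun i => q (lsrc i) (ltgt i) (lcol i)) (iota 0 m) =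
  #|[set e : edge G | q (vnum (src e)) (vnum (tgt e)) (ecol e)]|.
Proof.
rewrite cardE /enum_mem size_filter -enumT.
rewrite (eq_count (a2 := fun e => q (vnum (src e)) (vnum (tgt e)) (ecol e))); last first.
  by move=> e /=; rewrite inE.
have /permP <- := elistP L; rewrite -size_elist.
rewrite /lsrc /ltgt /lcol; case E: (elist L) => [//|e0 s]; rewrite -E.
rewrite -[in RHS](take_size (elist L)) -(map_nth_iota0 e0) // count_map.
apply: eq_in_count => i; rewrite mem_iota => /andP[_ im] /=.
by rewrite !(nth_map e0).
Qed.

Lemma bounded_input : bounded (n + m + p + 2) (init_state (input L)).
Proof.
split=> //= a; have [la|la] := ltnP a (size (input L)); last by rewrite nth_default.
have : all (fun x => x <= n + m + p + 2) (input L).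
  rewrite /input /=; apply/and4P; split; try by lia.
  apply/allP=> x /flattenP[s /mapP[e _ ->]].
  have arith i j k : [/\ i <= i + j + k + 2, j <= i + j + k + 2 & k <= i + j + k + 2].
    by split; lia.
  have [le1 _ le3] := arith n m p.
  rewrite !inE => /or3P[] /eqP ->.
  - by apply: leq_trans (ltnW (vnum_lt (src e))) le1.
  - by apply: leq_trans (ltnW (vnum_lt (tgt e))) le1.
  - by apply: leq_trans (ltnW (ltn_ord (ecol e))) le3.
by move/allP; apply; exact: mem_nth.
Qed.

End Listings.

Lemma program_spec : exists k K, forall p (G : ecdigraph p) (L : listing G),
  exists s t z, [/\ exec (word_bound k G) colour_program (init_state (input L)) s t,
    0 < #|vertex G| + #|edge G| ->
      arun #|vertex G| #|edge G| (lsrc L) (ltgt L) (lcol L) z,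
    memory s 0 = #|vertex G| + #|edge G|,
    forall v, memory s (vnum L v).+1 = z.1 (vnum L v)
    & t <= K * nlogn (#|vertex G| + #|edge G|)].
Proof.
(* [Q] hides the weight of the whole program, so that the arithmetic below treats it as a symbol. *)
have [Q] : exists Q, cmd_weight (ccmd narrays colour_refinement) <= Q by eexists.
rewrite /colour_program; move: (erefl (wfc narrays colour_refinement)).
rewrite {2}[wfc _ _](_ : _ = true) //.
move: (@colour_refinement_correct) => CRC.
set prog := ccmd _ _ => wfP Qle.
(* With X = n + m + p + 2 and [t] at most 2000 X^2, all numbers are at most (2001 Q + 4) X^2, and a
   factor a is at most X^a. The 6 in the time bound is the cost of the two loads. *)
exists (Q * 2001 + 6), (Q * 2000 + 6) => p G L.
have Wb : word_bound (Q * 2001 + 6) G = (#|vertex G| + #|edge G| + p + 2) ^ (Q * 2001 + 6) by [].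
set W := word_bound _ _ in Wb *.
have sz := size_input L; have bs0 := bounded_input L.
have in0 : nth 0 (input L) 0 = #|vertex G| by [].
have in1 : nth 0 (input L) 1 = #|edge G| by [].
have vl := vnum_lt L.
have [st [t [x [z [az h0 hz tle]]]]] := CRC _ _ _ _ _ (@lsrc_lt _ _ L) (@ltgt_lt _ _ L)
  _ (leqnn _) (fun a => nth 0 (input L) a) erefl erefl (input_is_input L).
move: Wb sz bs0 in0 in1 vl az h0 hz tle x.
move: #|vertex G| #|edge G| => n m; set X := n + m + p + 2 => Wb sz bs0 in0 in1 vl az h0 hz tle x.
have nle : nlogn (n + m) <= X ^ 2.
  have : trunc_log 2 (n + m) <= n + m.
    have [->|N0] := posnP (n + m); first by rewrite trunc_log0.
    by apply: leq_trans (trunc_logP (isT : 1 < 2) N0); apply: ltnW; exact: ltn_expl.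
  by rewrite /nlogn /X; nia.
have X2 : 1 < X by rewrite /X; lia.
have QW : Q * (X + t) + 4 * X <= W.
  rewrite Wb; apply: (@leq_trans ((Q * 2001 + 4) * X ^ 2)).
    have : X <= X ^ 2 by nia.
    by nia.
  have le a : a * X ^ 2 <= X ^ (a + 2).
    by rewrite expnD leq_mul2r (ltnW (ltn_expl _ X2)) orbT.
  by have := le (Q * 2001 + 4); rewrite -addnA.
move: (input L) sz bs0 in0 in1 x => inp sz bs0 in0 in1 x.
set s0 := init_state _ in bs0 *.
set s2 := set_reg (set_reg s0 0 n) 1 m.
have si : simul narrays n m s2 (empty_hst (nth 0 inp)).
  by split=> //= k i _; rewrite nth_default // sz; lia.
have nX : n <= X /\ m <= X by rewrite /X; split; lia.
have bs : bounded X s2.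
  by apply: bounded_set_reg; [case: nX | apply: bounded_set_reg; [case: nX |]].
have [|s' [t' [x' t'le si' _]]] := ccmd_correct (W := W) x wfP Qle si (ltnW X2) bs.
  by lia.
exists s', (3 + (3 + t')), z; split=> //.
- apply: ExecSeq.
    rewrite -[3]/((cost (Defs.Mem (Cst 0))).+1); apply: ExecAssign.
    by rewrite /= in0; lia.
  rewrite /= in0; apply: ExecSeq x'.
  have := @ExecAssign W (set_reg s0 0 n) 1 (Defs.Mem (Cst 1)).
  by rewrite /= in1; apply; lia.
- by case: si' => _ _ _ _ ->; [rewrite h0 | lia].
- move=> v; have vn := vl v; case: si' => _ _ _ _ ->; last by lia.
  by rewrite hz.
- have : Q * t <= Q * (2000 * nlogn (n + m)) by rewrite leq_mul2l tle orbT.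
  have : 0 < nlogn (n + m) by rewrite /nlogn; lia.
  by nia.
Qed.

(** * The names of a run form a coarsest stable colouring *)

Section Correctness.

Variables (p : nat) (G : ecdigraph p) (L : listing G).
Notation n := #|vertex G|.
Notation m := #|edge G|.

Lemma outdegE l (al : vertex G -> 'I_l) (f : nat -> nat) :
  (forall v, al v = f (vnum L v) :> nat) -> forall j v i,
  outdeg j v (colour_class al i) =
  count (fun e => [&& lsrc L e == vnum L v, f (ltgt L e) == i & lcol L e == j]) (iota 0 m).
Proof.
move=> alE j v i.
rewrite (count_elist L (fun a b c => [&& a == vnum L v, f b == i & c == j])).
apply: eq_card => e; rewrite !inE (inj_eq (@vnum_inj _ _ L)); congr [&& _, _ & _].
by rewrite -(alE (tgt e)).
Qed.

Lemma coarsest_stable z l (al : vertex G -> 'I_l) :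
  (0 < n + m -> arun n m (lsrc L) (ltgt L) (lcol L) z) ->
  (forall v, al v = z.1 (vnum L v) :> nat) -> coarsest_edge_colour_stable al.
Proof.
move=> az alE; have pos (v : vertex G) : 0 < n + m.
  by have := vnum_lt L v; case: n.
split=> [u v uv j i|l' be bes].
  rewrite !(outdegE alE); apply: (arun_stable (@lsrc_lt _ _ L) (@ltgt_lt _ _ L) (az (pos u)));
    try exact: vnum_lt.
  by rewrite -!alE uv.
pose f i := nth 0 [seq val (be v) | v <- vlist L] i.
have beE v : be v = f (vnum L v) :> nat.
  by rewrite /f (nth_map v) ?nth_index ?index_mem ?mem_vlist.
have f_lt e : e < m -> f (ltgt L e) < l'.
  move=> em; have [v <-] := vnum_surj L (ltgt_lt L em).
  by rewrite -beE.
have c_lt e : e < m -> lcol L e < p.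
  by move=> em; rewrite /lcol; have [x ->] := elistE L 0 (fun e => nat_of_ord (ecol e)) em.
have key u v : be u = be v -> al u = al v.
  move=> uv; apply: val_inj; rewrite /= !alE.
  apply: (arun_coarsest (@lsrc_lt _ _ L) (@ltgt_lt _ _ L) (az (pos u)) (pos u) (be := f));
    try exact: vnum_lt; last by rewrite -!beE uv.
  move=> a b an bn; have [u' <-] := vnum_surj L an; have [v' <-] := vnum_surj L bn.
  rewrite -!beE => /val_inj e c j.
  (* [arun_coarsest] asks for all numbers [c] and [j], stability of [be] speaks only of its
     palettes; outside them both counts are 0. *)
  have [cl|cl] := ltnP c l'; last first.
    rewrite !(@eq_in_count _ _ pred0) // => i; rewrite mem_iota => /andP[_ im] /=;
    by have := f_lt i im; case: eqP => //= _; case: eqP => //; lia.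
  have [jp|jp] := ltnP j p; last first.
    rewrite !(@eq_in_count _ _ pred0) // => i; rewrite mem_iota => /andP[_ im] /=;
    by have := c_lt i im; rewrite andbC; case: eqP => //=; lia.
  have := bes u' v' e (Ordinal jp) (Ordinal cl).
  by rewrite !(outdegE beE).
move=> X /imsetP[x _ ->]; exists [set y in [set: vertex G] | al x == al y].
  by apply: imset_f; rewrite inE.
by apply/subsetP=> y; rewrite !inE => /eqP /key -> /=.
Qed.

End Correctness.

(** * Independence of the listing and of the isomorphic copy *)

Section Canonicity.

Variables (p : nat) (G G' : ecdigraph p) (L : listing G) (L' : listing G').
Variable h : vertex G -> vertex G'.
Hypothesis iso : isomorphism h.

Lemma iso_inj : injective h. Proof. by case: iso => /bij_inj. Qed.

Lemma iso_order : #|vertex G'| = #|vertex G|.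
Proof. by case: iso => /bij_eq_card. Qed.

Let T := [seq (vnum L' (h (src e)), vnum L' (h (tgt e)), nat_of_ord (ecol e)) | e <- elist L].
Let T' := [seq (vnum L' (src e), vnum L' (tgt e), nat_of_ord (ecol e)) | e <- elist L'].

Lemma count_image (j : 'I_p) u v :
  count_mem (vnum L' (h u), vnum L' (h v), nat_of_ord j) T = mult j u v.
Proof.
rewrite /T count_map /mult cardE /enum_mem size_filter -enumT.
have /permP -> := elistP L; apply: eq_count => e.
rewrite /= inE !xpair_eqE !(inj_eq (@vnum_inj _ _ L')) !(inj_eq iso_inj) -andbA.
by [].
Qed.

Lemma count_target (j : 'I_p) u v :
  count_mem (vnum L' u, vnum L' v, nat_of_ord j) T' = mult j u v.
Proof.
rewrite /T' count_map /mult cardE /enum_mem size_filter -enumT.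
have /permP -> := elistP L'; apply: eq_count => e.
by rewrite /= inE !xpair_eqE !(inj_eq (@vnum_inj _ _ L')) -andbA.
Qed.

(** An isomorphism acts on vertices and only preserves multiplicities. Equality of the multisets of
    triples of source, target and colour is what provides a bijection of the edges. *)
Lemma perm_triples : perm_eq T T'.
Proof.
apply/allP => x xT.
have [[u v] [j ->]] : exists uv : vertex G * vertex G, exists j : 'I_p,
    x = (vnum L' (h uv.1), vnum L' (h uv.2), nat_of_ord j).
  case: iso => -[h' hK h'K] _.
  move: xT; rewrite mem_cat => /orP[] /mapP[e _ ->].
    by exists (src e, tgt e), (ecol e).
  by exists (h' (src e), h' (tgt e)), (ecol e); rewrite /= !h'K.
by rewrite /= count_image count_target; case: iso => _ ->.
Qed.

Lemma iso_size : #|edge G'| = #|edge G|.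
Proof.
by have := perm_size perm_triples; rewrite !size_map !size_elist.
Qed.

Lemma arun_iso z z' v : arun #|vertex G| #|edge G| (lsrc L) (ltgt L) (lcol L) z ->
  arun #|vertex G'| #|edge G'| (lsrc L') (ltgt L') (lcol L') z' ->
  z.1 (vnum L v) = z'.1 (vnum L' (h v)).
Proof.
rewrite iso_order iso_size => az az'.
pose x0 := (0, 0, 0).
(* [Is] assigns to each edge number of [G] the number of a matching edge of [G']; parallel edges of
   one colour may be matched arbitrarily. *)
have /(perm_iotaP x0) [Is pIs TE] := perm_triples.
have sT' : size T' = #|edge G| by rewrite size_map size_elist iso_size.
have sIs : size Is = #|edge G| by rewrite (perm_size pIs) size_iota sT'.
pose sv i := vnum L' (h (nth v (vlist L) i)).
pose se i := nth 0 Is i.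
have svE u : sv (vnum L u) = vnum L' (h u) by rewrite /sv nth_index // mem_vlist.
have se_lt e : e < #|edge G| -> se e < #|edge G|.
  move=> em; have := mem_nth 0 (_ : e < size Is); rewrite sIs (perm_mem pIs) mem_iota sT'.
  by apply.
have tri e : e < #|edge G| ->
    (lsrc L' (se e), ltgt L' (se e), lcol L' (se e)) = (sv (lsrc L e), sv (ltgt L e), lcol L e).
  move=> em.
  have -> : (lsrc L' (se e), ltgt L' (se e), lcol L' (se e)) = nth x0 T' (se e).
    have := se_lt e em; rewrite -iso_size -(size_elist L') /lsrc /ltgt /lcol /T'.
    case: (elist L') => [//|e0 s] es; by rewrite !(nth_map e0).
  have <- : nth x0 T e = nth x0 T' (se e) by rewrite TE (nth_map 0) ?sIs.
  rewrite /lsrc /ltgt /lcol /T; move: em; rewrite -(size_elist L).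
  by case: (elist L) => [//|e0 s] es; rewrite !(nth_map e0) // !svE.
rewrite -svE; symmetry.
apply: (@arun_sim _ _ _ _ _ _ _ _ sv se _ _ _ se_lt _ _ _ _ _ _ _ _ _ az az').
- exact: lsrc_lt.
- exact: ltgt_lt.
- by move=> i _; rewrite -iso_order; exact: vnum_lt.
- move=> a b an bn; have [u <-] := vnum_surj L an; have [w <-] := vnum_surj L bn.
  by rewrite !svE => /vnum_inj /iso_inj ->.
- move=> e e' em e'm /eqP; rewrite /se nth_uniq ?sIs // => [/eqP //|].
  by rewrite (perm_uniq pIs) iota_uniq.
- by move=> e /tri [].
- by move=> e /tri [].
- by move=> e /tri [].
- by have := vnum_lt L v; case: #|_|.
- exact: vnum_lt.
Qed.

End Canonicity.

Theorem theorem4 :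
  exists (c : cmd) (k K : nat),
    canonical c k /\
    forall (p : nat) (G : ecdigraph p) (L : listing G), 0 < p ->
    exists (t l : nat) (alpha : vertex G -> 'I_l),
      [/\ computes_colouring c k L t alpha,
          coarsest_edge_colour_stable alpha
        & t <= K * nlogn (#|vertex G| + #|edge G|)].
Proof.
have [k [K spec]] := program_spec.
have pos p (G : ecdigraph p) (L : listing G) (v : vertex G) : 0 < #|vertex G| + #|edge G|.
  by have := vnum_lt L v; case: #|_|.
exists colour_program, k, K; split.
  move=> p G G' L L' t t' l l' be be' h _ [s1 [x1 _ beE]] [s2 [x2 _ beE']] iso v.
  have [s [T [z [x az _ cz _]]]] := spec p G L.
  have [s' [T' [z' [x' az' _ cz' _]]]] := spec p G' L'.
  (* [canonical] quantifies over all halting computations; determinism identifies them with those of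
     the specification. *)
  have [es _] := exec_det x1 x; have [es' _] := exec_det x2 x'; subst s1 s2.
  have <- := beE v; have <- := beE' (h v); rewrite -/(vnum L v) -/(vnum L' (h v)) cz cz'.
  by apply: (arun_iso iso); [apply: az; exact: pos L v | apply: az'; exact: pos L' (h v)].
move=> p G L _; have [s [t [z [x az h0 cz tle]]]] := spec p G L.
have z_lt v : z.1 (vnum L v) < #|vertex G| + #|edge G|.
  have N0 := pos p G L v.
  have [wz _ _] := arun_facts N0 (az N0).
  by apply: (wf_lt wz); apply: leq_trans (vnum_lt L v) (leq_addr _ _).
exists t, (#|vertex G| + #|edge G|), (fun v => Ordinal (z_lt v)); split=> //.
  by exists s.
exact: (coarsest_stable az).
Qed.
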